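(* There exists an absolute constant $C$ such that for every $\Delta$ and every bipartite $\Delta$-bounded graph sequence $\mathcal{F}=\{F_1,F_2,\ldots\}$, the vertex set of every $2$-edge-colored complete graph can be partitioned into at most $2^{C\Delta}$ vertex-disjoint monochromatic copies of graphs from $\mathcal{F}$.
   Context: A sequence $\mathcal{F}=\{F_1,F_2,\ldots\}$ of graphs is $\Delta$-bounded if for every $n$, $F_n$ is a graph on exactly $n$ vertices with maximum degree at most $\Delta$; it is bipartite if every $F_n$ is bipartite. A monochromatic copy of a graph $F$ in an edge-colored complete graph is a subgraph isomorphic to $F$ all of whose edges have the same color. *)

(* Defs.v *)
From mathcomp Require Import all_boot.

Set Implicit Arguments.
Unset Strict Implicit.
Unset Printing Implicit Defensive.

Record sgraph (V : finType) := SGraph {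
  adj :> rel V;
  adj_sym : symmetric adj;
  adj_irrefl : irreflexive adj }.

Definition degree (V : finType) (G : sgraph V) (x : V) : nat :=
  #|[set y | G x y]|.

Definition max_degree (V : finType) (G : sgraph V) : nat :=
  \max_(x : V) degree G x.

Definition bipartite (V : finType) (G : sgraph V) : Prop :=
  exists side : V -> bool, forall x y, G x y -> side x != side y.

(* The additional term at index 0 is the graph with no vertices, which
   satisfies every condition imposed below. *)
Definition graph_sequence := forall n : nat, sgraph 'I_n.

Definition bounded_sequence (Delta : nat) (F : graph_sequence) : Prop :=
  forall n, max_degree (F n) <= Delta.

Definition bipartite_sequence (F : graph_sequence) : Prop :=
  forall n, bipartite (F n).

(* Subgraphs, not necessarily induced or spanning, of the complete graph on T. *)
Record subgraph (T : finType) := Subgraph {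
  vset : {set T};
  sub_adj : sgraph T;
  sub_adj_vset : forall x y, sub_adj x y -> (x \in vset) && (y \in vset) }.

Definition is_copy (V T : finType) (G : sgraph V) (H : subgraph T) : Prop :=
  exists f : V -> T,
    [/\ injective f, f @: [set: V] = vset H
      & forall x y, sub_adj H (f x) (f y) = G x y].

(* The colour of the edge xy is c x y = c y x; diagonal values are irrelevant. *)
Record edge_coloring (T : finType) := EdgeColoring {
  color :> T -> T -> bool;
  color_sym : forall x y, color x y = color y x }.

Definition monochromatic (T : finType) (c : edge_coloring T) (H : subgraph T) :
    Prop :=
  exists b : bool, forall x y, sub_adj H x y -> c x y = b.

Definition mono_copy_from (T : finType) (c : edge_coloring T)
    (F : graph_sequence) (H : subgraph T) : Prop :=
  (exists2 n, 0 < n & is_copy (F n) H) /\ monochromatic c H.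

Definition vertex_partition (T : finType) (k : nat) (H : 'I_k -> subgraph T) :
    Prop :=
  (forall i j, i != j -> [disjoint vset (H i) & vset (H j)]) /\
  \bigcup_(i < k) vset (H i) = [set: T].

(* Main.v *)
(* Dependent random choice puts a monochromatic copy of F_j into every set of at
   least 2^(10D) j vertices. Greedily removing such copies shrinks the vertex set by
   a factor rho at the cost of 2^O(D) log(1/rho) copies, so even the very bad ratio
   rho = 2^(-2^O(D)) is affordable.

   One first sets aside a large regular pair (A, B) of density at least 1/2 in one
   colour, found by density increment at polynomial regularity q^O(1) for q = 2^-D,
   and tiles the rest greedily down to a set L that is tiny compared to A and B. The
   vertices of L are either distributed between A and B or covered, together with
   part of A, in the other colour.

   The resulting balanced pair is covered by exactly two copies of F_m: since F_m is
   bipartite, a bijective embedding of its double cover into the pair consists of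
   two copies. That embedding is obtained by placing one side by a random
   permutation, repairing the few badly placed vertices by swaps, and placing the
   other side by Hall's theorem. *)

Require Import Defs.
From mathcomp Require Import all_boot all_order all_algebra all_fingroup.
From mathcomp Require Import zify ring lra.

Set Implicit Arguments.
Unset Strict Implicit.
Unset Printing Implicit Defensive.

(** The two sides of [F n] may differ greatly in size, so a single copy need not fill a balanced
    pair. Both sides of the double cover have exactly n vertices, which is why every large embedding
    here maps the double cover. A bijective embedding has no spare vertices: atypical vertices of A
    must be used too, and they spoil every position adjacent to theirs in the double cover. Being
    few, they can trade places with vertices at well-separated positions, provided that those
    positions tolerate an arbitrary vertex of A. Minimum degrees on both sides ensure that a random
    permutation offers many tolerant positions. Vertices absorbed into the other side lie outside
    the set [B0] on which regularity is known and receive reserved positions instead. Only one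
    regular pair is needed, never a regular partition, so it suffices to bound the densities of
    subpairs from above. With q = 2^-D, one factor q absorbs a factor 2D. Constants therefore only
    have to be ordered as powers of q, with generous gaps: minimum degrees near q^5 m, successful
    trials near q^16 m, errors from q^44 m down to q^50 m. *)

(** * Hall's marriage theorem *)

(** Halmos-Vaughan induction: a nonempty proper [S] with only #|S| available values splits the
    problem into [S] and [D :\: S]. If there is none, every such set has a value to spare, so [i0]
    may take any of its values. [j0] is a default value for the empty domain. *)
Lemma hall_marriage (I J : finType) (j0 : J) (G : I -> {set J}) (D : {set I}) :
  (forall S : {set I}, S \subset D -> #|S| <= #|\bigcup_(i in S) G i|) ->
  exists2 g : I -> J, {in D &, injective g} & forall i, i \in D -> g i \in G i.
Proof.
have [n] := ubnP #|D|; elim: n => // n IHn in D G * => leDn hallD.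
have [D0|[i0 i0D]] := set_0Vmem D.
  by exists (fun=> j0) => [i j|i]; rewrite D0 inE.
case: (pickP (fun S : {set I} => [&& S \proper D, S != set0
    & #|\bigcup_(i in S) G i| <= #|S|])) => [S /and3P[ltSD S0 tight]|slack].
- have sSD := proper_sub ltSD.
  have [|S' sS'|g1 g1_inj g1G] := IHn S G.
  + by rewrite -ltnS (leq_trans _ leDn) ?ltnS ?proper_card.
  + exact: hallD (subset_trans sS' sSD).
  have [||g2 g2_inj g2G] := IHn (D :\: S) (fun i => G i :\: \bigcup_(i in S) G i).
  + rewrite -ltnS (leq_trans _ leDn) // ltnS cardsDS //.
    by rewrite ltn_subrL !card_gt0 S0; apply/set0Pn; exists i0.
  + move=> S' /subsetDP[sS'D dS'S].
    have := hallD (S' :|: S); rewrite subUset sS'D sSD => /(_ isT).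
    rewrite cardsU (disjoint_setI0 dS'S) cards0 subn0 bigcup_setU.
    move: tight.
    set X := \bigcup_(i in S) _; set Y := \bigcup_(i in S') _.
    have -> : \bigcup_(i in S') (G i :\: X) = Y :\: X.
      apply/setP=> j; rewrite !inE; apply/bigcupP/andP.
        by case=> i iS'; rewrite inE => /andP[-> jG]; split=> //; apply/bigcupP; exists i.
      by case=> jX /bigcupP[i iS' jG]; exists i => //; rewrite inE jX.
    by have := cardsUI Y X; have := cardsID X Y; lia.
  exists (fun i => if i \in S then g1 i else g2 i) => [i j iD jD|i iD].
  + case: ifPn => iS; case: ifPn => jS; first exact: g1_inj.
    * move=> eq_g; have := g2G j; rewrite !inE jS jD -eq_g => /(_ isT)/andP[/negP[]].
      by apply/bigcupP; exists i => //; apply: g1G.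
    * move=> eq_g; have := g2G i; rewrite !inE iS iD eq_g => /(_ isT)/andP[/negP[]].
      by apply/bigcupP; exists j => //; apply: g1G.
    * by apply: g2_inj; rewrite inE ?iS ?jS.
  + case: ifPn => iS; first exact: g1G.
    by have := g2G i; rewrite !inE iS iD => /(_ isT)/andP[].
have: 0 < #|G i0|.
  by have := hallD [set i0]; rewrite sub1set i0D cards1 big_set1 => /(_ isT).
case/card_gt0P=> j1 j1G.
have [||g g_inj gG] := IHn (D :\ i0) (fun i => G i :\ j1).
- by rewrite -ltnS (leq_trans _ leDn) // ltnS [X in _ < X](cardsD1 i0) i0D.
- move=> S sS; have [->|[i1 i1S]] := set_0Vmem S; first by rewrite cards0.
  have prS : S \proper D.
    rewrite properE (subset_trans sS (subsetDl _ _)); apply/subsetPn; exists i0 => //.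
    by apply/negP=> /(subsetP sS); rewrite !inE eqxx.
  have S0 : S != set0 by apply/set0Pn; exists i1.
  have /negbT := slack S; rewrite prS S0 /= -ltnNge => ltS.
  rewrite -ltnS; apply: leq_trans ltS _.
  rewrite (cardsD1 j1 (\bigcup_(i in S) G i)) -addn1 addnC leq_add ?leq_b1 //.
  apply/subset_leq_card/subsetP=> j; rewrite !inE => /andP[jj1 /bigcupP[i iS jG]].
  by apply/bigcupP; exists i; rewrite // !inE jj1.
exists (fun i => if i == i0 then j1 else g i) => [i j iD jD|i iD].
- case: eqP => [->|/eqP ii0]; case: eqP => [->|/eqP ji0] // eqg.
  + by have := gG j; rewrite !inE ji0 jD -eqg eqxx => /(_ isT).
  + by have := gG i; rewrite !inE ii0 iD eqg eqxx => /(_ isT).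
  + by apply: g_inj; rewrite // !inE ?ii0 ?ji0.
- case: eqP => [->|/eqP ii0] //.
  by have := gG i; rewrite !inE ii0 iD => /(_ isT)/andP[].
Qed.

(** * Monochromatic tilings *)

Section Tilings.

Variables (T : finType) (c : edge_coloring T) (F : graph_sequence).

Definition mono_piece (S : {set T}) : Prop :=
  exists2 H : subgraph T, mono_copy_from c F H & vset H = S.

(** The index only bounds the number of pieces from above: the empty set is tiled at every index. *)
Inductive tiled : nat -> {set T} -> Prop :=
| tiled0 k : tiled k set0
| tiledS k (S X : {set T}) : mono_piece S -> [disjoint S & X] -> tiled k X ->
    tiled k.+1 (S :|: X).

Lemma mono_piece_embed n (f : 'I_n -> T) (col : bool) :
  0 < n -> injective f -> (forall i j, F n i j -> c (f i) (f j) = col) ->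
  mono_piece (f @: [set: 'I_n]).
Proof.
move=> n_gt0 f_inj f_mono.
pose e x y := [exists i, exists j, [&& f i == x, f j == y & F n i j]].
have eP x y : reflect (exists i j, [/\ f i = x, f j = y & F n i j]) (e x y).
  apply: (iffP existsP) => [[i /existsP[j /and3P[/eqP<- /eqP<- Fij]]]|].
    by exists i, j.
  by case=> i [j [<- <- Fij]]; exists i; apply/existsP; exists j; rewrite !eqxx.
have e_sym : symmetric e.
  move=> x y; apply/idP/idP=> /eP[i [j [<- <- Fij]]]; apply/eP; exists j, i;
    by rewrite adj_sym.
have e_irr : irreflexive e.
  by move=> x; apply/negbTE/negP=> /eP[i [j [<- /f_inj->]]]; rewrite adj_irrefl.
pose Ge := SGraph e_sym e_irr.
have e_sub x y : Ge x y ->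
    (x \in f @: [set: 'I_n]) && (y \in f @: [set: 'I_n]).
  by move=> /eP[i [j [<- <- _]]]; rewrite !imset_f ?inE.
exists (Subgraph e_sub) => //; split; last first.
  by exists col => x y /eP[i [j [<- <- Fij]]]; apply: f_mono.
exists n => //; exists f; split=> // i j /=.
apply/eP/idP=> /= [[i' [j' [/f_inj-> /f_inj->]]] //|Fij]; by exists i, j.
Qed.

(** [F 1] is a single vertex, so a bounded leftover can always be covered vertex by vertex. *)
Lemma mono_piece1 x : mono_piece [set x].
Proof.
have := @mono_piece_embed 1 (fun=> x) true isT; rewrite -[[set: _]]/(setT).
have -> : (fun _ : 'I_1 => x) @: [set: 'I_1] = [set x].
  apply/setP=> y; rewrite !inE; apply/imsetP/eqP=> [[]//|->].
  by exists ord0; rewrite ?inE.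
apply=> [i j _|i j]; first by rewrite !ord1.
by rewrite !ord1 adj_irrefl.
Qed.

Lemma tiled_leq k k' X : k <= k' -> tiled k X -> tiled k' X.
Proof.
move=> le_kk' tX; elim: tX k' le_kk' => [*|k1 S Y pS dSY _ IH [//|k'] le_kk'].
  exact: tiled0.
by apply: tiledS => //; apply: IH.
Qed.

Lemma tiled_piece S : mono_piece S -> tiled 1 S.
Proof.
move=> pS; rewrite -[S]setU0; apply: tiledS (tiled0 _) => //.
by rewrite -setI_eq0 setI0.
Qed.

Lemma tiledU k k' X Y : tiled k X -> tiled k' Y -> [disjoint X & Y] ->
  tiled (k + k') (X :|: Y).
Proof.
move=> tX tY; elim: tX => [k1 _|k1 S X1 pS dSX _ IH].
  by rewrite set0U; apply: tiled_leq tY; apply: leq_addl.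
rewrite -!setI_eq0 setIUl setU_eq0 !setI_eq0 -setUA addSn => /andP[dSY dXY].
by apply: tiledS (IH dXY) => //; rewrite -setI_eq0 setIUr setU_eq0 !setI_eq0 dSX.
Qed.

Lemma tiled_singletons (X : {set T}) : tiled #|X| X.
Proof.
have [n] := ubnP #|X|; elim: n X => // n IHn X ltXn.
have [->|[x xX]] := set_0Vmem X; first exact: tiled0.
rewrite (cardsD1 x) xX -(setD1K xX).
have -> : #|(x |: X :\ x) :\ x| = #|X :\ x|.
  by congr #|pred_of_set _|; rewrite (setD1K xX).
apply: tiledS (mono_piece1 x) _ (IHn _ _).
  by rewrite disjoints1 !inE eqxx.
by move: ltXn; rewrite (cardsD1 x) xX.
Qed.

Lemma tiled_partition k : tiled k [set: T] ->
  exists (k' : nat) (H : 'I_k' -> subgraph T),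
    [/\ k' <= k, forall i, mono_copy_from c F (H i) & vertex_partition H].
Proof.
rewrite /vertex_partition; elim=> [k1|k1 S X [H0 mH0 <-] dSX _].
  have H : 'I_0 -> subgraph T by case.
  exists 0, H.
  split=> // [[]//|]; split; first by case.
  by rewrite big_ord0.
case=> k' [H [le_k' mH [dH defX]]].
exists k'.+1, (fun i => if unlift ord0 i is Some j then H j else H0).
have dH0 j : [disjoint vset H0 & vset (H j)].
  by rewrite -defX in dSX; apply: disjointWr dSX; apply: bigcup_sup.
split=> // [i|]; first by case: unliftP.
split; last by rewrite big_ord_recl unlift_none -defX; congr (_ :|: _); apply: eq_bigr => i _; rewrite liftK.
move=> i j; case: unliftP => [i' ->|->]; case: unliftP => [j' ->|->] //.
- by move=> ij; apply: dH; apply: contraNneq ij => ->.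
- by rewrite disjoint_sym.
Qed.

End Tilings.

Lemma subset_of_card (T : finType) (A : {set T}) k :
  k <= #|A| -> exists2 B : {set T}, B \subset A & #|B| = k.
Proof.
move=> le_kA; exists [set x in take k (enum A)].
  by apply/subsetP=> x; rewrite inE => /mem_take; rewrite mem_enum.
rewrite cardsE (card_uniqP _) ?take_uniq ?enum_uniq // size_takel //.
by rewrite -cardE.
Qed.

Lemma leq_expn2r m n t : m <= n -> m ^ t <= n ^ t.
Proof. by case: t => // t; rewrite leq_exp2r. Qed.

Lemma bigcup_card_le (I T : finType) (D : {set I}) (G : I -> {set T}) k :
  (forall i, i \in D -> #|G i| <= k) -> #|\bigcup_(i in D) G i| <= #|D| * k.
Proof.
move=> leG; rewrite -sum_nat_const.
elim/big_rec2: _ => [|i n S iD IH]; first by rewrite cards0.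
by apply: leq_trans (leq_card_setU _ _) _; rewrite leq_add ?leG.
Qed.

(** * Dependent random choice *)

Section DependentRandomChoice.

Variables (T : finType) (E : rel T) (g : nat).
Let N a := [set y | E a y].

(* The number of j-tuples in A whose common neighbourhood inside U has fewer
   than g elements. *)
Fixpoint poor_tuples (A : {set T}) (j : nat) (U : {set T}) : nat :=
  if j is j'.+1 then \sum_(a in A) poor_tuples A j' (U :&: N a)
  else #|U| < g.

Definition common (A : {set T}) t (x : {ffun 'I_t -> T}) : {set T} :=
  [set a in A | [forall i, E a (x i)]].

Lemma in_common (A : {set T}) t (x : {ffun 'I_t -> T}) a :
  (a \in common A x) = (a \in A) && [forall i, E a (x i)].
Proof. by rewrite inE. Qed.

(** Double counting: a poor tuple with common neighbourhood W in [U] survives in [common A x]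
    exactly when all entries of [x] lie in W, that is for #|W|^t <= g^t choices of [x]. Peeling off
    one entry of the tuple shrinks [U] to the neighbourhood of that entry. *)
Lemma sum_poor_tuples (A : {set T}) t j (U : {set T}) :
  \sum_(x : {ffun 'I_t -> T} | x \in ffun_on (mem U))
     poor_tuples (common A x) j U <= #|A| ^ j * g ^ t.
Proof.
elim: j => [|j IHj] /= in U *.
  rewrite mul1n sum_nat_const card_ffun_on card_ord.
  by case: ltnP => [/ltnW le_Ug|_]; rewrite ?muln0 // muln1; apply: leq_expn2r.
have -> : \sum_(x : {ffun 'I_t -> T} | x \in ffun_on (mem U))
            \sum_(a in common A x) poor_tuples (common A x) j (U :&: N a)
   = \sum_(a in A) \sum_(x : {ffun 'I_t -> T} | x \in ffun_on (mem (U :&: N a)))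
            poor_tuples (common A x) j (U :&: N a).
  rewrite (exchange_big_dep (mem A)) /=; last by move=> x a _; rewrite in_common => /andP[].
  apply: eq_bigr => a aA; apply: eq_bigl => x; rewrite in_common aA /=.
  apply/andP/ffun_onP => [[/ffun_onP xU /forallP xE] i|xUE].
    by rewrite !inE xU xE.
  by split; [apply/ffun_onP|apply/forallP] => i; have := xUE i; rewrite !inE => /andP[].
rewrite expnS -mulnA -sum_nat_const; apply: leq_sum => a aA; exact: IHj.
Qed.

Lemma sum_common (A : {set T}) t (U : {set T}) :
  \sum_(x : {ffun 'I_t -> T} | x \in ffun_on (mem U)) #|common A x|
    = \sum_(a in A) #|U :&: N a| ^ t.
Proof.
transitivity (\sum_(x : {ffun 'I_t -> T} | x \in ffun_on (mem U))
                 \sum_(a in common A x) 1).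
  by apply: eq_bigr => x _; rewrite sum1_card.
rewrite (exchange_big_dep (mem A)) /=; last by move=> x a _; rewrite in_common => /andP[].
apply: eq_bigr => a aA; rewrite sum1_card -[t in RHS]card_ord -card_ffun_on.
apply: eq_card => x; rewrite unfold_in /= in_common aA /=.
apply/andP/ffun_onP => [[/ffun_onP xU /forallP xE] i|xUE].
  by rewrite !inE xU xE.
by split; [apply/ffun_onP|apply/forallP] => i; have := xUE i; rewrite !inE => /andP[].
Qed.

(** A vertex of [A] survives a uniform t-tuple of [U] with probability at least 4^-t, a poor D-tuple
    with probability at most (g / #|U|)^t. The numerical hypothesis makes the second effect
    negligible. *)
Lemma dependent_random_choice (A : {set T}) t D (U : {set T}) :
  0 < #|A| -> (forall a, a \in A -> #|U| <= 4 * #|U :&: N a|) ->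
  2 * 4 ^ t * (4 * D * 4 ^ t) ^ D * g ^ t < #|U| ^ t ->
  exists A' : {set T}, [/\ A' \subset A, #|A| <= 2 * 4 ^ t * #|A'|
    & poor_tuples A' D U * (2 * D) ^ D < #|A'| ^ D].
Proof.
move=> A_gt0 degA numeric.
set a := #|A| in A_gt0 *; set u := #|U|.
case: (pickP (fun x : {ffun 'I_t -> T} => [&& a <= 2 * 4 ^ t * #|common A x|
    & poor_tuples (common A x) D U * (2 * D) ^ D < #|common A x| ^ D])) => [x /andP[h1 h2]|bad].
  by exists (common A x); split=> //; apply/subsetP=> y; rewrite inE => /andP[].
(* A failing [x] either yields a small set, paid for by the first summand, or many poor tuples, paid
   for by the second. Summation over [x] then contradicts [numeric]. *)
have bnd (x : {ffun 'I_t -> T}) : #|common A x| * (2 * 4 ^ t) * a ^ D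
   <= a * a ^ D + 2 * 4 ^ t * a * (4 * D * 4 ^ t) ^ D * poor_tuples (common A x) D U.
  have [le_a|lt_a] := leqP a (2 * 4 ^ t * #|common A x|).
    have h : #|common A x| ^ D <= poor_tuples (common A x) D U * (2 * D) ^ D.
      by rewrite leqNgt; have := bad x; rewrite le_a /= => ->.
    apply: leq_trans (leq_addl _ _).
    have le_Aa : #|common A x| <= a.
      by apply/subset_leq_card/subsetP=> y; rewrite inE => /andP[].
    have leaD : a ^ D <= (4 * D * 4 ^ t) ^ D * poor_tuples (common A x) D U.
      have -> : 4 * D * 4 ^ t = (2 * 4 ^ t) * (2 * D) by ring.
      rewrite [(2 * 4 ^ t * _) ^ D]expnMn -mulnA.
      rewrite [(2 * D) ^ D * _]mulnC.
      apply: leq_trans (leq_mul (leqnn ((2 * 4 ^ t) ^ D)) h).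
      by rewrite -expnMn; apply: leq_expn2r.
    rewrite -[X in _ <= X]mulnA; apply: leq_mul => //.
    by rewrite [X in _ <= X]mulnC leq_mul2r le_Aa orbT.
  apply: leq_trans (leq_addr _ _); rewrite leq_mul2r [X in X <= _]mulnC.
  by rewrite (ltnW lt_a) orbT.
have : \sum_(x : {ffun 'I_t -> T} | x \in ffun_on (mem U))
         #|common A x| * (2 * 4 ^ t) * a ^ D
    <= \sum_(x : {ffun 'I_t -> T} | x \in ffun_on (mem U))
         (a * a ^ D + 2 * 4 ^ t * a * (4 * D * 4 ^ t) ^ D * poor_tuples (common A x) D U).
  by apply: leq_sum => x _; apply: bnd.
rewrite big_split /= -!big_distrl /= -big_distrr /= sum_common sum_nat_const card_ffun_on card_ord -/u.
rewrite -[u ^ t * a * _]mulnA => main.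
have h1 : a * u ^ t <= 4 ^ t * \sum_(i in A) #|U :&: N i| ^ t.
  rewrite big_distrr /= -sum_nat_const; apply: leq_sum => i iA.
  by rewrite -expnMn; apply/leq_expn2r/degA.
have h2 := sum_poor_tuples A t D U.
have h3 : 2 * (a * u ^ t) * a ^ D <= u ^ t * (a * a ^ D)
     + 2 * 4 ^ t * a * (4 * D * 4 ^ t) ^ D * (a ^ D * g ^ t).
  apply: leq_trans (leq_trans main _); last by rewrite leq_add2l leq_mul2l h2 orbT.
  rewrite leq_mul2r; apply/orP; right.
  by rewrite [X in _ <= X]mulnC -mulnA leq_mul2l h1 orbT.
suff: u ^ t <= 2 * 4 ^ t * (4 * D * 4 ^ t) ^ D * g ^ t by rewrite leqNgt numeric.
have aa_gt0 : 0 < a * a ^ D by rewrite muln_gt0 A_gt0 expn_gt0 A_gt0.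
rewrite -(leq_pmul2r aa_gt0).
move: h3; set x1 := u ^ t; set x2 := 4 ^ t; set x3 := (_ * _ * _) ^ D; set x4 := a ^ D; set x5 := g ^ t.
have -> : 2 * (a * x1) * x4 = x1 * (a * x4) + x1 * (a * x4) by ring.
have -> : 2 * x2 * a * x3 * (x4 * x5) = 2 * x2 * x3 * x5 * (a * x4) by ring.
by rewrite leq_add2l.
Qed.

Section Embedding.

Variables (I : finType) (h : rel I) (D : nat) (A U : {set T}).
Hypothesis D_gt0 : 0 < D.
Hypothesis degL : forall p, #|[set q | h p q]| <= D.
Hypothesis degR : forall q, #|[set p | h p q]| <= D.
Hypothesis cardA : 2 * #|I| <= #|A|.
Hypothesis poorA : poor_tuples A D U * (2 * D) ^ D < #|A| ^ D.

Definition cand (P : {set I}) (f : I -> T) (q : I) : {set T} :=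
  [set y in U | [forall p, (p \in P) && h p q ==> E (f p) y]].

(** Every q is treated as if it had exactly D predecessors, so that all of them start from the one
    count [poorA]. *)
Let rest (P : {set I}) q := D - #|[set p in P | h p q]|.

(** The fraction of poor completions at q is kept below (2D)^-r, with r open entries left. By
    Markov, each successor q of p forbids at most #|A| / (2D) images of p, all of them together at
    most half of [A]; and fewer than #|I| <= #|A| / 2 images are already taken. *)
Lemma greedy_rich_embedding : exists f : I -> T,
  [/\ injective f, forall p, f p \in A & forall q, g <= #|cand setT f q|].
Proof.
have [t0 t0A] : exists t0, t0 \in A.
  apply/card_gt0P; rewrite lt0n; apply: contraTneq poorA => ->.
  by rewrite exp0n // ltn0.
have step (k : nat) : k <= #|I| -> exists (P : {set I}) (f : I -> T),
  [/\ #|P| = k, {in P &, injective f}, forall p, f p \in A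
    & forall q, poor_tuples A (rest P q) (cand P f q) * (2 * D) ^ (rest P q)
        < #|A| ^ (rest P q)].
  elim: k => [|k IHk] lek.
    exists set0, (fun=> t0); split=> //; first by rewrite cards0.
      by move=> p q; rewrite inE.
    move=> q; rewrite /rest.
    have -> : [set p in set0 | h p q] = set0 by apply/setP=> p; rewrite !inE.
    have -> : cand set0 (fun=> t0) q = U.
      apply/setP=> y; rewrite inE; case: (y \in U) => //=; apply/forallP=> p.
      by rewrite inE.
    by rewrite cards0 subn0.
  have [P [f [cardP f_inj fA inv]]] := IHk (ltnW lek).
  have [p pP] : exists p, p \notin P.
    apply/existsP; rewrite -negb_forall; apply/negP=> /forallP allP.
    by have := ltnn #|I|; rewrite -{1}cardsT (_ : [set: I] = P) ?cardP 1?lek //; apply/setP=> x; rewrite inE allP.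
  pose bad q := [set a in A | #|A| ^ (rest P q).-1 <=
     poor_tuples A (rest P q).-1 (cand P f q :&: N a) * (2 * D) ^ (rest P q).-1].
  have rest_gt0 q : h p q -> 0 < rest P q.
    move=> hpq; rewrite /rest subn_gt0; apply: leq_trans (degR q).
    apply: proper_card; rewrite properE; apply/andP; split.
      by apply/subsetP=> x; rewrite !inE => /andP[].
    by apply/subsetPn; exists p; rewrite !inE ?hpq // (negbTE pP).
  have card_bad q : h p q -> 2 * D * #|bad q| <= #|A|.
    move=> hpq; have := inv q; have := rest_gt0 q hpq.
    rewrite /bad; case: (rest P q) => // r _ /= lt_r.
    set X := [set a in A | _].
    have cX : #|X| * #|A| ^ r <= (\sum_(a in A) poor_tuples A r (cand P f q :&: N a)) * (2 * D) ^ r.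
      rewrite big_distrl /= -sum_nat_const.
      apply: leq_trans (_ : \sum_(i in X) poor_tuples A r (cand P f q :&: N i) * (2 * D) ^ r <= _).
        by apply: leq_sum => a; rewrite inE => /andP[].
      rewrite [X in _ <= X](bigID (mem X)) /=; apply: leq_trans (leq_addr _ _).
      by apply: eq_leq; apply: eq_bigl => a; rewrite inE; case: (a \in A).
    have A_gt0 : 0 < #|A| ^ r by rewrite expn_gt0; apply/orP; left; apply/card_gt0P; exists t0.
    rewrite -(leq_pmul2r A_gt0) -expnS; apply: leq_trans (ltnW lt_r).
    by rewrite expnS mulnCA -mulnA leq_mul2l cX orbT.
  have [a [aA aP abad]] : exists a, [/\ a \in A, a \notin f @: P & forall q, h p q -> a \notin bad q].
    pose B := \bigcup_(q in [set q | h p q]) bad q.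
    have cB : 2 * #|B| <= #|A|.
      have /leq_trans-> // : 2 * #|B| <= 2 * (#|[set q | h p q]| * (#|A| %/ (2 * D))).
        rewrite leq_mul2l; apply: bigcup_card_le => q; rewrite inE => /card_bad.
        by rewrite leq_divRL ?muln_gt0 // mulnC.
      apply: leq_trans (_ : 2 * (D * (#|A| %/ (2 * D))) <= _).
        by rewrite leq_mul2l leq_mul2r degL !orbT.
      by rewrite mulnA mulnC leq_divM.
    have: 0 < #|A :\: (B :|: f @: P)|.
      rewrite cardsD subn_gt0.
      apply: leq_ltn_trans (subset_leq_card (subsetIr _ _)) _.
      apply: leq_ltn_trans (leq_card_setU _ _) _.
      have := leq_imset_card f P; rewrite cardP => le1.
      by move: cardA lek cB le1; lia.
    case/card_gt0P=> a; rewrite !inE negb_or => /andP[/andP[aB aP] aA].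
    exists a; split=> // q hpq; apply: contra aB => abad; apply/bigcupP; exists q => //.
    by rewrite inE.
  exists (p |: P), (fun i => if i == p then a else f i); split.
  - by rewrite cardsU1 pP cardP.
  - move=> i j; rewrite !inE.
    case: eqP => [->|_] /=; case: eqP => [->|_] //=.
    + by move=> _ jP eqa; case/negP: aP; rewrite eqa imset_f.
    + by move=> iP _ eqa; case/negP: aP; rewrite -eqa imset_f.
    + exact: f_inj.
  - by move=> q; case: eqP.
  - move=> q; rewrite /rest.
    have [hpq|hpq] := boolP (h p q).
      have -> : [set x in p |: P | h x q] = p |: [set x in P | h x q].
        by apply/setP=> x; rewrite !inE; case: eqP => [->|_] //=; rewrite hpq.
      rewrite cardsU1 inE (negbTE pP) /= add1n subnS.
      have -> : cand (p |: P) (fun i => if i == p then a else f i) q = cand P f q :&: N a.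
        apply/setP=> y; rewrite !inE -andbA; congr (_ && _).
        apply/forallP/andP => [all_y|[/forallP all_y Eay] x].
          split; last by have := all_y p; rewrite !inE eqxx hpq.
          apply/forallP=> x; apply/implyP=> /andP[xP hxq].
          have := all_y x; rewrite !inE xP orbT hxq /=.
          by case: eqP xP => // ->; rewrite (negbTE pP).
        rewrite !inE; case: eqP => [->|_] /=; first by rewrite Eay implybT.
        exact: all_y.
      by have := abad q hpq; rewrite inE aA /= -ltnNge.
    have -> : [set x in p |: P | h x q] = [set x in P | h x q].
      by apply/setP=> x; rewrite !inE; case: eqP => [->|_] //=; rewrite (negbTE hpq) !andbF.
    have -> : cand (p |: P) (fun i => if i == p then a else f i) q = cand P f q.
      apply/setP=> y; rewrite !inE; congr (_ && _).
      by apply: eq_forallb => x; rewrite !inE; case: eqP => [->|_] //=; rewrite (negbTE hpq) !andbF.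
    exact: inv.
have [P [f [cardP f_inj fA inv]]] := step _ (leqnn _).
have defP : P = setT by apply/eqP; rewrite eqEcard subsetT cardsT cardP leqnn.
rewrite defP in f_inj inv.
exists f; split=> // [i j eqf|q]; first by apply: f_inj; rewrite ?inE.
rewrite leqNgt; apply/negP=> lt_g.
(* A set of fewer than g elements stays so under intersection. Even with entries left open, all its
   completions would be poor, against the invariant. *)
have poor_all r (W : {set T}) : #|W| < g -> poor_tuples A r W = #|A| ^ r.
  elim: r W => [|r IHr] W ltWg /=; first by rewrite ltWg.
  rewrite expnS -sum_nat_const; apply: eq_bigr => a _; apply: IHr.
  by apply: leq_ltn_trans ltWg; rewrite subset_leq_card ?subsetIl.
have := inv q; rewrite poor_all // ltnNge.
by rewrite leq_pmulr // expn_gt0 muln_gt0 D_gt0.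
Qed.

End Embedding.

End DependentRandomChoice.

(** * Large monochromatic copies *)

Section DoubleCover.

Variables (T : finType) (c : edge_coloring T) (F : graph_sequence).
Variables (n : nat) (side : 'I_n -> bool) (f g : 'I_n -> T) (col : bool).
Hypothesis n_gt0 : 0 < n.
Hypothesis sideP : forall x y, F n x y -> side x != side y.
Hypothesis f_inj : injective f.
Hypothesis g_inj : injective g.
Hypothesis fg : forall i j, f i != g j.
Hypothesis fg_mono : forall i j, F n i j -> c (f i) (g j) = col.

(* An embedding f, g of the bipartite double cover of F n carries two disjoint
   copies of F n, because the double cover of a bipartite graph splits. *)
Definition sheet (b : bool) (i : 'I_n) : T := if side i == b then f i else g i.

Lemma sheet_inj b : injective (sheet b).
Proof.
move=> i j; rewrite /sheet; case: ifP => _; case: ifP => _ eq_fg.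
- exact: f_inj.
- by case/eqP: (fg i j).
- by case/eqP: (fg j i).
- exact: g_inj.
Qed.

Lemma sheet_piece b : mono_piece c F (sheet b @: [set: 'I_n]).
Proof.
apply: (mono_piece_embed (col := col)) => // [|i j Fij]; first exact: sheet_inj.
have := sideP Fij; rewrite /sheet.
case: (side i); case: (side j); case: b => // _ /=; rewrite ?fg_mono //.
- by rewrite color_sym fg_mono // adj_sym.
- by rewrite color_sym fg_mono // adj_sym.
Qed.

Lemma tiled_double_cover :
  tiled c F 2 (f @: [set: 'I_n] :|: g @: [set: 'I_n]).
Proof.
have -> : f @: setT :|: g @: setT = sheet true @: setT :|: sheet false @: setT.
  apply/setP=> x; rewrite !inE; apply/orP/orP.
    case=> /imsetP[i _ ->]; case si: (side i).
    - by left; apply/imsetP; exists i => //; rewrite /sheet si.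
    - by right; apply/imsetP; exists i => //; rewrite /sheet si.
    - by right; apply/imsetP; exists i => //; rewrite /sheet si.
    - by left; apply/imsetP; exists i => //; rewrite /sheet si.
  by case=> /imsetP[i _ ->]; rewrite /sheet; case: ifP => _;
    [left|right|left|right]; rewrite imset_f ?inE.
rewrite -[2]/(1 + 1); apply: tiledU; try exact/tiled_piece/sheet_piece.
rewrite -setI_eq0; apply/eqP/setP=> x; rewrite !inE; apply/negbTE/andP.
case=> /imsetP[i _ ->] /imsetP[j _]; rewrite /sheet.
case si: (side i); case sj: (side j) => //= eq_fg.
- by case/eqP: (fg i j).
- by move/f_inj: eq_fg si => ->; rewrite sj.
- by move/g_inj: eq_fg si => ->; rewrite sj.
- by case/eqP: (fg j i).
Qed.

End DoubleCover.

Lemma degree_bounded D (F : graph_sequence) n (x : 'I_n) :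
  bounded_sequence D F -> #|[set y | F n x y]| <= D.
Proof.
by move=> bF; apply: leq_trans (bF n); apply: (leq_bigmax (F := degree (F n)) x).
Qed.

Lemma majority_color (T : finType) (c : edge_coloring T) (A B : {set T}) :
  exists col : bool,
    #|A| * #|B| <= 2 * \sum_(a in A) #|[set b in B | c a b == col]|.
Proof.
have split_sum : \sum_(a in A) #|[set b in B | c a b == true]|
    + \sum_(a in A) #|[set b in B | c a b == false]| = #|A| * #|B|.
  rewrite -big_split -sum_nat_const; apply: eq_bigr => a _ /=.
  rewrite -(cardsID [set b | c a b == true] B); congr (_ + _); apply: eq_card => b.
    by rewrite !inE.
  by rewrite !inE; case: (c a b); rewrite ?andbF ?andbT.
case: (leqP (#|A| * #|B|) (2 * \sum_(a in A) #|[set b in B | c a b == true]|)).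
  by exists true.
by exists false; lia.
Qed.

Section Greedy.

Variables (T : finType) (c : edge_coloring T) (F : graph_sequence) (D : nat).
Hypothesis D_gt0 : 0 < D.
Hypothesis boundF : bounded_sequence D F.
Hypothesis bipF : bipartite_sequence F.

(** The double cover of [F j] is embedded between two halves of [X] and one sheet is kept. The
    exponent 10 D - 1 left after halving has to exceed 5 + 3 D for the random choice and 3 + 2 D for
    [bigA']. *)
Lemma greedy_piece (X : {set T}) j : 0 < j -> 2 ^ (10 * D) * j <= #|X| ->
  exists S : {set T}, [/\ S \subset X, #|S| = j & mono_piece c F S].
Proof.
move=> j_gt0 leX.
pose n0 := #|X| %/ 2.
have [A sAX cardA] : exists2 A : {set T}, A \subset X & #|A| = n0.
  by apply: subset_of_card; rewrite leq_div.
have [U sUX cardU] : exists2 U : {set T}, U \subset X :\: A & #|U| = n0.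
  by apply: subset_of_card; rewrite cardsDS // cardA /n0; lia.
have n0_ge : 2 ^ (10 * D).-1 * j <= n0.
  rewrite /n0 leq_divRL //; apply: leq_trans leX.
  by rewrite mulnAC -expnSr prednK // muln_gt0 D_gt0.
have n0_gt0 : 0 < n0 by apply: leq_trans n0_ge; rewrite muln_gt0 expn_gt0 j_gt0.
have [col le_col] := majority_color c A U; rewrite cardA cardU in le_col.
pose E : rel T := fun x y => c x y == col.
(* Density 1/2 leaves at least a quarter of [A] with degree at least n0 / 4. *)
pose A1 := [set a in A | n0 <= 4 * #|U :&: [set y | E a y]|].
have cardA1 : n0 <= 4 * #|A1|.
  have : 4 * \sum_(a in A) #|[set b in U | c a b == col]| <= n0 * (4 * #|A1|) + n0 * n0.
    rewrite big_distrr /= (bigID (mem A1)) /= leq_add //.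
      have -> : n0 * (4 * #|A1|) = \sum_(a in A1) 4 * n0 by rewrite sum_nat_const; ring.
      apply: leq_trans (_ : \sum_(i in A1) 4 * #|[set b in U | c i b == col]| <= _).
        by apply: eq_leq; apply: eq_bigl => a; rewrite inE; case: (a \in A).
      apply: leq_sum => a _; rewrite leq_mul2l -cardU subset_leq_card //=.
      by apply/subsetP=> y; rewrite inE => /andP[].
    apply: leq_trans (_ : \sum_(a in A) n0 <= _).
      rewrite big_mkcondr /=; apply: leq_sum => a aA.
      case: ifPn; rewrite ?inE ?aA //= -ltnNge => /ltnW; apply: leq_trans.
      by rewrite leq_mul2l; apply/orP; right; apply/subset_leq_card/subsetP=> y; rewrite !inE.
    by rewrite sum_nat_const cardA.
  by move: le_col; rewrite -[n0 <= _](leq_pmul2l n0_gt0); nia.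
have D2 : D < 2 ^ D by apply: ltn_expl.
have pw x : 2 ^ (x * D) = (2 ^ x) ^ D by rewrite expnM.
have [|||A' [sA' leA' poorA']] := @dependent_random_choice T E j A1 D D U.
- by rewrite lt0n; apply: contraTneq cardA1 => ->; rewrite muln0 -ltnNge.
- by move=> a; rewrite inE cardU => /andP[].
- rewrite cardU.
  have h1 : (4 * D * 4 ^ D) <= 2 ^ (2 + 3 * D).
    have -> : 2 ^ (2 + 3 * D) = 4 * 2 ^ D * 4 ^ D.
      by rewrite -[4]/(2 ^ 2) -expnM -!expnD; congr (2 ^ _); lia.
    by rewrite leq_mul2r leq_mul2l (ltnW D2) !orbT.
  have h2 : 2 * 4 ^ D <= (2 ^ 3) ^ D.
    rewrite -[4]/(2 ^ 2) -!expnM -expnS leq_exp2l //; lia.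
  apply: leq_ltn_trans (_ : (2 ^ 3 * 2 ^ (2 + 3 * D) * j) ^ D < _).
    rewrite [(2 ^ 3 * _ * _) ^ D]expnMn [(2 ^ 3 * _) ^ D]expnMn.
    by rewrite leq_mul2r; apply/orP; right; rewrite leq_mul // leq_expn2r.
  rewrite ltn_exp2r //; apply: leq_trans n0_ge; rewrite ltn_pmul2r // -expnD ltn_exp2l //.
  by lia.
have bigA' : 2 * j <= #|A'|.
  have : 2 ^ (10 * D).-1 * j <= 8 * 4 ^ D * #|A'|.
    by apply: leq_trans n0_ge _; apply: leq_trans cardA1 _; lia.
  have -> : 8 * 4 ^ D = 2 ^ (3 + 2 * D) by rewrite expnD expnM.
  have -> : (10 * D).-1 = (3 + 2 * D) + (8 * D - 4) by lia.
  rewrite expnD -mulnA leq_pmul2l ?expn_gt0 //; apply: leq_trans.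
  by rewrite leq_mul2r -[X in X <= _]expn1 leq_exp2l //; apply/orP; right; lia.
have degF1 p : #|[set q | F j p q]| <= D by exact: degree_bounded.
have degF2 q : #|[set p | F j p q]| <= D.
  apply: leq_trans (degree_bounded (n := j) q boundF).
  by apply: subset_leq_card; apply/subsetP=> p; rewrite !inE adj_sym.
have [|f [f_inj fA' candf]] := greedy_rich_embedding D_gt0 degF1 degF2 _ poorA'.
  by rewrite card_ord.
have [t0 _] : exists t, t \in U by apply/card_gt0P; rewrite cardU.
(* Each candidate set alone has j elements, as many as the whole index type, so Hall's condition is
   immediate. *)
have [S sS|h h_inj hc] := @hall_marriage 'I_j T t0 (fun q => cand E (fun p q => F j p q) U setT f q) setT.
  have [->|[q qS]] := set_0Vmem S; first by rewrite cards0.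
  apply: leq_trans (max_card _) _; rewrite card_ord.
  by apply: leq_trans (candf q) _; apply/subset_leq_card/(bigcup_sup _ qS).
have [side sideP] := bipF j.
have hU q : h q \in U by have := hc q; rewrite !inE => /(_ isT)/andP[].
have fA p : f p \in A by have := subsetP sA' _ (fA' p); rewrite inE => /andP[].
have fh p q : f p != h q.
  by apply: contraTneq (hU q) => <-; apply/negP=> /(subsetP sUX); rewrite inE fA.
have h_inj' : injective h by move=> p q; apply: h_inj; rewrite inE.
have fh_mono p q : F j p q -> c (f p) (h q) = col.
  move=> Fpq; have := hc q; rewrite !inE => /(_ isT)/andP[_ /forallP/(_ p)].
  by rewrite inE Fpq => /eqP.
exists (sheet side f h true @: setT); split.
- apply/subsetP=> x /imsetP[i _ ->]; rewrite /sheet; case: ifP => _.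
    exact: (subsetP sAX).
  by have := subsetP sUX _ (hU i); rewrite inE => /andP[].
- by rewrite card_imset ?cardsT ?card_ord //; apply: sheet_inj.
- exact: (sheet_piece (col := col)).
Qed.

End Greedy.

Section GreedyTiling.

Variables (T : finType) (c : edge_coloring T) (F : graph_sequence) (D : nat).
Hypothesis D_gt0 : 0 < D.
Hypothesis boundF : bounded_sequence D F.
Hypothesis bipF : bipartite_sequence F.

Lemma tiledU_sub k k' (X Y L : {set T}) : L \subset Y -> Y \subset X ->
  tiled c F k (X :\: Y) -> tiled c F k' (Y :\: L) -> tiled c F (k + k') (X :\: L).
Proof.
move=> sLY sYX tX tY.
have -> : X :\: L = (X :\: Y) :|: (Y :\: L).
  apply/setP=> x; rewrite !inE.
  have /implyP := subsetP sYX x; have /implyP := subsetP sLY x.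
  by case: (x \in Y); case: (x \in X); case: (x \in L).
apply: tiledU => //; rewrite -setI_eq0; apply/eqP/setP=> x; rewrite !inE.
by case: (x \in Y); rewrite ?andbF.
Qed.

(** Copies of the fixed size j = #|X| / G can be removed while more than half of [X] is left, and G
    of them suffice because #|X| < G j + G <= 2 G j. *)
Lemma greedy_halving (X : {set T}) : 2 ^ (10 * D).+1 <= #|X| ->
  exists L : {set T}, [/\ L \subset X, 2 * #|L| <= #|X|
    & tiled c F (2 ^ (10 * D).+1) (X :\: L)].
Proof.
move=> leX; set G := 2 ^ (10 * D).+1 in leX *; pose j := #|X| %/ G.
have G_gt0 : 0 < G by rewrite expn_gt0.
have j_gt0 : 0 < j by rewrite divn_gt0.
have step i : exists L : {set T}, [/\ L \subset X,
    (2 * #|L| <= #|X|) || (#|L| + i * j <= #|X|) & tiled c F i (X :\: L)].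
  elim: i => [|i [L [sLX orL tL]]].
    by exists X; rewrite setDv addn0 leqnn orbT; split=> //; apply: tiled0.
  case: (leqP (2 * #|L|) #|X|) orL => [leL _|ltL /= leL].
    by exists L; split; rewrite ?leL //; apply: tiled_leq tL.
  have [|S [sSL cardS pS]] := greedy_piece c D_gt0 boundF bipF (X := L) j_gt0.
    have : G * j <= #|X| by rewrite mulnC leq_divM.
    rewrite /G expnS; lia.
  exists (L :\: S); split.
  - exact: subset_trans (subsetDl _ _) sLX.
  - by rewrite cardsDS // cardS; apply/orP; right; move: (subset_leq_card sSL); rewrite cardS; lia.
  - rewrite -addn1; apply: (tiledU_sub _ sLX) => //; first exact: subsetDl.
    by rewrite setDDr setDv set0U (setIidPr sSL); apply: tiled_piece.
have [L [sLX orL tL]] := step G.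
exists L; split=> //; case/orP: orL => // leL.
have : #|X| < G * j + G by rewrite {1}(divn_eq #|X| G) mulnC ltn_add2l ltn_mod.
have : G <= G * j by rewrite leq_pmulr.
lia.
Qed.

Lemma greedy_tiling (X : {set T}) r : exists L : {set T}, [/\ L \subset X,
    (#|L| < 2 ^ (10 * D).+1) || (#|L| * 2 ^ r <= #|X|)
    & tiled c F (2 ^ (10 * D).+1 * r) (X :\: L)].
Proof.
elim: r => [|r [L [sLX orL tL]]].
  by exists X; rewrite setDv expn0 muln1 leqnn orbT; split=> //; apply: tiled0.
case: (ltnP #|L| (2 ^ (10 * D).+1)) orL => [ltL _|leL /= leLr].
  by exists L; split; rewrite ?ltL //; apply: tiled_leq tL; rewrite leq_mul2l leqnSn orbT.
have [L' [sL'L leL' tL']] := greedy_halving leL.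
exists L'; split; first exact: subset_trans sL'L sLX.
  apply/orP; right; apply: leq_trans leLr; rewrite expnS mulnA.
  by rewrite leq_mul2r mulnC leL' orbT.
by rewrite mulnS addnC; apply: (tiledU_sub _ sLX).
Qed.

End GreedyTiling.

(** * Revealing a random permutation *)

Section RandomPermutation.

Import Order.TTheory GRing.Theory Num.Theory.
Local Open Scope ring_scope.

Variables (R : realFieldType) (I : finType).
Implicit Types (C : {set I}) (s t : {perm I}).

(** Measurability with respect to the values on [C]. Sums weighted by a nonnegative [G] of this kind
    take the place of conditional expectations. *)
Definition dep_on (A : Type) C (G : {perm I} -> A) : Prop :=
  forall s t, {in C, s =1 t} -> G s = G t.

(* Composing s with the transposition of p and p' does not change s on C: given
   its values on C, a uniformly random s has s p uniform outside s @: C. *)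
Lemma perm_reveal C p (G : {perm I} -> R) (X : {perm I} -> {set I}) :
  p \notin C -> dep_on C G -> dep_on C X ->
  #|~: C|%:R * (\sum_s G s * (s p \in X s)%:R)
    = \sum_s G s * #|X s :\: s @: C|%:R.
Proof.
move=> pC dG dX.
have cardX s : #|X s :\: s @: C|%:R = \sum_(p' in ~: C) (s p' \in X s)%:R :> R.
  rewrite -natr_sum; congr _%:R.
  rewrite -sum1_card big_mkcond [RHS](reindex_inj (h := s^-1%g)) /=; last exact: perm_inj.
  rewrite [RHS]big_mkcond /=; apply: eq_bigr => v _; rewrite !inE permKV.
  have -> : (v \in s @: C) = ((s^-1)%g v \in C).
    by rewrite -{1}(permKV s v) mem_imset //; apply: perm_inj.
  by case: (_ \in C); case: (_ \in X s).
under [RHS]eq_bigr do rewrite cardX mulr_sumr.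
rewrite exchange_big /= -sum1_card natr_sum mulr_suml; apply: eq_bigr => p' p'C.
rewrite mul1r [RHS](reindex_inj (mulgI (tperm p p'))) /=.
apply: eq_bigr => s _.
have eqC : {in C, (tperm p p' * s)%g =1 s}.
  move=> c cC; rewrite permM tpermD //.
    by apply: contraNneq pC => ->.
  by apply: contraTneq p'C => ->; rewrite inE negbK.
by rewrite (dG _ _ eqC) (dX _ _ eqC) permM tpermR.
Qed.

Lemma perm_reveal_le C p (G : {perm I} -> R) (X : {perm I} -> {set I}) (b : R) :
  p \notin C -> dep_on C G -> dep_on C X -> (forall s, 0 <= G s) ->
  (forall s, G s != 0 -> #|X s|%:R <= b) ->
  #|~: C|%:R * (\sum_s G s * (s p \in X s)%:R) <= b * \sum_s G s.
Proof.
move=> pC dG dX G_ge0 leX; rewrite perm_reveal // mulr_sumr; apply: ler_sum => s _.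
have [->|G0] := eqVneq (G s) 0; first by rewrite mul0r mulr0.
rewrite [b * _]mulrC ler_wpM2l //; apply: le_trans (leX _ G0).
by rewrite ler_nat subset_leq_card ?subsetDl.
Qed.

Lemma perm_reveal_ge C p (G : {perm I} -> R) (X : {perm I} -> {set I}) (r : R) :
  p \notin C -> dep_on C G -> dep_on C X -> (forall s, 0 <= G s) ->
  (forall s, G s != 0 -> r * #|~: C|%:R <= #|X s|%:R - #|C|%:R) ->
  r * (\sum_s G s) <= \sum_s G s * (s p \in X s)%:R.
Proof.
move=> pC dG dX G_ge0 geX.
have C_gt0 : 0 < #|~: C|%:R :> R.
  by rewrite ltr0n; apply/card_gt0P; exists p; rewrite inE.
rewrite -(ler_pM2l C_gt0) perm_reveal // !mulr_sumr; apply: ler_sum => s _.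
have [->|G0] := eqVneq (G s) 0; first by rewrite !(mul0r, mulr0).
rewrite mulrA [X in X <= _]mulrC ler_wpM2l // mulrC; apply: le_trans (geX _ G0) _.
rewrite lerBlDr -natrD ler_nat -(cardsID (s @: C) (X s)) addnC leq_add2l.
apply: leq_trans (subset_leq_card (subsetIr _ _)) _.
exact: leq_imset_card.
Qed.

(** The product is 2^-(number of events). Given the earlier blocks, each event has probability at
    least r, so each factor scales the sum by at most 1 - r / 2; no independence is involved. *)
Lemma perm_exp_moment k (Bl : nat -> {set I}) (e : nat -> {perm I} -> bool) (r : R) :
  (forall i j, (i < j < k)%N -> [disjoint Bl i & Bl j]) ->
  (forall i, (i < k)%N -> dep_on (Bl i) (e i)) ->
  (forall i (G : {perm I} -> R), (i < k)%N ->
     dep_on (\bigcup_(j < i) Bl j) G -> (forall s, 0 <= G s) ->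
     r * (\sum_s G s) <= \sum_s G s * (e i s)%:R) ->
  r <= 1 ->
  \sum_(s : {perm I}) \prod_(i < k) (1 - (e i s)%:R / 2)
    <= (1 - r / 2) ^+ k * #|{: {perm I}}|%:R.
Proof.
move=> dBl de re r1.
suff H j : (j <= k)%N -> \sum_(s : {perm I}) \prod_(i < j) (1 - (e i s)%:R / 2)
    <= (1 - r / 2) ^+ j * #|{: {perm I}}|%:R by exact: H.
elim: j => [_|j IHj ltjk].
  by rewrite expr0 mul1r -sum1_card natr_sum; apply: ler_sum => s _; rewrite big_ord0.
have e01 i s : 0 <= 1 - (e i s)%:R / 2 :> R by case: (e i s) => /=; lra.
pose G s : R := \prod_(i < j) (1 - (e i s)%:R / 2).
have dG : dep_on (\bigcup_(i < j) Bl i) G.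
  move=> s t eq_st; apply: eq_bigr => i _; congr (1 - _%:R / 2); congr nat_of_bool.
  apply: de; first exact: ltn_trans (ltn_ord i) ltjk.
  by move=> p pB; apply: eq_st; apply/bigcupP; exists i.
have G0 s : 0 <= G s by apply: prodr_ge0.
pose SG := \sum_s G s; pose SE := \sum_s G s * (e j s)%:R.
pose N : R := #|{: {perm I}}|%:R; pose A := (1 - r / 2) ^+ j.
have h2 : r * SG <= SE by apply: re.
have h1 : SG <= A * N by apply/IHj/ltnW.
have -> : \sum_(s : {perm I}) \prod_(i < j.+1) (1 - (e i s)%:R / 2) = SG - SE / 2.
  rewrite /SG /SE mulr_suml -sumrB; apply: eq_bigr => s _.
  by rewrite big_ord_recr /= mulrBr mulr1 mulrA.
rewrite exprSr -/A -/N.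
have h3 : (1 - r / 2) * SG <= (1 - r / 2) * (A * N) by rewrite ler_wpM2l //; lra.
have -> : A * (1 - r / 2) * N = (1 - r / 2) * (A * N) by rewrite mulrAC mulrC mulrA.
apply: le_trans h3; rewrite mulrBl mul1r; lra.
Qed.

(** Markov's inequality for 2^-(number of events), which is above 2^-h on the permutations counted
    here. *)
Lemma perm_few_events k h (Bl : nat -> {set I}) (e : nat -> {perm I} -> bool) (r : R) :
  (forall i j, (i < j < k)%N -> [disjoint Bl i & Bl j]) ->
  (forall i, (i < k)%N -> dep_on (Bl i) (e i)) ->
  (forall i (G : {perm I} -> R), (i < k)%N ->
     dep_on (\bigcup_(j < i) Bl j) G -> (forall s, 0 <= G s) ->
     r * (\sum_s G s) <= \sum_s G s * (e i s)%:R) ->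
  r <= 1 ->
  #|[set s | (\sum_(i < k) e i s < h)%N]|%:R
    <= 2 ^+ h * (1 - r / 2) ^+ k * #|{: {perm I}}|%:R.
Proof.
move=> dBl de re r1; rewrite -mulrA.
apply: le_trans (ler_wpM2l (exprn_ge0 h (ler0n R 2)) (perm_exp_moment dBl de re r1)).
rewrite mulr_sumr -sum1_card natr_sum big_mkcond /=; apply: ler_sum => s _.
have -> : \prod_(i < k) (1 - (e i s)%:R / 2) = 2^-1 ^+ (\sum_(i < k) e i s)%N :> R.
  rewrite -prodrXr; apply: eq_bigr => i _; case: (e i s) => /=; rewrite ?expr1 ?expr0; lra.
rewrite inE; case: ltnP => [lt_h|_]; last by rewrite mulr_ge0 ?exprn_ge0 ?invr_ge0 ?ler0n.
rewrite -(subnKC (ltnW lt_h)) addnC exprD -mulrA -exprMn divff ?expr1n ?pnatr_eq0 // mulr1.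
by rewrite exprn_ege1 // ler1n.
Qed.

End RandomPermutation.

(** * Spanning embeddings into regular pairs *)

Section HoleEnergy.

Import Order.TTheory GRing.Theory Num.Theory.
Local Open Scope ring_scope.

Variables (R : realFieldType) (I J : finType).

(* A vertex b of W contributes the square of the sum of rho to the second moment
   over B of the discrepancy of b, since no T q with q in S contains b. *)
Lemma hole_energy (S : {set I}) (Tq : I -> {set J}) (rho : I -> R) (B W : {set J}) :
  W \subset B -> (forall q, Tq q \subset B) -> (forall q, q \in S -> [disjoint Tq q & W]) ->
  #|W|%:R * (\sum_(q in S) rho q) ^+ 2
    <= \sum_(q in S) \sum_(q' in S)
         (#|Tq q :&: Tq q'|%:R - rho q' * #|Tq q|%:R - rho q * #|Tq q'|%:R
          + rho q * rho q' * #|B|%:R).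
Proof.
move=> sWB sTB dTW.
pose Y b := \sum_(q in S) ((b \in Tq q)%:R - rho q).
have cardE (X : {set J}) : X \subset B -> #|X|%:R = \sum_(b in B) (b \in X)%:R :> R.
  move=> sXB; rewrite -sum1_card natr_sum big_mkcond [RHS]big_mkcond /=.
  apply: eq_bigr => b _; have /implyP := subsetP sXB b.
  by case: (b \in X); case: (b \in B).
have -> : \sum_(q in S) \sum_(q' in S)
         (#|Tq q :&: Tq q'|%:R - rho q' * #|Tq q|%:R - rho q * #|Tq q'|%:R
          + rho q * rho q' * #|B|%:R) = \sum_(b in B) Y b ^+ 2.
  transitivity (\sum_(b in B) \sum_(q in S) \sum_(q' in S)
      ((b \in Tq q)%:R - rho q) * ((b \in Tq q')%:R - rho q')); last first.
    apply: eq_bigr => b _; rewrite expr2 [X in X * _]/Y mulr_suml; apply: eq_bigr => q _.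
    by rewrite /Y mulr_sumr.
  rewrite [RHS]exchange_big /=; apply: eq_bigr => q qS.
  rewrite [RHS]exchange_big /=; apply: eq_bigr => q' q'S.
  rewrite !cardE ?subsetIl ?(subset_trans (subsetIl _ _)) // !mulr_sumr -!sumrB -big_split /=.
  apply: eq_bigr => b bB; rewrite !inE bB.
  by case: (b \in Tq q); case: (b \in Tq q') => /=; ring.
rewrite (bigID (mem W)) /= -[X in X <= _]addr0 lerD //; last first.
  by apply: sumr_ge0 => b _; apply: sqr_ge0.
rewrite -sum1_card natr_sum mulr_suml.
rewrite [X in _ <= X](eq_bigl (mem W)); last first.
  by move=> b /=; have /implyP := subsetP sWB b; case: (b \in W); case: (b \in B).
apply: ler_sum => b bW; rewrite mul1r.
have -> : Y b = - \sum_(q in S) rho q.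
  rewrite /Y -sumrN; apply: eq_bigr => q qS.
  by rewrite (disjointFl (dTW q qS) bW) sub0r.
by rewrite sqrrN.
Qed.

End HoleEnergy.

(** * Typical vertices and good chains *)

Section RegularPair.

Import Order.TTheory GRing.Theory Num.Theory.
Local Open Scope ring_scope.

Variables (R : realFieldType) (I : finType) (E : rel I) (B0 : {set I}) (x d : R).
Implicit Types (s t : {perm I}) (l : seq I) (U : {set I}).

Definition nb a : {set I} := [set b | E a b].

Definition typical U v : bool :=
  ((1 - x) * d * #|U|%:R <= #|nb v :&: U|%:R) &&
  (#|nb v :&: U|%:R <= (1 + x) * d * #|U|%:R).

(** Regularity in terms of single vertices, as a vertex-by-vertex placement uses it. Both sides of
    the pair are indexed by [I], the first argument of [E] being on the side that is placed at
    random. *)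
Definition regular : Prop := forall U, U \subset B0 -> x * #|I|%:R <= #|U|%:R ->
  #|[set v | ~~ typical U v]|%:R <= x * #|I|%:R.

Definition tset s l : {set I} := [set b in B0 | all (fun p => E (s p) b) l].

(* "Good chain": each vertex of l is placed at a vertex typical for the common
   neighbourhood of those after it, so this neighbourhood shrinks by about d at
   each step. *)
Fixpoint gc s l : bool :=
  if l is p :: l' then gc s l' && typical (tset s l') (s p) else true.

Hypothesis x_gt0 : 0 < x.
Hypothesis x_le : x <= 1 / 2.
Hypothesis d_ge : 1 / 2 <= d.
Hypothesis d_le : d <= 1.
Hypothesis reg : regular.

Lemma tset_cons s p l : tset s (p :: l) = nb (s p) :&: tset s l.
Proof. by apply/setP=> b; rewrite !inE /=; case: (b \in B0); case: (E _ _). Qed.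

Lemma tset_cat s l l' : tset s (l ++ l') = tset s l :&: tset s l'.
Proof.
by apply/setP=> b; rewrite !inE all_cat; case: (b \in B0); case: (all _ l).
Qed.

Lemma tset_sub s l : tset s l \subset B0.
Proof. by apply/subsetP=> b; rewrite inE => /andP[]. Qed.

Lemma eq_tset s t l : {in l, s =1 t} -> tset s l = tset t l.
Proof.
move=> eq_st; apply/setP=> b; rewrite !inE; congr (_ && _).
by apply: eq_in_all => p pl; rewrite eq_st.
Qed.

Lemma eq_gc s t l : {in l, s =1 t} -> gc s l = gc t l.
Proof.
elim: l => //= p l IHl eq_st; rewrite (eq_st p) ?mem_head //.
have eq_st' : {in l, s =1 t} by move=> c cl; apply: eq_st; rewrite in_cons cl orbT.
by rewrite IHl // (eq_tset eq_st').
Qed.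

Lemma xd_ge0 : 0 <= (1 - x) * d.
Proof. by apply: mulr_ge0; move: x_gt0 x_le d_ge; lra. Qed.

Lemma gc_ge s l : gc s l -> ((1 - x) * d) ^+ size l * #|B0|%:R <= #|tset s l|%:R.
Proof.
elim: l => [_|p l IHl] /=.
  rewrite expr0 mul1r (_ : tset s [::] = B0) //.
  by apply/setP=> b; rewrite inE andbT.
case/andP=> /IHl le_l /andP[ge_p _]; rewrite tset_cons exprS -mulrA.
by apply: le_trans ge_p; rewrite ler_wpM2l ?xd_ge0.
Qed.

Lemma gc_le s l : gc s l -> #|tset s l|%:R <= ((1 + x) * d) ^+ size l * #|B0|%:R.
Proof.
elim: l => [_|p l IHl] /=.
  rewrite expr0 mul1r (_ : tset s [::] = B0) //.
  by apply/setP=> b; rewrite inE andbT.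
case/andP=> /IHl le_l /andP[_ le_p]; rewrite tset_cons exprS -mulrA.
apply: le_trans le_p _; rewrite ler_wpM2l // mulr_ge0 //; move: x_gt0 d_ge; lra.
Qed.

(** Union bound along [l]: while the chain is good, the current set is large enough for regularity,
    so the next vertex must hit one of at most x m atypical values among at least m - L unrevealed
    ones. *)
Lemma gc_rare L l : uniq l -> (size l <= L)%N ->
  x * #|I|%:R <= ((1 - x) * d) ^+ L * #|B0|%:R ->
  (#|I|%:R - L%:R) * (\sum_s (~~ gc s l)%:R)
    <= (size l)%:R * (x * #|I|%:R) * #|{: {perm I}}|%:R :> R.
Proof.
move=> + + big; elim: l => [_ _|p l IHl] /=.
  by rewrite !mul0r (eq_bigr (fun=> 0)) // sumr_const mul0rn mulr0.
case/andP=> pl ul lel; have {}IHl := IHl ul (ltnW lel).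
set N := #|{: {perm I}}|%:R in IHl *.
pose C := [set q in l]; pose G s : R := (gc s l)%:R.
pose X s := [set v | ~~ typical (tset s l) v].
have inC s t : {in C, s =1 t} -> {in l, s =1 t}.
  by move=> st c cl; apply: st; rewrite inE.
have G_le s : G s <= 1 by rewrite /G; case: (gc s l) => /=; lra.
have H : #|~: C|%:R * (\sum_s G s * (s p \in X s)%:R) <= x * #|I|%:R * \sum_s G s.
  apply: perm_reveal_le => //; first by rewrite inE.
  - by move=> s t /inC eq_st; rewrite /G (eq_gc eq_st).
  - by move=> s t /inC eq_st; rewrite /X (eq_tset eq_st).
  move=> s; rewrite /G pnatr_eq0 eqb0 negbK => gcl.
  apply: reg; first exact: tset_sub.
  apply: le_trans big _; apply: le_trans (gc_ge gcl); rewrite ler_wpM2r //.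
  apply: ler_wiXn2l; [exact: xd_ge0| |exact: ltnW].
  by apply: mulr_ile1; move: x_gt0 x_le d_ge d_le; lra.
have leN : x * #|I|%:R * (\sum_s G s) <= x * #|I|%:R * N.
  rewrite ler_wpM2l ?mulr_ge0 ?(ltW x_gt0) // /N -sum1_card natr_sum.
  exact: ler_sum.
pose SE := \sum_s G s * (s p \in X s)%:R.
have SE_ge0 : 0 <= SE by apply: sumr_ge0 => s _; rewrite mulr_ge0 ?ler0n.
have cC : #|I|%:R - L%:R <= #|~: C|%:R :> R.
  rewrite lerBlDr -natrD ler_nat -(cardsC C) addnC leq_add2l.
  by rewrite cardsE (card_uniqP ul) ltnW.
have -> : \sum_(s : {perm I}) (~~ (gc s l && typical (tset s l) (s p)))%:R =
    \sum_(s : {perm I}) (~~ gc s l)%:R + SE.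
  rewrite -big_split; apply: eq_bigr => s _ /=; rewrite /G inE.
  by case: (gc s l); case: (typical _ _) => /=; ring.
rewrite mulrDr -add1n natrD [(1 + _) * _]mulrDl mul1r [(_ + _) * N]mulrDl.
rewrite addrC lerD // (le_trans _ leN) // (le_trans _ H) //.
by rewrite ler_wpM2r.
Qed.

End RegularPair.

Section RevealChain.

Import Order.TTheory GRing.Theory Num.Theory.
Local Open Scope ring_scope.

Variables (R : realFieldType) (I : finType) (K : nat) (rho : R).
Variables (ok : {perm I} -> seq I -> bool) (X : {perm I} -> I -> seq I -> {set I}).
Variable (P0 : pred I).
Hypothesis rho_ge0 : 0 <= rho.
Hypothesis ok_nil : forall s, ok s [::].
Hypothesis ok_cons : forall s p l, ok s (p :: l) = ok s l && (s p \in X s p l).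
Hypothesis ok_dep : forall (s t : {perm I}) l, {in l, s =1 t} -> ok s l = ok t l.
Hypothesis X_dep : forall (s t : {perm I}) p l, {in l, s =1 t} -> X s p l = X t p l.
Hypothesis X_low : forall s p l (k : nat), uniq (p :: l) -> {subset p :: l <= P0} ->
  ok s l -> (k <= K)%N -> rho * (#|I|%:R - k%:R) <= #|X s p l|%:R - k%:R.

(** Common shape of hits and acceptance chains: each position must land in a set fixed by the values
    revealed before it. [X_low] keeps the conditional probability at least rho although up to [K]
    values are already taken. *)
Lemma reveal_chain (C : {set I}) (G : {perm I} -> R) l :
  dep_on C G -> (forall s, 0 <= G s) -> uniq l -> {subset l <= P0} ->
  (forall p, p \in l -> p \notin C) -> (#|C| + size l <= K)%N ->
  rho ^+ size l * (\sum_s G s) <= \sum_s G s * (ok s l)%:R.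
Proof.
move=> dG G_ge0; elim: l => [_ _ _ _|p l IHl].
  by rewrite expr0 mul1r; apply: ler_sum => s _; rewrite ok_nil mulr1.
move=> upl lP0 lC leK /=; have /= /andP[pl ul] := upl.
have sub_l (q : I) : q \in l -> q \in p :: l by rewrite in_cons orbC => ->.
have {}IHl : rho ^+ size l * (\sum_s G s) <= \sum_s G s * (ok s l)%:R.
  apply: IHl => //; first by move=> q /sub_l/lP0.
    by move=> q /sub_l/lC.
  by apply: leq_trans leK; rewrite /= addnS.
pose C' := C :|: [set q in l].
pose G' s : R := G s * (ok s l)%:R.
have cC' : #|C'| = (#|C| + size l)%N.
  rewrite cardsU cardsE (card_uniqP ul).
  suff -> : C :&: [set q in l] = set0 by rewrite cards0 subn0.
  apply/setP=> q; rewrite !inE; apply/negbTE/andP=> -[qC ql].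
  by have := lC q (sub_l _ ql); rewrite qC.
have inC s t : {in C', s =1 t} -> {in l, s =1 t} /\ {in C, s =1 t}.
  by move=> st; split=> c cl; apply: st; rewrite !inE cl ?orbT.
have H : rho * (\sum_s G' s) <= \sum_s G' s * (s p \in X s p l)%:R.
  apply: (@perm_reveal_ge R I C' p G' (fun s => X s p l)).
  - by rewrite !inE negb_or pl (lC p) // mem_head.
  - by move=> s t /inC[st1 st2]; rewrite /G' (ok_dep st1) (dG _ _ st2).
  - by move=> s t /inC[st1 st2]; apply: X_dep.
  - by move=> s; rewrite /G' mulr_ge0 ?ler0n.
  move=> s; rewrite /G' => nz.
  have okl : ok s l by apply: contraNT nz => /negbTE->; rewrite mulr0.
  have -> : #|~: C'|%:R = #|I|%:R - #|C'|%:R :> R.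
    by rewrite -(cardsC C') natrD; ring.
  apply: X_low => //; rewrite cC'; apply: leq_trans leK; rewrite /= ; lia.
rewrite exprS -mulrA; apply: le_trans (ler_wpM2l rho_ge0 IHl) _.
apply: le_trans H _; rewrite le_eqVlt; apply/orP; left; apply/eqP.
by apply: eq_bigr => s _; rewrite /G' ok_cons -mulrA -natrM mulnb.
Qed.

End RevealChain.

(** * Hits and acceptance of swaps *)

Section Events.

Import Order.TTheory GRing.Theory Num.Theory.
Local Open Scope ring_scope.

Variables (R : realFieldType) (I : finType) (E : rel I) (B0 : {set I}) (x d : R).
Variables (h : rel I) (D K k : nat) (pc qc : nat -> I).
Implicit Types (s t : {perm I}) (l : seq I) (U : {set I}).

Local Notation m := (#|I|%:R : R).
Local Notation regular := (regular E B0 x d).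

Definition preds q : {set I} := [set p | h p q].
Definition coll b : {set I} := [set a | E a b].
(** These are the positions that restrict some q together with p; disjoint balls keep swaps from
    interfering. *)
Definition ball p : {set I} := p |: [set p' | [exists q, h p q && h p' q]].

Hypothesis x_gt0 : 0 < x.
Hypothesis x_le : x <= 1 / 2.
Hypothesis d_ge : 1 / 2 <= d.
Hypothesis d_le : d <= 1.
Hypothesis reg : regular.
Hypothesis degL : forall p, (#|[set q | h p q]| <= D)%N.
Hypothesis degR : forall q, (#|preds q| <= D)%N.
Hypothesis K_le : (2 * K <= #|I|)%N.

Section Hits.

Hypothesis disj : forall i j, (i < j < k)%N -> [disjoint preds (qc i) & preds (qc j)].
Hypothesis sizeK : (k * D <= K)%N.

Definition hit b i s : bool := [forall p in preds (qc i), E (s p) b].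

Lemma bigcup_ord_card (Bl : nat -> {set I}) i c :
  (forall j, (#|Bl j| <= c)%N) -> (#|\bigcup_(j < i) Bl j| <= i * c)%N.
Proof.
move=> leB; have := @bigcup_card_le 'I_i I setT (fun j => Bl j) c.
by rewrite cardsT card_ord (eq_bigl xpredT) => [|j]; rewrite ?inE //; apply.
Qed.

(** A hit makes [b] eligible as the image of [qc i]. Whatever was revealed before, it has
    probability at least rho^D; the [K] subtracted from the degree of [b] accounts for values
    already used. *)
Lemma few_hits b (rho : R) n : 0 <= rho -> rho <= 1 -> rho * m + K%:R <= #|coll b|%:R ->
  #|[set s | (\sum_(i < k) hit b i s < n)%N]|%:R
    <= 2 ^+ n * (1 - rho ^+ D / 2) ^+ k * #|{: {perm I}}|%:R :> R.
Proof.
move=> rho_ge0 rho_le1 rho_low.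
apply: (@perm_few_events R I k n (fun i => preds (qc i)) (fun i => hit b i)) => //.
- move=> i ltik s t eq_st; apply: eq_forallb => p.
  by case pq: (p \in _) => //=; rewrite (eq_st _ pq).
- move=> i G ltik dG G_ge0.
  pose ok s l := all (fun p => E (s p) b) l.
  have H := @reveal_chain R I K rho ok (fun s p l => coll b) predT rho_ge0.
  have hitE s : hit b i s = ok s (enum (preds (qc i))).
    apply/forall_inP/allP => [hb p|ha p pq]; first by rewrite mem_enum; apply: hb.
    by apply: ha; rewrite mem_enum.
  under [X in _ <= X]eq_bigr do rewrite hitE.
  apply: le_trans (H _ _ _ _ _ (\bigcup_(j < i) preds (qc j)) G (enum (preds (qc i))) _ _ _ _ _ _) => //.
  + rewrite -cardE ler_wpM2r ?sumr_ge0 //; apply: ler_wiXn2l => //; exact: degR.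
  + by move=> s p l; rewrite /ok /= inE andbC.
  + by move=> s t l st; apply: eq_in_all => p pl; rewrite st.
  + move=> s p l c _ _ _ lecK.
    have c0 : (c%:R : R) <= K%:R by rewrite ler_nat.
    have c1 : 0 <= (c%:R : R) by rewrite ler0n.
    have := mulr_ge0 rho_ge0 c1; move: rho_low; lra.
  + exact: enum_uniq.
  + move=> p; rewrite mem_enum => pq; apply/bigcupP=> -[j _ pj].
    have := disj (i := j) (j := i); rewrite ltn_ord ltik => /(_ isT)/disjointFr/(_ pj).
    by rewrite pq.
  + rewrite -cardE; apply: leq_trans sizeK.
    apply: leq_trans (leq_add (bigcup_ord_card _ (fun j => degR (qc j))) (degR (qc i))) _.
    by rewrite addnC -mulSn leq_mul2r ltik orbT.
- by apply: exprn_ile1.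
Qed.

End Hits.

Section Acceptance.

Variable a : I.
Implicit Types (p q b : I).

(** The candidates for q once [a] occupies a predecessor of q and the positions in [l] are filled by
    s. *)
Definition ext_set s q l : {set I} :=
  [set b in B0 | E a b && all (fun p => h p q ==> E (s p) b) l].

(** Typical values qualify, as (1 - x) d >= 1/4; the factor 4 is all that is needed later. *)
Definition ext_ok p0 s p l : {set I} :=
  [set v | [forall q, h p0 q && h p q ==>
     (#|ext_set s q l| <= 4 * #|nb E v :&: ext_set s q l|)%N]].

Fixpoint ext_chain p0 s l : bool :=
  if l is p :: l' then ext_chain p0 s l' && (s p \in ext_ok p0 s p l') else true.

(* accept b p0 s means that the value s p0 may be moved to a position asking for a
   neighbour of b, its place at p0 being taken by the vertex a. *)
Definition accept b p0 s : bool :=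
  ext_chain p0 s (enum (ball p0 :\ p0)) && E (s p0) b.

Lemma eq_ext_set s t q l : {in l, s =1 t} -> ext_set s q l = ext_set t q l.
Proof.
move=> eq_st; apply/setP=> b; rewrite !inE; congr (_ && (_ && _)).
by apply: eq_in_all => p pl; rewrite eq_st.
Qed.

Lemma eq_ext_ok p0 s t p l : {in l, s =1 t} -> ext_ok p0 s p l = ext_ok p0 t p l.
Proof.
move=> eq_st; apply/setP=> v; rewrite !inE; apply: eq_forallb => q.
by rewrite (eq_ext_set _ eq_st).
Qed.

Lemma eq_ext_chain p0 s t l : {in l, s =1 t} -> ext_chain p0 s l = ext_chain p0 t l.
Proof.
elim: l => //= p l IHl eq_st; rewrite (eq_st p) ?mem_head //.
have eq_st' : {in l, s =1 t} by move=> c cl; apply: eq_st; rewrite in_cons cl orbT.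
by rewrite IHl // (eq_ext_ok _ _ eq_st').
Qed.

Lemma dep_accept b p0 : dep_on (ball p0) (accept b p0).
Proof.
move=> s t eq_st; rewrite /accept (eq_st p0) ?inE ?eqxx //.
congr (_ && _); apply: eq_ext_chain => p; rewrite mem_enum => /setD1P[_].
exact: eq_st.
Qed.

Lemma ext_chain_size p0 s q l : h p0 q -> ext_chain p0 s l ->
  (#|nb E a :&: B0| <= 4 ^ count (h^~ q) l * #|ext_set s q l|)%N.
Proof.
move=> hq; elim: l => [_|p l IHl] /=.
  rewrite mul1n; apply: eq_leq; apply: eq_card => b; rewrite !inE andbT.
  by rewrite andbC.
case/andP=> /IHl le_l; rewrite inE => /forallP/(_ q); rewrite hq /=.
have [hpq|hpq] /= := boolP (h p q); last first.
  move=> _; rewrite add0n; apply: leq_trans le_l _; rewrite leq_mul2l; apply/orP; right.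
  by apply/subset_leq_card/subsetP=> b; rewrite !inE /= (negbTE hpq).
move=> le4; apply: leq_trans le_l _; rewrite add1n expnSr -mulnA leq_mul2l.
apply/orP; right; apply: leq_trans le4 _; rewrite leq_mul2l /=.
apply/subset_leq_card/subsetP=> b; rewrite !inE /= hpq /=.
by case/andP=> -> /and3P[-> -> ->].
Qed.

(** At most D positions of the ball precede q, and each of them costs a factor 4. *)
Lemma accept_ext b p0 q s : h p0 q -> accept b p0 s ->
  (#|nb E a :&: B0| <= 4 ^ D *
     #|[set b' in B0 | E a b' && [forall p, h p q && (p != p0) ==> E (s p) b']]|)%N.
Proof.
move=> hq /andP[/(ext_chain_size hq) le_ext _]; apply: leq_trans le_ext _.
apply: leq_mul.
  rewrite leq_exp2l //; apply: leq_trans (degR q); rewrite -size_filter.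
  rewrite -(card_uniqP (filter_uniq _ (enum_uniq _))).
  by apply/subset_leq_card/subsetP=> p; rewrite mem_filter inE => /andP[].
apply/subset_leq_card/subsetP=> b'; rewrite !inE => /and3P[-> -> /allP ha] /=.
apply/forallP=> p; apply/implyP=> /andP[hpq pp0].
have := ha p; rewrite mem_enum !inE pp0 hpq /=; apply; rewrite (negbTE pp0) /=.
by apply/existsP; exists q; rewrite hq hpq.
Qed.

Hypothesis D_gt0 : (0 < D)%N.
Hypothesis deg_a : 4 ^+ D * (x * m) <= #|nb E a :&: B0|%:R.
Hypothesis disj : forall i j, (i < j < k)%N -> [disjoint ball (pc i) & ball (pc j)].
Hypothesis sizeK : (k * (D * D).+1 <= K)%N.

Lemma card_ball p : (#|ball p| <= (D * D).+1)%N.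
Proof.
rewrite -add1n /ball; apply: leq_trans (leq_card_setU _ _) _; rewrite cards1 leq_add2l.
apply: leq_trans (_ : #|\bigcup_(q in [set q | h p q]) preds q| <= _)%N.
  apply/subset_leq_card/subsetP=> p'; rewrite inE => /existsP[q /andP[hpq hp'q]].
  by apply/bigcupP; exists q; rewrite inE.
apply: leq_trans (bigcup_card_le (k := D) _) _ => [q _|]; first exact: degR.
by rewrite leq_mul2r degL orbT.
Qed.

Lemma card_bigcup_sum (J L : finType) (P : pred J) (S : J -> {set L}) :
  (#|\bigcup_(j | P j) S j| <= \sum_(j | P j) #|S j|)%N.
Proof.
elim/big_rec2: _ => [|j n Y _ IH]; first by rewrite cards0.
by apply: leq_trans (leq_card_setU _ _) _; rewrite leq_add2l.
Qed.

(** A value outside [ext_ok] is atypical for the candidate set of one of at most D successors. These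
    sets stay above x m because [a] has large degree and the chain loses at most 4^D. *)
Lemma ext_ok_large p0 s p l : uniq l -> ext_chain p0 s l ->
  m - D%:R * (x * m) <= #|ext_ok p0 s p l|%:R.
Proof.
move=> ul okl; have eqm : m = #|ext_ok p0 s p l|%:R + #|~: ext_ok p0 s p l|%:R by rewrite -natrD cardsC.
suff : #|~: ext_ok p0 s p l|%:R <= D%:R * (x * m) by move: eqm; lra.
apply: le_trans (_ : (\sum_(q | h p0 q && h p q) #|[set v | ~~ typical E x d (ext_set s q l) v]|)%:R <= _).
  rewrite ler_nat; apply: leq_trans (card_bigcup_sum _ _).
  apply/subset_leq_card/subsetP=> v; rewrite !inE negb_forall => /existsP[q].
  rewrite negb_imply => /andP[hq nle]; apply/bigcupP; exists q => //.
  rewrite inE; apply: contra nle => /andP[ge_v _].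
  have u0 : 0 <= #|ext_set s q l|%:R :> R by rewrite ler0n.
  have h0 : 1 / 4 <= (1 - x) * d.
    have : 0 <= (1 / 2 - x) * d by apply: mulr_ge0; move: x_le d_ge; lra.
    by move: d_ge; lra.
  rewrite -(ler_nat R) natrM.
  have := ler_wpM2r u0 h0; move: ge_v; lra.
rewrite natr_sum; apply: le_trans (_ : \sum_(q | h p0 q) x * m <= _); last first.
  have xm0 : 0 <= x * m by rewrite mulr_ge0 ?ler0n // ltW.
  rewrite sumr_const -[x * m *+ _]mulr_natl. rewrite ler_wpM2r // ler_nat.
  by apply: leq_trans (degL p0); apply: eq_leq; apply: eq_card => q; rewrite !inE.
rewrite big_mkcondr /=; apply: ler_sum => q hq; case: ifP => // _; last first.
  by rewrite mulr_ge0 ?ler0n // ltW.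
apply: reg; first by apply/subsetP=> b; rewrite inE => /andP[].
rewrite -(ler_pM2l (x := 4 ^+ D)) ?exprn_gt0 //; apply: le_trans deg_a _.
rewrite -natrX -natrM ler_nat; apply: leq_trans (ext_chain_size hq okl) _.
rewrite leq_mul2r leq_exp2l //; apply/orP; right; apply: leq_trans (degR q).
rewrite -size_filter -(card_uniqP (filter_uniq _ ul)).
by apply/subset_leq_card/subsetP=> p'; rewrite mem_filter inE => /andP[].
Qed.

(** The D * D other positions of the ball succeed with probability at least 1 - 2 D x each, the 2
    being due to at most half of the values being taken. Then the centre lands next to [b] with
    probability at least rho. *)
Lemma few_accepts b (rho : R) n : 0 <= rho -> rho <= 1 -> rho * m + K%:R <= #|coll b|%:R ->
  2 * D%:R * x <= 1 ->
  #|[set s | (\sum_(i < k) accept b (pc i) s < n)%N]|%:R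
    <= 2 ^+ n * (1 - rho * (1 - 2 * D%:R * x) ^+ (D * D) / 2) ^+ k * #|{: {perm I}}|%:R :> R.
Proof.
move=> rho_ge0 rho_le1 rho_low Dx.
have th_ge0 : 0 <= 1 - 2 * D%:R * x by lra.
have th_le1 : 1 - 2 * D%:R * x <= 1.
  by have := mulr_ge0 (ler0n R D) (ltW x_gt0); lra.
apply: (@perm_few_events R I k n (fun i => ball (pc i)) (fun i => accept b (pc i))) => //.
- by move=> i ltik; apply: dep_accept.
- move=> i G ltik dG G_ge0.
  set p0 := pc i; set l := enum (ball p0 :\ p0); set C := \bigcup_(j < i) _ in dG.
  have ul : uniq l by apply: enum_uniq.
  have lC p : p \in ball p0 -> p \notin C.
    move=> pB; apply/bigcupP=> -[j _ pj].
    have := disj (i := j) (j := i); rewrite ltn_ord ltik => /(_ isT)/disjointFr/(_ pj).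
    by rewrite pB.
  have lB p : p \in l -> p \in ball p0 by rewrite mem_enum => /setD1P[].
  have p0B : p0 \in ball p0 by rewrite !inE eqxx.
  have cCl : (#|C| + (size l).+1 <= K)%N.
    have cb : (size l).+1 = #|ball p0|.
      by rewrite -cardE (cardsD1 p0 (ball p0)) p0B.
    rewrite cb; apply: leq_trans sizeK.
    apply: leq_trans (leq_add (bigcup_ord_card _ (fun j => card_ball (pc j))) (card_ball p0)) _.
    by rewrite addnC -mulSn leq_mul2r ltik orbT.
  have H1 : (1 - 2 * D%:R * x) ^+ (D * D) * (\sum_s G s) <= \sum_s G s * (ext_chain p0 s l)%:R.
    apply: le_trans (@reveal_chain R I K (1 - 2 * D%:R * x) (ext_chain p0) (ext_ok p0)
       predT th_ge0 _ _ _ _ _ C G l _ _ _ _ _ _) => //.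
    + rewrite ler_wpM2r ?sumr_ge0 //; apply: ler_wiXn2l => //.
      have := card_ball p0; rewrite (cardsD1 p0 (ball p0)) p0B /=.
      by rewrite -cardE.
    + exact: eq_ext_chain.
    + by move=> s t p l'; apply: eq_ext_ok.
    + move=> s p l' c /= /andP[_ ul'] _ okl' lecK.
      have := ext_ok_large p ul' okl'.
      have : 2 * (c%:R : R) <= m.
        by rewrite -natrM ler_nat; apply: leq_trans K_le; rewrite leq_mul2l lecK.
      have Dx0 : 0 <= D%:R * x by rewrite mulr_ge0 ?ler0n // ltW.
      move=> h1 h2; have h3 := ler_wpM2l Dx0 h1; lra.
    + by move=> p /lB/lC.
    + by apply: leq_trans cCl; rewrite addnS.
  pose C' := C :|: [set q in l].
  pose G' s : R := G s * (ext_chain p0 s l)%:R.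
  have inC s t : {in C', s =1 t} -> {in l, s =1 t} /\ {in C, s =1 t}.
    by move=> st; split=> c cl; apply: st; rewrite !inE cl ?orbT.
  have cC' : (#|C'| <= K)%N.
    apply: leq_trans (leq_card_setU _ _) _; rewrite cardsE (card_uniqP ul).
    by apply: leq_trans cCl; rewrite addnS.
  have H : rho * (\sum_s G' s) <= \sum_s G' s * (s p0 \in coll b)%:R.
    apply: (@perm_reveal_ge R I C' p0 G' (fun s => coll b)) => //.
    + rewrite !inE negb_or lC ?mem_enum ?inE ?eqxx //.
    + by move=> s t /inC[st1 st2]; rewrite /G' (eq_ext_chain _ st1) (dG _ _ st2).
    + by move=> s; rewrite /G' mulr_ge0 ?ler0n.
    move=> s _.
    have -> : #|~: C'|%:R = m - #|C'|%:R :> R by rewrite -(cardsC C') natrD; ring.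
    have c0 : (#|C'|%:R : R) <= K%:R by rewrite ler_nat.
    have := mulr_ge0 rho_ge0 (ler0n R #|C'|); move: rho_low; lra.
  rewrite -mulrA; apply: le_trans (ler_wpM2l rho_ge0 H1) _.
  apply: le_trans H _; rewrite le_eqVlt; apply/orP; left; apply/eqP.
  by apply: eq_bigr => s _; rewrite /G' /accept inE -mulrA -natrM mulnb.
- by apply: mulr_ile1 => //; rewrite ?exprn_ge0 ?exprn_ile1.
Qed.

End Acceptance.

End Events.

(** * Choosing the permutation *)

Section GoodPermutation.

Import Order.TTheory GRing.Theory Num.Theory.
Local Open Scope ring_scope.

Variables (R : realFieldType) (I : finType) (E : rel I) (B0 : {set I}) (x d : R).
Variables (h : rel I) (D k n : nat) (pc qc : nat -> I) (y z : R).
Implicit Types (s t : {perm I}) (l : seq I) (U : {set I}).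

Local Notation m := (#|I|%:R : R).
Local Notation N := (#|{: {perm I}}|%:R : R).
Local Notation preds := (preds h).
Local Notation gc := (gc E B0 x d).
Local Notation accept := (accept E B0 h).
Local Notation hit := (hit E h qc).

(** The pairs excluded from the second-moment estimate: a common predecessor correlates the two
    candidate sets, and a broken chain leaves their sizes or that of their intersection
    uncontrolled. *)
Definition bad_pair s (qq : I * I) : bool :=
  [|| ~~ [disjoint preds qq.1 & preds qq.2], ~~ gc s (enum (preds qq.1)),
      ~~ gc s (enum (preds qq.2)) | ~~ gc s (enum (preds qq.1) ++ enum (preds qq.2))].

Definition bad_vertices s := [set q | ~~ gc s (enum (preds q))].

Definition bad_pairs s := [set qq | bad_pair s qq].

Hypothesis degL : forall p, (#|[set q | h p q]| <= D)%N.
Hypothesis degR : forall q, (#|preds q| <= D)%N.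
Hypothesis hits_fail : forall b, b \in B0 ->
  #|[set s | (\sum_(i < k) hit b i s < n)%N]|%:R <= z * N.
Hypothesis accept_fail : forall a b,
  #|[set s | (\sum_(i < k) accept a b (pc i) s < n)%N]|%:R <= z * N.
Hypothesis gc_fail : forall l, uniq l -> (size l <= 2 * D)%N ->
  \sum_s (~~ gc s l)%:R <= y * N.
Hypothesis y_gt0 : 0 < y.
Hypothesis m_gt0 : (0 < #|I|)%N.
Hypothesis z_ge0 : 0 <= z.
Hypothesis z_small : 8 * z * (m * m) <= 1.

Lemma card_close_pairs :
  (#|[set qq : I * I | ~~ [disjoint preds qq.1 & preds qq.2]]| <= #|I| * (D * D))%N.
Proof.
apply: leq_trans (_ : #|\bigcup_(p in [set: I]) setX [set q | h p q] [set q | h p q]| <= _)%N.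
  apply/subset_leq_card/subsetP=> -[q q']; rewrite inE -setI_eq0 /=.
  case/set0Pn=> p; rewrite !inE => /andP[hq hq'].
  by apply/bigcupP; exists p; rewrite ?inE //= hq hq'.
rewrite -cardsT; apply: bigcup_card_le => p _; rewrite cardsX.
by apply: leq_mul; apply: degL.
Qed.

Lemma sum_bad_vertices : \sum_s #|bad_vertices s|%:R <= m * y * N.
Proof.
have -> : \sum_s #|bad_vertices s|%:R =
    \sum_q \sum_s (~~ gc s (enum (preds q)))%:R :> R.
  rewrite exchange_big /=; apply: eq_bigr => s _; rewrite -natr_sum; congr _%:R.
  by rewrite -sum1_card big_mkcond /=; apply: eq_bigr => q _; rewrite inE; case: (~~ _).
apply: le_trans (_ : \sum_(q : I) y * N <= _).
  apply: ler_sum => q _; apply: gc_fail; first exact: enum_uniq.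
  by rewrite -cardE; apply: leq_trans (degR q) _; rewrite leq_pmull.
by rewrite sumr_const -[_ *+ _]mulr_natl mulrA.
Qed.

Lemma sum_bad_pairs :
  \sum_s #|bad_pairs s|%:R <= (m * (D * D)%:R + 3 * (m * m) * y) * N.
Proof.
have N0 : 0 <= N by rewrite ler0n.
have -> : \sum_s #|bad_pairs s|%:R = \sum_(qq : I * I) \sum_s (bad_pair s qq)%:R :> R.
  rewrite exchange_big /=; apply: eq_bigr => s _; rewrite -natr_sum; congr _%:R.
  by rewrite -sum1_card big_mkcond /=; apply: eq_bigr => q _; rewrite inE; case: (bad_pair _ _).
apply: le_trans (_ : \sum_(qq : I * I)
   ((~~ [disjoint preds qq.1 & preds qq.2])%:R * N + 3 * y * N) <= _).
  apply: ler_sum => -[q q'] _; rewrite /bad_pair /=.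
  case: (boolP [disjoint _ & _]) => [dqq'|_] /=; last first.
    rewrite -[X in X <= _]addr0 lerD //; last by rewrite !mulr_ge0 // ltW.
    by rewrite mul1r sumr_const.
  rewrite mul0r add0r.
  have uc : uniq (enum (preds q) ++ enum (preds q')).
    rewrite cat_uniq !enum_uniq andbT /=; apply/hasPn=> p; rewrite !mem_enum => pq'.
    by rewrite (disjointFl dqq' pq').
  have b1 := @gc_fail (enum (preds q)) (enum_uniq _).
  have b2 := @gc_fail (enum (preds q')) (enum_uniq _).
  have b3 := @gc_fail _ uc.
  apply: le_trans (_ : \sum_s ((~~ gc s (enum (preds q)))%:R
      + (~~ gc s (enum (preds q')))%:R
      + (~~ gc s (enum (preds q) ++ enum (preds q')))%:R) <= _).
    apply: ler_sum => s _; rewrite -!natrD ler_nat.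
    by do 3 case: (gc s _).
  rewrite !big_split /=.
  have -> : 3 * y * N = y * N + y * N + y * N by ring.
  apply: lerD; first apply: lerD.
  - by apply: b1; rewrite -cardE; apply: leq_trans (degR q) _; rewrite leq_pmull.
  - by apply: b2; rewrite -cardE; apply: leq_trans (degR q') _; rewrite leq_pmull.
  - by apply: b3; rewrite size_cat -!cardE mul2n -addnn leq_add // degR.
rewrite big_split /= -mulr_suml sumr_const card_prod.
have -> : 3 * y * N *+ (#|I| * #|I|) = 3 * (m * m) * y * N.
  by rewrite -[_ *+ (_ * _)]mulr_natl natrM; ring.
rewrite [X in _ <= X]mulrDl lerD // ler_wpM2r // -natrM -natr_sum ler_nat.
apply: leq_trans card_close_pairs.
by rewrite -sum1_card [X in (_ <= X)%N]big_mkcond /=; apply: leq_sum => qq _; rewrite inE; case: (~~ _).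
Qed.

Lemma good_perm : exists s, [/\
  forall b, b \in B0 -> (n <= \sum_(i < k) hit b i s)%N,
  forall a b, (n <= \sum_(i < k) accept a b (pc i) s)%N,
  #|bad_vertices s|%:R <= 4 * m * y &
  #|bad_pairs s|%:R <= 4 * (m * (D * D)%:R + 3 * (m * m) * y)].
Proof.
pose Y2 := m * (D * D)%:R + 3 * (m * m) * y.
have m0 : 0 < m by rewrite ltr0n.
have my_gt0 : 0 < 4 * m * y by rewrite !mulr_gt0.
have Y2_gt0 : 0 < Y2.
  by apply: ltr_wpDl; rewrite ?mulr_ge0 ?mulr_gt0 ?ler0n.
have N_gt0 : 0 < N by rewrite ltr0n; apply/card_gt0P; exists 1%g.
pose F1 b s := (\sum_(i < k) hit b i s < n)%N.
pose F2 ab s := (\sum_(i < k) accept ab.1 ab.2 (pc i) s < n)%N.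
case: (pickP (fun s => [&& [forall b in B0, ~~ F1 b s], [forall ab, ~~ F2 ab s],
   #|bad_vertices s|%:R <= 4 * m * y & #|bad_pairs s|%:R <= 4 * Y2])) => [s|none].
  case/and4P=> /forall_inP h1 /forallP h2 h3 h4; exists s; split=> //.
    by move=> b /h1; rewrite -leqNgt.
  by move=> a b; have := h2 (a, b); rewrite -leqNgt.
(* A permutation failing any requirement has [Phi s] >= 1, while the mean of [Phi] is at most 3/4:
   the two families of rare events give 2 z m^2 <= 1/4, and the two Markov terms 1/4 each. *)
pose Phi s : R := \sum_(b in B0) (F1 b s)%:R + \sum_ab (F2 ab s)%:R
   + #|bad_vertices s|%:R / (4 * m * y) + #|bad_pairs s|%:R / (4 * Y2).
have Phi_ge s : 1 <= Phi s.
  have p1 : 0 <= \sum_(b in B0) (F1 b s)%:R :> R by apply: sumr_ge0 => *; rewrite ler0n.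
  have p2 : 0 <= \sum_ab (F2 ab s)%:R :> R by apply: sumr_ge0 => *; rewrite ler0n.
  have p3 : 0 <= #|bad_vertices s|%:R / (4 * m * y) by rewrite divr_ge0 ?ler0n // ltW.
  have p4 : 0 <= #|bad_pairs s|%:R / (4 * Y2) by rewrite divr_ge0 ?mulr_ge0 ?ler0n // ltW.
  have /negbT := none s; rewrite !negb_and -!ltNge => /or4P[/forall_inPn[b bB]|/forallPn[ab]|lt3|lt4].
  - rewrite negbK => F1b; have : 1 <= \sum_(b in B0) (F1 b s)%:R :> R.
      by rewrite (bigD1 b) //= F1b lerDl sumr_ge0 // => *; rewrite ler0n.
    by rewrite /Phi; lra.
  - rewrite negbK => F2b; have : 1 <= \sum_ab (F2 ab s)%:R :> R.
      by rewrite (bigD1 ab) //= F2b lerDl sumr_ge0 // => *; rewrite ler0n.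
    by rewrite /Phi; lra.
  - have : 1 <= #|bad_vertices s|%:R / (4 * m * y) by rewrite ler_pdivlMr // mul1r ltW.
    by rewrite /Phi; lra.
  - have : 1 <= #|bad_pairs s|%:R / (4 * Y2) by rewrite ler_pdivlMr ?mulr_gt0 // mul1r ltW.
    by rewrite /Phi; lra.
have : \sum_s Phi s <= m * (z * N) + m * m * (z * N) + N / 4 + N / 4.
  rewrite /Phi !big_split /= !lerD //.
  - rewrite exchange_big /=; apply: le_trans (_ : \sum_(b in B0) z * N <= _).
      apply: ler_sum => b /hits_fail; apply: le_trans; rewrite -natr_sum ler_nat.
      by rewrite -sum1_card [X in (_ <= X)%N]big_mkcond /=; apply: leq_sum => s _; rewrite inE /F1; case: (_ < _)%N.
    rewrite sumr_const -[_ *+ _]mulr_natl ler_wpM2r ?mulr_ge0 ?ler0n // ler_nat.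
    exact: max_card.
  - rewrite exchange_big /=; apply: le_trans (_ : \sum_(b : I * I) z * N <= _).
      apply: ler_sum => -[a b] _; apply: le_trans (accept_fail a b); rewrite -natr_sum ler_nat.
      by rewrite -sum1_card [X in (_ <= X)%N]big_mkcond /=; apply: leq_sum => s _; rewrite inE /F2; case: (_ < _)%N.
    by rewrite sumr_const card_prod -[_ *+ _]mulr_natl natrM.
  - rewrite -mulr_suml ler_pdivrMr //; apply: le_trans sum_bad_vertices _.
    by rewrite le_eqVlt; apply/orP; left; apply/eqP; field.
  - rewrite -mulr_suml ler_pdivrMr ?mulr_gt0 //; apply: le_trans sum_bad_pairs _.
    by rewrite le_eqVlt; apply/orP; left; apply/eqP; rewrite /Y2; field.
have : N <= \sum_s Phi s by rewrite -sum1_card natr_sum; apply: ler_sum.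
have zmm : 8 * z * (m * m) * N <= N by rewrite -[X in _ <= X]mul1r ler_wpM2r // ltW.
have zm : m * (z * N) <= m * m * (z * N).
  rewrite ler_wpM2r ?mulr_ge0 ?ler0n // ler_peMr ?ler0n // ler1n //.
move=> a1 a2; have a3 : N <= m * m * (z * N) + m * m * (z * N) + N / 4 + N / 4 by lra.
exfalso; move: zmm a3 N_gt0; lra.
Qed.

End GoodPermutation.

(** * Repairing badly placed vertices by swaps *)

Section Repair.

Import Order.TTheory GRing.Theory Num.Theory.
Local Open Scope ring_scope.

Variables (R : realFieldType) (I : finType) (E : rel I) (B0 : {set I}) (x d : R).
Variables (h : rel I) (D k n : nat) (pc : nat -> I) (s : {perm I}).
Variables (Pbad : {set I}) (tgt : I -> I) (A0 : nat).
Implicit Types (f : {perm I}) (U : {set I}).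

Local Notation m := (#|I|%:R : R).
Local Notation preds := (preds h).
Local Notation ball := (ball h).
Local Notation accept := (accept E B0 h).

Hypothesis x_ge0 : 0 <= x.
Hypothesis x_le : x <= 1 / 2.
Hypothesis d_ge : 1 / 2 <= d.
Hypothesis reg : regular E B0 x d.
Hypothesis degL : forall p, (#|[set q | h p q]| <= D)%N.
Hypothesis degR : forall q, (#|preds q| <= D)%N.
Hypothesis disj : forall i j, (i < j < k)%N -> [disjoint ball (pc i) & ball (pc j)].
Hypothesis acceptE : forall a b, (n <= \sum_(i < k) accept a b (pc i) s)%N.
Hypothesis deg_nb : forall a, (A0 <= #|nb E a :&: B0|)%N.
Hypothesis big_B0 : 4 ^+ (2 * D) * (x * m) <= #|B0|%:R.
Hypothesis n_large : 2 * #|Pbad|%:R + D%:R * (x * m) < n%:R.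

Definition placed_set (P : {set I}) f q : {set I} :=
  [set b in B0 | [forall p, (p \in P) && h p q ==> E (f p) b]].

Hypothesis init : forall q,
  (#|B0| <= 4 ^ D * #|placed_set (~: Pbad) s q|)%N.

Let pcI (i : 'I_k) := pc i.

Lemma mem_ball p : p \in ball p.
Proof. by rewrite !inE eqxx. Qed.

Lemma preds_ball p q p' : h p q -> h p' q -> p' \in ball p.
Proof. by move=> hp hp'; rewrite !inE; apply/orP; right; apply/existsP; exists q; rewrite hp. Qed.

Lemma disj_ball (i j : 'I_k) : i != j -> [disjoint ball (pcI i) & ball (pcI j)].
Proof.
rewrite -val_eqE neq_ltn => /orP[] ltij; first by apply: disj; rewrite ltij /=.
by rewrite disjoint_sym; apply: disj; rewrite ltij /=.
Qed.

Lemma pcI_inj : injective pcI.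
Proof.
move=> i j eq_pc; apply/eqP; apply: contraTT (mem_ball (pcI i)) => /disj_ball.
by rewrite -eq_pc => /disjointFr dd; apply/negP=> ib; have := dd _ ib; rewrite ib.
Qed.

(** [P] holds the repaired positions, [Us] the indices of the centres spent on them. A successor of
    a spent centre now has a displaced vertex among its predecessors, about which only the degree
    bound [A0] is known; the other positions lose a factor 4 per repaired predecessor. *)
Record repair_state (P : {set I}) (Us : {set 'I_k}) f : Prop := RepairState {
  rs_sub : P \subset Pbad;
  rs_card : #|Us| = #|P|;
  rs_same : forall p, p \notin P -> (forall i, i \in Us -> p != pcI i) -> f p = s p;
  rs_avoid : forall i, i \in Us -> [disjoint ball (pcI i) & Pbad];
  rs_rich : forall q, (forall i, i \in Us -> ~~ h (pcI i) q) ->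
    (#|B0| <= 4 ^ (D + #|preds q :&: P|) * #|placed_set (~: Pbad :|: P) f q|)%N;
  rs_used : forall i q, i \in Us -> h (pcI i) q ->
    (A0 <= 4 ^ D * #|placed_set (~: Pbad :|: P) f q|)%N;
  rs_tgt : forall p, p \in P -> E (f p) (tgt p) }.

(** The count behind [n_large]: among n accepting centres at most #|Pbad| are spent, at most #|Pbad|
    have balls meeting [Pbad], and at most D x m carry a vertex atypical for a successor of p. *)
Lemma repair_choice P Us f p : repair_state P Us f -> p \in Pbad -> p \notin P ->
  exists i : 'I_k, [/\ i \notin Us, [disjoint ball (pcI i) & Pbad],
    accept (s p) (tgt p) (pcI i) s &
    forall q, h p q -> (#|placed_set (~: Pbad :|: P) f q|
      <= 4 * #|nb E (s (pcI i)) :&: placed_set (~: Pbad :|: P) f q|)%N].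
Proof.
move=> rs pbad pP.
pose Tq q := placed_set (~: Pbad :|: P) f q.
pose X1 : {set 'I_k} := [set i | accept (s p) (tgt p) (pcI i) s].
pose X2 : {set 'I_k} := [set i | ~~ [disjoint ball (pcI i) & Pbad]].
pose V := \bigcup_(q in [set q | h p q]) [set v | ~~ typical E x d (Tq q) v].
pose X3 : {set 'I_k} := [set i | s (pcI i) \in V].
have cX1 : (n <= #|X1|)%N.
  apply: leq_trans (acceptE (s p) (tgt p)) _; rewrite -sum1_card big_mkcond /=.
  by rewrite [X in (_ <= X)%N]big_mkcond; apply: leq_sum => i _; rewrite inE; case: (accept _ _ _ _).
(* The balls are disjoint, so those meeting [Pbad] contain distinct elements of it. *)
have cX2 : (#|X2| <= #|Pbad|)%N.
  pose w (i : 'I_k) := odflt p [pick p' in ball (pcI i) :&: Pbad].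
  have wP i : i \in X2 -> w i \in ball (pcI i) :&: Pbad.
    rewrite inE -setI_eq0 => /set0Pn[p' p'B]; rewrite /w.
    by case: pickP => [//|/(_ p')]; rewrite /= p'B.
  have w_inj : {in X2 &, injective w}.
    move=> i j iX jX eq_w; apply/eqP; apply: contraT => /disj_ball/disjointFr dd.
    have /setIP[wi _] := wP i iX; have /setIP[wj _] := wP j jX; rewrite eq_w in wi.
    by have := dd _ wi; rewrite wj.
  rewrite -(card_in_imset w_inj); apply/subset_leq_card/subsetP=> _ /imsetP[i iX ->].
  by case/setIP: (wP i iX).
have Tq_sub q : Tq q \subset B0 by apply/subsetP=> b; rewrite inE => /andP[].
have Tq_big q : h p q -> x * m <= #|Tq q|%:R.
  move=> hpq; have p4 : 0 < 4 ^+ (2 * D) :> R by rewrite exprn_gt0.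
  rewrite -(ler_pM2l p4); apply: le_trans big_B0 _; rewrite -natrX -natrM ler_nat.
  have := rs_rich rs (q := q); move/(_ _)/leq_trans; apply.
    move=> i iU; apply/negP=> hiq.
    have := disjointFr (rs_avoid rs iU) (preds_ball hiq hpq); by rewrite pbad.
  rewrite leq_mul2r leq_exp2l // mul2n -addnn leq_add2l; apply/orP; right.
  by apply: leq_trans (degR q); rewrite subset_leq_card ?subsetIl.
have cX3 : #|X3|%:R <= D%:R * (x * m).
  apply: le_trans (_ : #|V|%:R <= _).
    rewrite ler_nat; have s_inj : injective (fun i => s (pcI i)) by move=> i j /perm_inj/pcI_inj.
    rewrite -(card_imset _ s_inj); apply/subset_leq_card/subsetP=> _ /imsetP[i iX ->].
    by move: iX; rewrite inE.
  apply: le_trans (_ : (\sum_(q in [set q | h p q]) #|[set v | ~~ typical E x d (Tq q) v]|)%:R <= _).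
    by rewrite ler_nat; apply: card_bigcup_sum.
  rewrite natr_sum; apply: le_trans (_ : \sum_(q in [set q | h p q]) x * m <= _).
    by apply: ler_sum => q; rewrite inE => hpq; apply: reg; [apply: Tq_sub|apply: Tq_big].
  rewrite sumr_const -[_ *+ _]mulr_natl ler_wpM2r ?ler_nat ?degL //.
  by rewrite mulr_ge0 ?ler0n.
have cUs : (#|Us| <= #|Pbad|)%N by rewrite (rs_card rs) subset_leq_card ?(rs_sub rs).
have : (0 < #|X1 :\: (Us :|: X2 :|: X3)|)%N.
  rewrite cardsD subn_gt0; apply: leq_ltn_trans (subset_leq_card (subsetIr _ _)) _.
  rewrite -(ltr_nat R); apply: le_lt_trans (_ : #|Us|%:R + #|X2|%:R + #|X3|%:R < _).
    rewrite -!natrD ler_nat; apply: leq_trans (leq_card_setU _ _) _.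
    by rewrite leq_add2r leq_card_setU.
  apply: lt_le_trans (_ : n%:R <= _); last by rewrite ler_nat.
  apply: le_lt_trans n_large.
  have e1 : #|Us|%:R <= #|Pbad|%:R :> R by rewrite ler_nat.
  have e2 : #|X2|%:R <= #|Pbad|%:R :> R by rewrite ler_nat.
  lra.
case/card_gt0P=> i; rewrite in_setD !in_setU !negb_or -!andbA => /and4P[iU iX2 iX3 iX1].
exists i; split=> //.
- by move: iX2; rewrite inE negbK.
- by move: iX1; rewrite inE.
move=> q hpq; move: iX3; rewrite inE => viV.
have : typical E x d (Tq q) (s (pcI i)).
  apply: contraNT viV => ntyp; apply/bigcupP; exists q; rewrite ?inE //.
case/andP=> ge_v _.
have u0 : 0 <= #|Tq q|%:R :> R by rewrite ler0n.
have h0 : 1 / 4 <= (1 - x) * d.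
  have : 0 <= (1 / 2 - x) * d by apply: mulr_ge0; move: x_le d_ge; lra.
  by move: d_ge; lra.
rewrite -/(Tq q) -(ler_nat R) natrM; have := ler_wpM2r u0 h0; move: ge_v; lra.
Qed.

(** The swap puts s c at p and s p at the centre c. No q succeeds both, since the ball of c avoids
    [Pbad]. Hence a candidate set changes at one end only: successors of p are safe by the choice of
    c, those of c by acceptance. *)
Lemma repair_step P Us f p : repair_state P Us f -> p \in Pbad -> p \notin P ->
  exists Us' f', repair_state (p |: P) Us' f'.
Proof.
move=> rs pbad pP; have [i [iU iB acc ext]] := repair_choice rs pbad pP.
pose c := pcI i; pose f' := (tperm p c * f)%g.
exists (i |: Us), f'.
have cbad : c \notin Pbad by rewrite (disjointFr iB) // mem_ball.
have pc_p : p != c by apply: contraNneq cbad => <-.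
have pj j : j \in Us -> p != pcI j.
  by move=> jU; apply: contraTneq pbad => ->; rewrite (disjointFr (rs_avoid rs jU)) ?mem_ball.
have ij j : j \in Us -> i != j by move=> jU; apply: contraNneq iU => ->.
have cP : c \notin P by apply: contra cbad; apply: (subsetP (rs_sub rs)).
have f_c : f c = s c.
  apply: (rs_same rs) => // j jU; apply: contraNneq iU => /pcI_inj->//.
have f_p : f p = s p by apply: (rs_same rs) => //; apply: pj.
have f'p : f' p = s c by rewrite permM tpermL.
have f'c : f' c = s p by rewrite permM tpermR.
have f'o p' : p' != p -> p' != c -> f' p' = f p'.
  by move=> ne1 ne2; rewrite permM tpermD // eq_sym.
have same_T q : ~~ h p q -> ~~ h c q ->
    placed_set (~: Pbad :|: (p |: P)) f' q = placed_set (~: Pbad :|: P) f q.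
  move=> npq ncq; apply/setP=> b; rewrite !inE; congr (_ && _); apply: eq_forallb => p'.
  rewrite !inE; case: (eqVneq p' p) => [->|np] /=; first by rewrite (negbTE npq) !andbF.
  case: (eqVneq p' c) => [->|nc] /=; first by rewrite (negbTE ncq) !andbF.
  by rewrite f'o.
split.
- by rewrite subUset sub1set pbad (rs_sub rs).
- by rewrite !cardsU1 iU pP (rs_card rs).
- move=> p'; rewrite !inE negb_or => /andP[np nP] npc.
  rewrite f'o //; last by apply: npc; rewrite !inE eqxx.
  by apply: (rs_same rs) => // j jU; apply: npc; rewrite !inE jU orbT.
- by move=> j; rewrite !inE => /orP[/eqP->//|]; apply: (rs_avoid rs).
- move=> q nq.
  have ncq : ~~ h c q by apply: nq; rewrite !inE eqxx.
  have nq' j : j \in Us -> ~~ h (pcI j) q by move=> jU; apply: nq; rewrite !inE jU orbT.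
  have rich := rs_rich rs nq'.
  have [hpq|hpq] := boolP (h p q); last first.
    rewrite same_T //; apply: leq_trans rich _; rewrite leq_mul2r leq_exp2l // leq_add2l.
    by apply/orP; right; apply/subset_leq_card/setIS/subsetUr.
  have -> : preds q :&: (p |: P) = p |: (preds q :&: P).
    by apply/setP=> p'; rewrite !inE; case: eqP => [->|] //=; rewrite hpq.
  rewrite cardsU1 !inE (negbTE pP) andbF add1n addnS expnSr -mulnA.
  apply: leq_trans rich _; rewrite leq_mul2l; apply/orP; right.
  apply: leq_trans (ext q hpq) _; rewrite leq_mul2l /=.
  apply/subset_leq_card/subsetP=> b; rewrite !inE => /and3P[Eb -> /forallP all_b] /=.
  apply/forallP=> p'; apply/implyP; rewrite !inE => /andP[p'D hp'q].
  case: (eqVneq p' p) p'D => [->|np] /= p'D; first by rewrite f'p.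
  rewrite f'o //; first by have := all_b p'; rewrite !inE p'D hp'q.
  by apply: contraNneq ncq => <-.
(* A successor of an old centre is unaffected: p lies in [Pbad] and c in a disjoint ball, so neither
   precedes it. *)
- move=> j q; rewrite !inE => /orP[/eqP->|jU] hq; last first.
    have dij := disj_ball (ij j jU).
    rewrite same_T; first exact: (rs_used rs jU).
      apply: contraTN pbad => hpq.
      by rewrite (disjointFr (rs_avoid rs jU)) // (preds_ball hq).
    apply/negP=> hcq; have := disjointFr dij (mem_ball _).
    by rewrite (preds_ball hq hcq).
  apply: leq_trans (deg_nb (s p)) _.
  apply: leq_trans (accept_ext degR hq acc) _; rewrite leq_mul2l; apply/orP; right.
  apply/subset_leq_card/subsetP=> b; rewrite !inE => /and3P[-> Eb /forallP all_b] /=.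
  apply/forallP=> p'; apply/implyP=> /andP[_ hp'q].
  have p'B := preds_ball hq hp'q.
  have p'bad : p' \notin Pbad by rewrite (disjointFr iB).
  case: (eqVneq p' c) => [->|nc]; first by rewrite f'c.
  have np : p' != p by apply: contraNneq p'bad => ->.
  rewrite f'o // (rs_same rs); first by have := all_b p'; rewrite hp'q nc.
    by apply: contra p'bad; apply: (subsetP (rs_sub rs)).
  move=> j' jU; apply/eqP=> eq_p'; have := disjointFr (disj_ball (ij j' jU)) p'B.
  by rewrite eq_p' mem_ball.
- move=> p'; rewrite !inE => /orP[/eqP->|p'P].
    by rewrite f'p; case/andP: acc.
  rewrite f'o; first exact: (rs_tgt rs).
    by apply: contraNneq pP => <-.
  by apply: contraNneq cP => <-.
Qed.

(* Each p in Pbad swaps its value with that of its own centre pc i, which has to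
   accept s p in exchange; the balls around the centres are disjoint, so the
   repairs do not interfere. *)
Lemma repair_exists : exists f, [/\
  forall q, (#|B0| <= 4 ^ (2 * D) * #|placed_set setT f q|)%N
     \/ (A0 <= 4 ^ D * #|placed_set setT f q|)%N,
  forall p, p \in Pbad -> E (f p) (tgt p) &
  (#|[set p | f p != s p]| <= 2 * #|Pbad|)%N].
Proof.
have [Us [f rs]] : exists Us f, repair_state Pbad Us f.
  have all_j j : (j <= #|Pbad|)%N -> exists P Us f, repair_state P Us f /\ #|P| = j.
    elim: j => [_|j IHj ltj].
      exists set0, set0, s; split; last by rewrite cards0.
      split=> //; rewrite ?sub0set ?cards0 //; try by move=> ?; rewrite inE.
      + by move=> q _; rewrite setI0 cards0 addn0 setU0.
    case: (IHj (ltnW ltj)) => P [Us [f [rs cP]]].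
    have [p pbad pP] : exists2 p, p \in Pbad & p \notin P.
      apply/subsetPn; apply: contraTN ltj => sPbad; rewrite -leqNgt -cP.
      exact: subset_leq_card.
    have [Us' [f' rs']] := repair_step rs pbad pP.
    by exists (p |: P), Us', f'; split=> //; rewrite cardsU1 pP cP.
  have [P [Us [f [rs cP]]]] := all_j _ (leqnn _).
  exists Us, f; suff <- : P = Pbad by [].
  by apply/eqP; rewrite eqEcard (rs_sub rs) cP leqnn.
exists f; split.
- have DT : ~: Pbad :|: Pbad = setT by rewrite setUC setUCr.
  move=> q; have [/existsP[i /andP[iU hi]]|none] := boolP [exists i in Us, h (pcI i) q].
    by right; have := rs_used rs iU hi; rewrite DT.
  left; have := rs_rich rs (q := q); rewrite DT => rich.
  apply: leq_trans (rich _) _.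
    by move=> i iU; apply: contra none => hi; apply/existsP; exists i; rewrite iU.
  rewrite leq_mul2r leq_exp2l // mul2n -addnn leq_add2l; apply/orP; right.
  by apply: leq_trans (degR q); rewrite subset_leq_card ?subsetIl.
- exact: (rs_tgt rs).
- rewrite mul2n -addnn -{2}(rs_card rs) -(card_imset _ pcI_inj).
  apply: leq_trans (leq_card_setU Pbad (pcI @: Us)).
  apply/subset_leq_card/subsetP=> p; rewrite !inE; apply: contraNT.
  rewrite negb_or => /andP[pbad pU]; apply/eqP/(rs_same rs) => // i iU.
  by apply: contraNneq pU => ->; apply: imset_f.
Qed.

End Repair.

(** * Completing the embedding by Hall's theorem *)

Section Spanning.

Import Order.TTheory GRing.Theory Num.Theory.
Local Open Scope ring_scope.

Variables (R : realFieldType) (I : finType) (E : rel I) (B0 : {set I}) (x d : R).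
Variables (h : rel I) (D K k n A0 : nat) (pc qc : nat -> I).
Variables (y z u rho1 rho2 g0 pb : R).

Local Notation m := (#|I|%:R : R).
Local Notation preds := (preds h).
Local Notation ball := (ball h).
Local Notation LB := (~: B0).

Hypothesis x_gt0 : 0 < x.
Hypothesis x_le : x <= 1 / 2.
Hypothesis d_ge : 1 / 2 <= d.
Hypothesis d_le : d <= 1.
Hypothesis reg : regular E B0 x d.
Hypothesis D_gt0 : (0 < D)%N.
Hypothesis degL : forall p, (#|[set q | h p q]| <= D)%N.
Hypothesis degR : forall q, (#|preds q| <= D)%N.
Hypothesis K_le : (2 * K <= #|I|)%N.
Hypothesis sizeK : (k * (D * D).+1 <= K)%N.
Hypothesis disj_ball : forall i j, (i < j < k)%N -> [disjoint ball (pc i) & ball (pc j)].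
Hypothesis disj_preds : forall i j, (i < j < k)%N ->
  [disjoint preds (qc i) & preds (qc j)] /\ qc i != qc j.
Hypothesis deg_a : forall a, (A0 <= #|nb E a :&: B0|)%N.
Hypothesis A0_big : 4 ^+ D * (x * m) <= A0%:R.
Hypothesis rho1_ge0 : 0 <= rho1.
Hypothesis rho1_le1 : rho1 <= 1.
Hypothesis rho2_ge0 : 0 <= rho2.
Hypothesis rho2_le1 : rho2 <= 1.
Hypothesis deg_B0 : forall b, b \in B0 -> rho1 * m + K%:R <= #|coll E b|%:R.
Hypothesis deg_b : forall b, rho2 * m + K%:R <= #|coll E b|%:R.
Hypothesis Dx : 2 * D%:R * x <= 1.
Hypothesis z1 : 2 ^+ n * (1 - rho1 ^+ D / 2) ^+ k <= z.
Hypothesis z2 : 2 ^+ n * (1 - rho2 * (1 - 2 * D%:R * x) ^+ (D * D) / 2) ^+ k <= z.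
Hypothesis z_ge0 : 0 <= z.
Hypothesis z_small : 8 * z * (m * m) <= 1.
Hypothesis y_gt0 : 0 < y.
Hypothesis m_large : 2 * D%:R < m.
Hypothesis y_big : 2 * D%:R * (x * m) <= y * (m - 2 * D%:R).
Hypothesis B0_big : 4 ^+ (2 * D) * (x * m) <= #|B0|%:R.
Hypothesis pb_big : D%:R * (4 * m * y + #|LB|%:R) <= pb.
Hypothesis n_large : 2 * pb + D%:R * (x * m) < n%:R.
Hypothesis LB_small : (#|LB| <= k)%N.
Hypothesis g0_B0 : 4 ^+ (2 * D) * g0 <= #|B0|%:R.
Hypothesis g0_A0 : 4 ^+ D * g0 <= A0%:R.
Hypothesis w_pos : 0 < n%:R - 2 * pb - #|LB|%:R.
Hypothesis g_pos : 2 * D%:R * pb < g0.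
Hypothesis u_up : (1 + x) ^+ (2 * D) <= 1 + u.
Hypothesis u_low : 1 - u <= (1 - x) ^+ D.
Hypothesis energy :
  3 * u * m * (m * m) + 2 * m * (4 * (m * (D * D)%:R + 3 * (m * m) * y))
    < (n%:R - 2 * pb - #|LB|%:R) * (d ^+ D * (g0 - 2 * D%:R * pb)) ^+ 2.

Lemma tset_placed s q : tset E B0 s (enum (preds q)) = placed_set E B0 h setT s q.
Proof.
apply/setP=> b; rewrite !inE; congr (_ && _).
apply/allP/forallP => [ha p|ha p].
  by apply/implyP; rewrite inE /= => hp; apply: ha; rewrite mem_enum inE.
by rewrite mem_enum inE => hp; have := ha p; rewrite inE hp.
Qed.

Lemma quarter_le : 1 / 4 <= (1 - x) * d.
Proof.
have : 0 <= (1 / 2 - x) * d by apply: mulr_ge0; move: x_le d_ge; lra.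
by move: d_ge; lra.
Qed.

(** All three sizes are within factors 1 - u and 1 + u of their expected values, so the sum is at
    most (1 + u) - 2 (1 - u) + 1 = 3 u times the expected size of the intersection. *)
Lemma pair_energy s q q' : ~~ bad_pair E B0 x d h s (q, q') ->
  let T q := placed_set E B0 h setT s q in let rho q := d ^+ #|preds q| in
  #|T q :&: T q'|%:R - rho q' * #|T q|%:R - rho q * #|T q'|%:R
    + rho q * rho q' * #|B0|%:R <= 3 * u * m.
Proof.
rewrite /bad_pair /= !negb_or !negbK => /and4P[_ gq gq' gqq'].
rewrite -!tset_placed -tset_cat.
have xD1 : 0 <= 1 - x by move: x_le; lra.
have l1 := gc_ge x_gt0 x_le d_ge gq.
have l2 := gc_ge x_gt0 x_le d_ge gq'.
have l3 := gc_le x_gt0 d_ge gqq'.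
rewrite size_cat -!cardE in l1 l2 l3.
rewrite !exprMn in l1 l2 l3; rewrite [d ^+ (_ + _)]exprD in l3.
pose T1 : R := #|tset E B0 s (enum (preds q))|%:R.
pose T2 : R := #|tset E B0 s (enum (preds q'))|%:R.
pose T3 : R := #|tset E B0 s (enum (preds q) ++ enum (preds q'))|%:R.
have d0 : 0 <= d by move: d_ge; lra.
pose r1 := d ^+ #|preds q|; pose r2 := d ^+ #|preds q'|.
rewrite -/r1 -/r2 -/T1 -/T2 -/T3 in l1 l2 l3 *.
have r1_ge : 0 <= r1 by rewrite exprn_ge0.
have r2_ge : 0 <= r2 by rewrite exprn_ge0.
have r1_le : r1 <= 1 by rewrite exprn_ile1.
have r2_le : r2 <= 1 by rewrite exprn_ile1.
pose B : R := #|B0|%:R; rewrite -/B in l1 l2 l3 *.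
have B_ge0 : 0 <= B by rewrite ler0n.
have B_le : B <= m by rewrite ler_nat max_card.
have low (q0 : I) : 1 - u <= (1 - x) ^+ #|preds q0|.
  apply: le_trans u_low _; apply: ler_wiXn2l => //; move: x_gt0; lra.
have up : (1 + x) ^+ (#|preds q| + #|preds q'|) <= 1 + u.
  apply: le_trans u_up; rewrite ler_weXn2l //; first by move: x_gt0; lra.
  by rewrite mul2n -addnn leq_add // degR.
have u_ge0 : 0 <= u.
  have : 1 <= (1 + x) ^+ (2 * D) by rewrite exprn_ege1 //; move: x_gt0; lra.
  by move: u_up; lra.
have rB1 : 0 <= r1 * B by rewrite mulr_ge0.
have rB2 : 0 <= r2 * B by rewrite mulr_ge0.
have rrB : 0 <= r1 * r2 * B by rewrite !mulr_ge0.
have e1 : (1 - u) * (r1 * B) <= T1.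
  by apply: le_trans l1; rewrite -mulrA ler_wpM2r ?low.
have e2 : (1 - u) * (r2 * B) <= T2.
  by apply: le_trans l2; rewrite -mulrA ler_wpM2r ?low.
have e3 : T3 <= (1 + u) * (r1 * r2 * B).
  by apply: le_trans l3 _; rewrite -[X in X <= _]mulrA ler_wpM2r.
have f1 := ler_wpM2l r2_ge e1; have f2 := ler_wpM2l r1_ge e2.
have f3 : 3 * u * (r1 * r2 * B) <= 3 * u * m.
  rewrite ler_wpM2l ?mulr_ge0 //; apply: le_trans B_le.
  by rewrite -[X in _ <= X]mul1r ler_wpM2r // mulr_ile1.
move: e3 f1 f2 f3; lra.
Qed.

(** Reserved positions have disjoint predecessor sets, so no position p is asked to be adjacent to
    two vertices outside [B0]. *)
Let ql b := qc (index b (enum LB)).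

Lemma ql_index b : b \in LB -> (index b (enum LB) < k)%N.
Proof.
move=> bL; apply: leq_trans LB_small; by rewrite cardE index_mem mem_enum.
Qed.

Lemma qc_disj i j : (i < k)%N -> (j < k)%N -> i != j ->
  [disjoint preds (qc i) & preds (qc j)] /\ qc i != qc j.
Proof.
move=> ltik ltjk; rewrite neq_ltn => /orP[] lt; first by apply: disj_preds; rewrite lt.
have [] := @disj_preds j i _; first by rewrite lt.
by rewrite disjoint_sym eq_sym.
Qed.

Lemma ql_inj : {in LB &, injective ql}.
Proof.
move=> b b' bL b'L eq_q; have ib := ql_index bL; have ib' := ql_index b'L.
have [eq_i|ne] := eqVneq (index b (enum LB)) (index b' (enum LB)); last first.
  by have [_] := qc_disj ib ib' ne; rewrite -/(ql b) eq_q eqxx.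
by rewrite -(nth_index b (s := enum LB) (x := b)) ?mem_enum // eq_i nth_index ?mem_enum.
Qed.

Lemma ql_disj b b' p : b \in LB -> b' \in LB -> h p (ql b) -> h p (ql b') -> b = b'.
Proof.
move=> bL b'L hb hb'; have ib := ql_index bL; have ib' := ql_index b'L.
have [eq_i|ne] := eqVneq (index b (enum LB)) (index b' (enum LB)); last first.
  have [/disjointFr dd _] := qc_disj ib ib' ne.
  have pb1 : p \in preds (ql b) by rewrite inE.
  by have := dd _ pb1; rewrite inE -/(ql b') hb'.
by rewrite -(nth_index b (s := enum LB) (x := b)) ?mem_enum // eq_i nth_index ?mem_enum.
Qed.

Lemma random_perm_exists : exists s : {perm I}, [/\
  forall b, b \in B0 -> (n <= \sum_(i < k) hit E h qc b i s)%N,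
  forall a b, (n <= \sum_(i < k) accept E B0 h a b (pc i) s)%N,
  #|bad_vertices E B0 x d h s|%:R <= 4 * m * y &
  #|bad_pairs E B0 x d h s|%:R <= 4 * (m * (D * D)%:R + 3 * (m * m) * y)].
Proof.
have m0 : 0 < m.
  by apply: le_lt_trans m_large; rewrite mulr_ge0 ?ler0n.
apply: (@good_perm R I E B0 x d h D k n pc qc y z) => //.
- move=> b bB; apply: le_trans (few_hits degR _ _ n rho1_ge0 rho1_le1 (deg_B0 bB)) _.
  + by move=> i j /disj_preds[].
  + by apply: leq_trans sizeK; rewrite leq_mul2l; apply/orP; right; rewrite (leq_trans (leq_pmulr _ D_gt0)).
  + by rewrite ler_wpM2r ?ler0n.
- move=> a b.
  apply: le_trans (few_accepts x_gt0 x_le d_ge reg degL degR K_le (a := a) _ disj_ball sizeK n rho2_ge0 rho2_le1 (deg_b b) Dx) _.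
    by apply: le_trans A0_big _; rewrite ler_nat.
  by rewrite ler_wpM2r ?ler0n.
- move=> l ul sl; have L0 : 0 < m - (2 * D)%:R by rewrite natrM subr_gt0.
  rewrite -(ler_pM2l L0); apply: le_trans (gc_rare x_gt0 x_le d_ge d_le reg ul sl _) _.
    have p4 : 0 < 4 ^+ (2 * D) :> R by rewrite exprn_gt0.
    rewrite -(ler_pM2l p4); apply: le_trans B0_big _.
    rewrite mulrA -exprMn -[X in X <= _]mul1r ler_wpM2r ?ler0n // exprn_ege1 //.
    by have := quarter_le; lra.
  rewrite [X in _ <= X]mulrA ler_wpM2r ?ler0n //; apply: le_trans (_ : (2 * D)%:R * (x * m) <= _).
    by rewrite ler_wpM2r ?ler_nat // mulr_ge0 ?ler0n // ltW.
  by rewrite natrM [X in _ <= X]mulrC.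
- by rewrite -(ltr0n R).
Qed.

Section WithPermutation.

Variable s : {perm I}.
Hypothesis hitE : forall b, b \in B0 -> (n <= \sum_(i < k) hit E h qc b i s)%N.
Hypothesis acceptE : forall a b, (n <= \sum_(i < k) accept E B0 h a b (pc i) s)%N.
Hypothesis few_bad : #|bad_vertices E B0 x d h s|%:R <= 4 * m * y.
Hypothesis few_pairs :
  #|bad_pairs E B0 x d h s|%:R <= 4 * (m * (D * D)%:R + 3 * (m * m) * y).

Let Pbad := \bigcup_(q in bad_vertices E B0 x d h s :|: ql @: LB) preds q.
(** A position that precedes no reserved one gets the arbitrary target p; this is harmless because
    acceptance is available for every pair of vertices. *)
Let tgt p := odflt p [pick b in LB | h p (ql b)].

Lemma card_Pbad : #|Pbad|%:R <= pb.
Proof.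
apply: le_trans pb_big; apply: le_trans (_ : (D * (#|bad_vertices E B0 x d h s| + #|LB|))%:R <= _).
  rewrite ler_nat mulnC; apply: leq_trans (bigcup_card_le (k := D) _) _ => [q _|]; first exact: degR.
  rewrite leq_mul2r; apply/orP; right; apply: leq_trans (leq_card_setU _ _) _.
  by rewrite leq_add2l leq_imset_card.
by rewrite natrM natrD ler_wpM2l ?ler0n // lerD2r.
Qed.

Lemma repaired_perm : exists f : {perm I}, [/\
  forall q, g0 <= #|placed_set E B0 h setT f q|%:R,
  forall b p, b \in LB -> h p (ql b) -> E (f p) b &
  #|[set p | f p != s p]|%:R <= 2 * pb].
Proof.
have cP := card_Pbad.
have [||f [rich tgtP few]] := @repair_exists R I E B0 x d h D k n pc s Pbad tgt A0
   (ltW x_gt0) x_le d_ge reg degL degR disj_ball acceptE deg_a B0_big.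
- by move: n_large cP; lra.
- move=> q; have sub : \bigcup_(q in bad_vertices E B0 x d h s) preds q \subset Pbad.
    apply/subsetP=> p /bigcupP[q' q'b pq']; apply/bigcupP; exists q' => //.
    by rewrite inE q'b.
  (* All predecessors of a bad q lie in [Pbad], so before the repair nothing restricts it; a good
     chain keeps at least a 4^-D share of [B0]. *)
  have [qb|] := boolP (q \in bad_vertices E B0 x d h s).
    have -> : placed_set E B0 h (~: Pbad) s q = B0.
      apply/setP=> b; rewrite !inE; case: (b \in B0) => //=; apply/forallP=> p.
      apply/implyP=> /andP[]; rewrite inE => /negP pP hpq; case: pP.
      by apply: (subsetP sub); apply/bigcupP; exists q => //; rewrite inE.
    by rewrite leq_pmull // expn_gt0.
  rewrite inE negbK => gcq; have := gc_ge x_gt0 x_le d_ge gcq.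
  have p4 : 0 <= 4 ^+ D :> R by rewrite exprn_ge0.
  move=> /(ler_wpM2l p4) le_t; rewrite -(ler_nat R) natrM natrX.
  apply: le_trans (_ : 4 ^+ D * #|tset E B0 s (enum (preds q))|%:R <= _).
    apply: le_trans le_t; rewrite mulrA -[X in X <= _]mul1r ler_wpM2r ?ler0n //.
    have q1 : 1 <= 4 * ((1 - x) * d) by have := quarter_le; lra.
    apply: le_trans (_ : (4 * ((1 - x) * d)) ^+ #|preds q| <= _); first by rewrite exprn_ege1.
    rewrite exprMn -cardE ler_wpM2r ?exprn_ge0 //; first by have := quarter_le; lra.
    by rewrite ler_weXn2l ?degR // ler1n.
  rewrite ler_wpM2l // ler_nat tset_placed; apply/subset_leq_card/subsetP=> b.
  rewrite !inE => /andP[-> /forallP hb] /=; apply/forallP=> p; apply/implyP=> /andP[_ hp].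
  by have := hb p; rewrite inE hp.
exists f; split.
- move=> q; have [le1|le1] := rich q.
    have p4 : 0 < 4 ^+ (2 * D) :> R by rewrite exprn_gt0.
    rewrite -(ler_pM2l p4); apply: le_trans g0_B0 _.
    by rewrite -natrX -natrM ler_nat.
  have p4 : 0 < 4 ^+ D :> R by rewrite exprn_gt0.
  rewrite -(ler_pM2l p4); apply: le_trans g0_A0 _.
  by rewrite -natrX -natrM ler_nat.
- move=> b p bL hp; have pP : p \in Pbad.
    by apply/bigcupP; exists (ql b); rewrite !inE ?hp // imset_f ?orbT.
  have := tgtP p pP; rewrite /tgt; case: pickP => [b' /andP[b'L hp']|/(_ b)] /=.
    by rewrite (ql_disj bL b'L hp hp').
  by rewrite bL hp.
- apply: le_trans (_ : (2 * #|Pbad|)%:R <= _); first by rewrite ler_nat.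
  by rewrite natrM ler_wpM2l.
Qed.

(* The vertices b outside B0 get the preassigned positions ql b; Hall's theorem
   places the rest. If a set S violates Hall's condition, then some b lies in no T q
   with q in S, so the many positions hit by b avoid S; this makes S small and the
   hole W left by all T q with q in S large, so that hole_energy contradicts the
   pairwise estimate pair_energy. *)
Lemma perm_completes : exists f g : {perm I}, forall p q, h p q -> E (f p) (g q).
Proof.
have [f [rich tgtP few]] := repaired_perm.
pose T (f : {perm I}) q := placed_set E B0 h setT f q.
pose Q' := ~: (ql @: LB).
pose Mv := [set p | f p != s p].
have T_sub (f' : {perm I}) q : T f' q \subset B0 by apply/subsetP=> b; rewrite inE => /andP[].
have TP (f' : {perm I}) q b : b \in T f' q -> forall p, h p q -> E (f' p) b.
  by rewrite inE => /andP[_ /forallP hb] p hp; have := hb p; rewrite inE hp.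
have cQ' : #|Q'| = #|B0|.
  have := cardsC (ql @: LB); rewrite (card_in_imset ql_inj) -/Q' => eqI.
  by apply/eqP; rewrite -(eqn_add2l #|LB|) eqI addnC cardsC.
have same_T q : [disjoint preds q & Mv] -> T f q = T s q.
  move=> dq; apply/setP=> b; rewrite !inE; congr (_ && _); apply: eq_forallb => p.
  rewrite inE /=; case hp: (h p q) => //=.
  have pq : p \in preds q by rewrite inE.
  by have := disjointFr dq pq; rewrite inE => /negbFE/eqP->.
have hall (S : {set I}) : S \subset Q' -> (#|S| <= #|\bigcup_(q in S) T f q|)%N.
  move=> sSQ'; rewrite leqNgt; apply/negP=> ltS.
  set NS := \bigcup_(q in S) T f q in ltS.
  pose W := B0 :\: NS.
  have NS_sub : NS \subset B0 by apply/bigcupsP=> q _; apply: T_sub.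
  have cW : #|W| = (#|B0| - #|NS|)%N by rewrite cardsDS.
  have cS : (#|S| <= #|B0|)%N by rewrite -cQ'; apply: subset_leq_card.
  have dTW q : q \in S -> [disjoint T f q & W].
    move=> qS; rewrite -setI_eq0; apply/eqP/setP=> b; rewrite in_set0.
    apply/negbTE/negP=> /setIP[bT /setDP[_ /negP[]]].
    by apply/bigcupP; exists q.
  have [b bW] : exists b, b \in W by apply/card_gt0P; rewrite cW subn_gt0; apply: leq_trans ltS cS.
  have bB : b \in B0 by move: bW; rewrite inE => /andP[].
  have [q0 q0S] : exists q, q \in S by apply/card_gt0P; apply: leq_ltn_trans ltS.
  (* A violating set is larger than the candidate set of any of its members. *)
  have S_big : g0 <= #|S|%:R.
    apply: le_trans (rich q0) _; rewrite ler_nat; apply: leq_trans (ltnW ltS).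
    by apply/subset_leq_card/(bigcup_sup _ q0S).
  pose Hi : {set 'I_k} := [set i : 'I_k | hit E h qc b i s].
  pose Mi : {set 'I_k} := [set i : 'I_k | ~~ [disjoint preds (qc i) & Mv]].
  have qcI_inj : injective (fun i : 'I_k => qc i).
    move=> i j eq_q; apply/eqP; apply: contraT; rewrite -val_eqE => ne.
    by have [_] := qc_disj (ltn_ord i) (ltn_ord j) ne; rewrite eq_q eqxx.
  have cHi : (n <= #|Hi|)%N.
    apply: leq_trans (hitE bB) _; rewrite -sum1_card big_mkcond /=.
    by rewrite [X in (_ <= X)%N]big_mkcond; apply: leq_sum => i _; rewrite inE; case: (hit _ _ _ _ _ _).
  have cMi : (#|Mi| <= #|Mv|)%N.
    pose w (i : 'I_k) := odflt b [pick p' in preds (qc i) :&: Mv].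
    have wP i : i \in Mi -> w i \in preds (qc i) :&: Mv.
      rewrite inE -setI_eq0 => /set0Pn[p' p'B]; rewrite /w.
      by case: pickP => [//|/(_ p')]; rewrite /= p'B.
    have w_inj : {in Mi &, injective w}.
      move=> i j iX jX eq_w; apply/eqP; apply: contraT; rewrite -val_eqE => ne.
      have [/disjointFr dd _] := qc_disj (ltn_ord i) (ltn_ord j) ne.
      have /setIP[wi _] := wP i iX; have /setIP[wj _] := wP j jX; rewrite eq_w in wi.
      by have := dd _ wi; rewrite wj.
    rewrite -(card_in_imset w_inj); apply/subset_leq_card/subsetP=> _ /imsetP[i iX ->].
    by case/setIP: (wP i iX).
  have hit_free i : i \in Hi -> i \notin Mi -> qc i \notin S.
    rewrite !inE negbK => hi /same_T eqT; apply/negP=> qS.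
    have := disjointFl (dTW _ qS) bW; rewrite eqT inE bB /=.
    move/negbT/forallPn=> [p]; rewrite inE negb_imply /= => /andP[hp /negP[]].
    by move/forall_inP: hi; apply; rewrite inE.
  (* A hit position whose predecessors did not move has [b] as a candidate and so avoids [S]. It is
     reserved or lies in [Q' :\: S], which is no larger than [W] because #|S| > #|NS|. *)
  have cW_big : n%:R - 2 * pb - #|LB|%:R <= #|W|%:R.
    have c1 : (#|Hi :\: Mi| <= #|LB| + (#|Q'| - #|S|))%N.
      rewrite -(card_imset _ qcI_inj).
      apply: leq_trans (_ : #|ql @: LB :|: (Q' :\: S)| <= _)%N; last first.
        apply: leq_trans (leq_card_setU _ _) _.
        by rewrite (card_in_imset ql_inj) leq_add2l cardsDS.
      apply/subset_leq_card/subsetP=> v /imsetP[i]; rewrite in_setD => /andP[iM iH] ->.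
      by rewrite in_setU in_setD in_setC (hit_free i iH iM) /=; case: (_ \in _).
    have c2 : (n <= #|Mv| + #|LB| + #|W|)%N.
      apply: leq_trans cHi _; rewrite -(cardsID Mi Hi) -addnA leq_add //.
        by apply: leq_trans cMi; rewrite subset_leq_card ?subsetIr.
      by apply: leq_trans c1 _; rewrite leq_add2l cQ' cW leq_sub2l // ltnW.
    have : (n%:R : R) <= #|Mv|%:R + #|LB|%:R + #|W|%:R by rewrite -!natrD ler_nat.
    by move: few; rewrite -/Mv; lra.
  (* The second-moment estimate concerns [s], so only positions whose predecessors did not move are
     kept; at most #|Mv| * D are lost. *)
  pose S' := [set q in S | [disjoint preds q & Mv]].
  have cS' : g0 - 2 * D%:R * pb <= #|S'|%:R.
    have c1 : (#|S| <= #|S'| + #|Mv| * D)%N.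
      rewrite -(cardsID [set q | [disjoint preds q & Mv]] S) leq_add //.
        by apply/subset_leq_card/subsetP=> q; rewrite !inE.
      apply: leq_trans (bigcup_card_le (k := D) (G := fun p => [set q | h p q]) _) => [|p _]; last exact: degL.
      apply/subset_leq_card/subsetP=> q; rewrite !inE -setI_eq0 => /andP[/set0Pn[p /setIP[pq pM]] _].
      by apply/bigcupP; exists p; rewrite // inE; move: pq; rewrite inE.
    have c2 : (#|S|%:R : R) <= #|S'|%:R + #|Mv|%:R * D%:R by rewrite -natrM -natrD ler_nat.
    have c3 : (#|Mv|%:R : R) * D%:R <= 2 * pb * D%:R by rewrite ler_wpM2r ?ler0n.
    by move: S_big c2 c3; lra.
  have W_sub : W \subset B0 by apply: subsetDl.
  have dTW' q : q \in S' -> [disjoint T s q & W].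
    by rewrite inE => /andP[qS /same_T <-]; apply: dTW.
  have := hole_energy (fun q => d ^+ #|preds q|) W_sub (T_sub s) dTW'.
  set LHS := _ * _; set RHS := \sum_(q in S') _ => le_energy.
  have d0 : 0 <= d by move: d_ge; lra.
  have lowL : (n%:R - 2 * pb - #|LB|%:R) * (d ^+ D * (g0 - 2 * D%:R * pb)) ^+ 2 <= LHS.
    have gp : 0 <= g0 - 2 * D%:R * pb by move: g_pos; lra.
    apply: ler_pM => //; first exact: ltW w_pos.
      by rewrite sqr_ge0.
    rewrite lerXn2r ?nnegrE //; first by rewrite mulr_ge0 ?exprn_ge0.
      by apply: sumr_ge0 => q _; rewrite exprn_ge0.
    apply: le_trans (_ : \sum_(q in S') d ^+ D <= _).
      by rewrite sumr_const -(mulr_natr (d ^+ D)) ler_wpM2l ?exprn_ge0.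
    by apply: ler_sum => q _; apply: ler_wiXn2l => //; apply: degR.
  have u_ge0 : 0 <= u.
    have : 1 <= (1 + x) ^+ (2 * D) by rewrite exprn_ege1 //; move: x_gt0; lra.
    by move: u_up; lra.
  have m0 : 0 <= m by rewrite ler0n.
  have um0 : 0 <= 3 * u * m by rewrite !mulr_ge0.
  have upR : RHS <= 3 * u * m * (m * m) + 2 * m * #|bad_pairs E B0 x d h s|%:R.
    apply: le_trans (_ : \sum_q \sum_q' (3 * u * m + 2 * m * ((q, q') \in bad_pairs E B0 x d h s)%:R) <= _).
      rewrite /RHS big_mkcond /=; apply: ler_sum => q _; case: ifP => _; last first.
        by apply: sumr_ge0 => q' _; rewrite addr_ge0 ?mulr_ge0 ?ler0n.
      rewrite big_mkcond /=; apply: ler_sum => q' _; case: ifP => _; last first.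
        by rewrite addr_ge0 ?mulr_ge0 ?ler0n.
      rewrite inE; case: (boolP (bad_pair _ _ _ _ _ _ _)) => [_|]; last first.
        by rewrite mulr0 addr0; apply: pair_energy.
      (* For a bad pair the trivial bound 2 m is used: each of the two positive terms is at most
         m. *)
      rewrite mulr1 -[X in X <= _]add0r lerD //.
      have r1 : 0 <= d ^+ #|preds q| <= 1 by rewrite exprn_ge0 ?exprn_ile1.
      have r2 : 0 <= d ^+ #|preds q'| <= 1 by rewrite exprn_ge0 ?exprn_ile1.
      case/andP: r1 => r1a r1b; case/andP: r2 => r2a r2b.
      have c1 : (#|T s q :&: T s q'|%:R : R) <= m by rewrite ler_nat max_card.
      have c2 : (#|B0|%:R : R) <= m by rewrite ler_nat max_card.
      have c3 : d ^+ #|preds q| * d ^+ #|preds q'| * #|B0|%:R <= m.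
        apply: le_trans c2; rewrite -[X in _ <= X]mul1r ler_wpM2r ?ler0n // mulr_ile1 //.
      have c4 : 0 <= d ^+ #|preds q'| * #|T s q|%:R by rewrite mulr_ge0 ?ler0n.
      have c5 : 0 <= d ^+ #|preds q| * #|T s q'|%:R by rewrite mulr_ge0 ?ler0n.
      by move: c1 c3 c4 c5; lra.
    rewrite pair_bigA /= big_split /= sumr_const card_prod -[_ *+ _]mulr_natr natrM lerD //.
    rewrite -mulr_sumr ler_wpM2l ?mulr_ge0 // -natr_sum ler_nat -sum1_card [X in (_ <= X)%N]big_mkcond /=.
    by apply: leq_sum => -[q q'] _; case: (_ \in _).
  have mm : 2 * m * #|bad_pairs E B0 x d h s|%:R
     <= 2 * m * (4 * (m * (D * D)%:R + 3 * (m * m) * y)) by rewrite ler_wpM2l ?mulr_ge0.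
  by move: energy lowL le_energy upR mm; lra.
have [b0 _] : exists b : I, b \in I.
  apply/card_gt0P; rewrite -(ltr0n R); apply: le_lt_trans m_large.
  by rewrite mulr_ge0 ?ler0n.
have [g1 g1_inj g1T] := hall_marriage b0 hall.
pose g q := if [pick b in LB | ql b == q] is Some b then b else g1 q.
have g_ql b : b \in LB -> g (ql b) = b.
  move=> bL; rewrite /g; case: pickP => [b' /andP[b'L /eqP eq_b]|/(_ b)].
    exact: ql_inj.
  by rewrite bL eqxx.
have g_Q q : q \in Q' -> g q = g1 q.
  move=> qQ; rewrite /g; case: pickP => // b' /andP[b'L /eqP eq_b].
  by move: qQ; rewrite inE -eq_b imset_f.
have qP q : (exists2 b, b \in LB & q = ql b) \/ q \in Q'.
  case: (boolP (q \in Q')) => [|]; [by right|rewrite inE negbK].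
  by case/imsetP=> b bL ->; left; exists b.
have g1B q : q \in Q' -> g1 q \in B0 by move=> /g1T; apply: (subsetP (T_sub f q)).
have g_inj : injective g.
  move=> q q'; have [[b bL ->]|qQ] := qP q; have [[b' b'L ->]|q'Q] := qP q'.
  - by rewrite !g_ql // => ->.
  - rewrite g_ql // g_Q // => eqb; move: bL; by rewrite eqb inE g1B.
  - rewrite g_ql // g_Q // => eqb; move: b'L; by rewrite -eqb inE g1B.
  - by rewrite !g_Q //; apply: g1_inj.
exists f, (perm g_inj) => p q hpq; rewrite permE.
have [[b bL eq_q]|qQ] := qP q.
  by rewrite eq_q g_ql //; apply: tgtP => //; rewrite -eq_q.
by rewrite g_Q //; apply: TP hpq; apply: g1T.
Qed.

End WithPermutation.

Lemma spanning_embedding : exists f g : {perm I}, forall p q, h p q -> E (f p) (g q).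
Proof.
by have [s [h1 h2 h3 h4]] := random_perm_exists; apply: (perm_completes h1 h2 h3 h4).
Qed.

End Spanning.

(** * Well-separated positions *)

Lemma greedy_independent (I : finType) (conf : I -> {set I}) c k : 0 < #|I| ->
  0 < c -> (forall p, #|conf p| <= c) -> k * c <= #|I| ->
  exists pc : nat -> I, forall i j, i < j < k -> pc j \notin conf (pc i).
Proof.
move=> I_gt0 c_gt0 conf_le; elim: k => [_|k IHk leI].
  by case/card_gt0P: I_gt0 => p _; exists (fun=> p) => i j; rewrite ltn0 andbF.
have [|pc pcP] := IHk; first by apply: leq_trans leI; rewrite leq_mul2r leqnSn orbT.
have [v vN] : exists v, v \notin \bigcup_(i < k) conf (pc i).
  have: 0 < #|~: \bigcup_(i < k) conf (pc i)|.
    rewrite -(ltn_add2l #|\bigcup_(i < k) conf (pc i)|) cardsC addn0.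
    apply: leq_trans leI; rewrite mulSn.
    apply: leq_ltn_trans (_ : k * c < _); last by rewrite -[X in X < _]add0n ltn_add2r.
    apply: leq_trans (card_bigcup_sum _ _) _.
    by rewrite -[X in X * _](card_ord k) -sum_nat_const leq_sum.
  by case/card_gt0P=> v; rewrite inE; exists v.
exists (fun i => if i == k then v else pc i) => i j /andP[ltij ltjk].
have ltik : i < k by apply: leq_trans ltij _; rewrite -ltnS.
rewrite (ltn_eqF ltik); case: eqP => [_|/eqP ne].
  by apply: contra vN => vi; apply/bigcupP; exists (Ordinal ltik).
by apply: pcP; rewrite ltij ltn_neqAle ne -ltnS.
Qed.

Lemma ball_sym (I : finType) (h : rel I) p p' : (p' \in ball h p) = (p \in ball h p').
Proof.
rewrite !inE eq_sym; congr (_ || _); apply: eq_existsb => q.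
by rewrite andbC.
Qed.

Lemma exists_disjoint_balls (I : finType) (h : rel I) D k : 0 < #|I| ->
  (forall p, #|[set q | h p q]| <= D) -> (forall q, #|preds h q| <= D) ->
  k * ((D * D).+1 * (D * D).+1) <= #|I| ->
  exists pc : nat -> I, forall i j, i < j < k -> [disjoint ball h (pc i) & ball h (pc j)].
Proof.
move=> I_gt0 degL degR lek.
(* Two balls meet only if the centre of one lies in the ball around some point of the other. *)
have [|p|pc pcP] := @greedy_independent I (fun p => \bigcup_(v in ball h p) ball h v) _ k I_gt0 _ _ lek.
- by rewrite muln_gt0.
- apply: leq_trans (bigcup_card_le (k := (D * D).+1) _) _ => [v _|].
    exact: (card_ball degL degR).
  by rewrite leq_mul2r (card_ball degL degR) orbT.
exists pc => i j /pcP; apply: contraR; rewrite -setI_eq0 => /set0Pn[v /setIP[vi vj]].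
by apply/bigcupP; exists v; rewrite // ball_sym.
Qed.

Lemma exists_disjoint_preds (I : finType) (h : rel I) D k : 0 < #|I| ->
  (forall p, #|[set q | h p q]| <= D) -> (forall q, #|preds h q| <= D) ->
  k * (D * D).+1 <= #|I| ->
  exists qc : nat -> I, forall i j, i < j < k ->
    [disjoint preds h (qc i) & preds h (qc j)] /\ qc i != qc j.
Proof.
move=> I_gt0 degL degR lek.
have [||qc qcP] := @greedy_independent I (fun q => q |: \bigcup_(p in preds h q) [set q' | h p q']) (D * D).+1 k I_gt0 _ _ lek.
- by [].
- move=> q; apply: leq_trans (leq_card_setU _ _) _; rewrite cards1 add1n ltnS.
  apply: leq_trans (bigcup_card_le (k := D) _) _ => [v _|]; first exact: degL.
  by rewrite leq_mul2r degR orbT.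
exists qc => i j /qcP; rewrite in_setU1 negb_or eq_sym => /andP[-> nj]; split=> //.
apply: contraR nj; rewrite -setI_eq0 => /set0Pn[v /setIP[vi vj]].
by apply/bigcupP; exists v; rewrite // inE; move: vj; rewrite inE.
Qed.

(** * Elementary exponential estimates *)

Section ExponentialBounds.

Import Order.TTheory GRing.Theory Num.Theory.
Local Open Scope ring_scope.

Variable R : realFieldType.

Lemma bernoulli (t : R) n : 0 <= t -> 1 + n%:R * t <= (1 + t) ^+ n.
Proof.
move=> t0; elim: n => [|n IHn]; first by rewrite mul0r addr0 expr0.
have t1 : 0 <= 1 + t by lra.
rewrite exprS -natr1; have := ler_wpM2l t1 IHn.
have : 0 <= n%:R * t * t by rewrite !mulr_ge0 ?ler0n.
lra.
Qed.

(** For Q >= 2 the inverse of 1 - 1/Q is 1 + 1/(Q - 1), whose Q-th power is at least 2 by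
    Bernoulli's inequality. *)
Lemma exp_inv_nat (Q : nat) : (0 < Q)%N -> (1 - Q%:R^-1) ^+ Q <= 1 / 2 :> R.
Proof.
case: Q => // -[_|Q _]; first by rewrite invr1 subrr expr1; lra.
have Q0 : 0 < (Q.+1%:R : R) by rewrite ltr0n.
have Q1 : 0 < (Q.+2%:R : R) by rewrite ltr0n.
have -> : 1 - (Q.+2%:R)^-1 = (1 + (Q.+1%:R)^-1)^-1 :> R.
  have -> : Q.+2%:R = Q.+1%:R + 1 :> R by rewrite -natr1.
  by field; have Q2 := ler0n R Q; rewrite !gt_eqF //; lra.
have i0 : 0 <= (Q.+1%:R : R)^-1 by rewrite invr_ge0 ltW.
have h1 := bernoulli Q.+2 i0; rewrite [X in X <= _]exprVn.
have h2 : 2 <= (1 + (Q.+1%:R)^-1) ^+ Q.+2 :> R.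
  apply: le_trans h1; rewrite -natr1 mulrDl mul1r mulfV ?gt_eqF //.
  by move: (_^-1) i0 => t t0; lra.
have -> : 1 / 2 = 2^-1 :> R by lra.
rewrite lef_pV2 // posrE //; apply: lt_le_trans h2; lra.
Qed.

Lemma exp_decay (Q k n : nat) (r : R) : (0 < Q)%N -> Q%:R^-1 <= r -> r <= 1 ->
  (2 * n <= k %/ Q)%N -> 2 ^+ n * (1 - r) ^+ k <= 2^-1 ^+ n.
Proof.
move=> Q_gt0 ler r1 len.
have iQ : 0 < (Q%:R : R)^-1 by rewrite invr_gt0 ltr0n.
have iQ1 : (Q%:R : R)^-1 <= 1 by rewrite invf_le1 ?ltr0n // ler1n.
have h1 : (1 - r) ^+ k <= (1 - Q%:R^-1) ^+ k.
  by apply: lerXn2r; rewrite ?nnegrE; lra.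
have h2 : (1 - Q%:R^-1) ^+ k <= 2^-1 ^+ (2 * n) :> R.
  apply: le_trans (_ : (1 - Q%:R^-1) ^+ (Q * (2 * n)) <= _).
    apply: ler_wiXn2l; try lra.
    by rewrite mulnC; apply: leq_trans (leq_divM k Q); rewrite leq_mul2r len orbT.
  rewrite exprM; apply: lerXn2r; rewrite ?nnegrE; try lra.
    by apply: exprn_ge0; lra.
  by have := exp_inv_nat Q_gt0; lra.
apply: le_trans (ler_wpM2l (exprn_ge0 n (ler0n R 2)) (le_trans h1 h2)) _.
by rewrite mul2n -addnn exprD mulrA -exprMn divff ?pnatr_eq0 // expr1n mul1r.
Qed.

Lemma exp_upper (x : R) n : 0 <= x -> 2 * n%:R * x <= 1 ->
  (1 + x) ^+ n <= 1 + 2 * n%:R * x /\ 1 - n%:R * x <= (1 - x) ^+ n.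
Proof.
move=> x0; elim: n => [|n IHn] nx.
  by rewrite !expr0 mulr0 !mul0r; split; lra.
rewrite -natr1 in nx *.
have n0 : 0 <= n%:R * x by rewrite mulr_ge0 ?ler0n.
have [|h1 h2] := IHn; first by lra.
have x1 : 0 <= 1 + x by lra.
have x2 : 0 <= 1 - x by lra.
have g1 := ler_wpM2l x1 h1; have g2 := ler_wpM2l x2 h2.
have e1 : 2 * (n%:R * x) * x <= 1 * x by rewrite ler_wpM2r //; lra.
have e2 : 0 <= n%:R * x * x by rewrite mulr_ge0.
rewrite !exprS; split; lra.
Qed.

End ExponentialBounds.

Lemma expn2_cube n : 16 <= n -> 8 * n ^ 3 <= 2 ^ n.
Proof.
elim: n => // n IHn; rewrite leq_eqVlt => /orP[/eqP<- //|ltn16].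
have {}IHn := IHn ltn16; rewrite [2 ^ _]expnS.
apply: leq_trans (_ : 2 * (8 * n ^ 3) <= _); last by rewrite leq_mul2l.
have -> : 2 * (8 * n ^ 3) = 8 * (2 * n ^ 3) by ring.
rewrite leq_mul2l /=.
have n16 : 16 <= n by [].
rewrite !expnS !expn0 !muln1; nia.
Qed.

Lemma mul2_leq_expn2 D : 2 * D <= 2 ^ D.
Proof.
case: D => // D; elim: D => // D IHD; rewrite [2 ^ _]expnS mulnS.
by apply: leq_trans (leq_mul (leqnn 2) IHD); lia.
Qed.

Lemma leq_double_div Q m : 0 < Q -> Q <= m -> m <= 2 * Q * (m %/ Q).
Proof.
move=> Q_gt0 leQ; have := ltn_pmod m Q_gt0; have := divn_eq m Q.
have : 0 < m %/ Q by rewrite divn_gt0.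
set a := m %/ Q; set b := m %% Q; nia.
Qed.

(** * Parameters as powers of 2^-D *)

Section SpanningRegular.

Import Order.TTheory GRing.Theory Num.Theory.
Local Open Scope ring_scope.

Variables (R : realFieldType) (D : nat).
Hypothesis D_gt0 : (0 < D)%N.
Let q : R := 2^-1 ^+ D.

Lemma q_gt0 : 0 < q.
Proof. by rewrite exprn_gt0 // invr_gt0. Qed.

Lemma qX_gt0 i : 0 < q ^+ i.
Proof. by rewrite exprn_gt0 // q_gt0. Qed.

Lemma qX_ge0 i : 0 <= q ^+ i.
Proof. exact: ltW (qX_gt0 i). Qed.

Lemma qS i : 2 * q ^+ i.+1 <= q ^+ i.
Proof.
rewrite exprS mulrA -[X in _ <= X]mul1r ler_wpM2r ?qX_ge0 //.
rewrite -[X in _ <= X](divff (x := 2)) ?pnatr_eq0 // ler_wpM2l ?ler0n // /q.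
by rewrite -(prednK D_gt0) exprS -[X in _ <= X]mulr1 ler_wpM2l ?invr_ge0 // exprn_ile1 ?invr_ge0 // invf_le1 // ler1n.
Qed.

Lemma expn_q a : (2 ^ (a * D))%:R * q ^+ a = 1.
Proof.
by rewrite /q -exprM mulnC natrX -exprMn divff ?pnatr_eq0 // expr1n.
Qed.

(** One power of [q] pays for a factor 2 D, so comparing constants amounts to comparing
    exponents. *)
Lemma DqS i : 2 * (D%:R * q ^+ i.+1) <= q ^+ i.
Proof.
have h1 := expn_q 1; rewrite mul1n expr1 in h1.
have h2 : 2 * (D%:R * q) <= 1.
  by rewrite -[X in _ <= X]h1 mulrA -natrM ler_wpM2r ?ler_nat ?mul2_leq_expn2 // ltW // q_gt0.
rewrite exprS mulrA mulrA -[X in _ <= X]mul1r ler_wpM2r ?qX_ge0 //.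
by rewrite -mulrA.
Qed.

Lemma nat_le_q a (s t : nat) : (2 ^ (a * D) * s <= t)%N -> s%:R <= q ^+ a * t%:R.
Proof.
rewrite -(ler_nat R) natrM => le_st.
have := ler_wpM2l (qX_ge0 a) le_st.
by rewrite [X in X <= _]mulrA [q ^+ a * (2 ^ _)%:R]mulrC expn_q mul1r.
Qed.

Lemma q_le_nat a (s t : nat) : (t <= 2 ^ (a * D) * s)%N -> q ^+ a * t%:R <= s%:R.
Proof.
rewrite -(ler_nat R) natrM => le_st.
have := ler_wpM2l (qX_ge0 a) le_st.
by rewrite [X in _ <= X]mulrA [q ^+ a * (2 ^ _)%:R]mulrC expn_q mul1r.
Qed.

Lemma four_expn a : 4 ^+ a = (2 ^ (2 * a))%:R :> R.
Proof. by rewrite natrX exprM (_ : 4 = 2 ^+ 2 :> R) //; ring. Qed.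

Lemma fourX_q (t : R) i : 4 ^+ D * (q ^+ i.+2 * t) = q ^+ i * t.
Proof.
by rewrite four_expn -(add2n i) exprD mulrA mulrA expn_q mul1r.
Qed.

Lemma fourX2_q (t : R) i : 4 ^+ (2 * D) * (q ^+ i.+4 * t) = q ^+ i * t.
Proof.
by rewrite four_expn mulnA -(add4n i) exprD mulrA mulrA (expn_q 4) mul1r.
Qed.

Variables (I : finType) (E : rel I) (B0 : {set I}) (d : R) (h : rel I).

Let m : R := #|I|%:R.

Hypothesis degL : forall p, (#|[set q | h p q]| <= D)%N.
Hypothesis degR : forall q, (#|preds h q| <= D)%N.
Hypothesis d_ge : 1 / 2 <= d.
Hypothesis d_le : d <= 1.
Hypothesis reg : regular E B0 (q ^+ 50) d.
Hypothesis I_large : (2 ^ (64 * D) <= #|I|)%N.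
Hypothesis LB_small : (2 ^ (50 * D) * #|~: B0| <= #|I|)%N.
Hypothesis deg_a : forall a, (#|I| <= 2 ^ (5 * D) * #|nb E a :&: B0|)%N.
Hypothesis deg_b : forall b, (#|I| <= 2 ^ (4 * D) * #|coll E b|)%N.
Hypothesis deg_B0 : forall b, b \in B0 -> (#|I| <= 8 * #|coll E b|)%N.

Lemma spanning_regular : exists f g : {perm I}, forall p q, h p q -> E (f p) (g q).
Proof.
have p2 a : (0 < 2 ^ a)%N by rewrite expn_gt0.
have I_gt0 : (0 < #|I|)%N by apply: leq_trans I_large.
have m_gt0 : 0 < m by rewrite ltr0n.
have qm_gt0 i : 0 < q ^+ i * m by rewrite mulr_gt0 // qX_gt0.
have qSm i : 2 * (q ^+ i.+1 * m) <= q ^+ i * m.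
  by rewrite mulrA ler_wpM2r ?qS // ltW.
have DqSm i : 2 * (D%:R * (q ^+ i.+1 * m)) <= q ^+ i * m.
  by rewrite !mulrA ler_wpM2r ?(ltW m_gt0) // -mulrA DqS.
have D0 : 0 <= D%:R :> R by rewrite ler0n.
have q0m : q ^+ 0 * m = m by rewrite expr0 mul1r.
(* Each of the k trials succeeds often enough that its factor is at most 1 - 1/Q = 1 - q^7: for hits
   q^4 / 2 is available, for acceptances about q^5 / 4. With 2 n <= k / Q the failure probability
   drops to 2^-n. *)
pose Q := (2 ^ (7 * D))%N.
pose k := (#|I| %/ Q)%N.
pose n := ((k %/ Q) %/ 2)%N.
pose K := (k * (D * D).+1)%N.
pose A0 := (#|I| %/ 2 ^ (5 * D))%N.
have le_large a : (a <= 64)%N -> (2 ^ (a * D) <= #|I|)%N.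
  by move=> lea; apply: leq_trans I_large; rewrite leq_exp2l // leq_mul2r lea orbT.
have two_pow a : (2 * 2 ^ (a * D) <= 2 ^ (a.+1 * D))%N.
  by rewrite -expnS leq_exp2l // mulSn -add1n leq_add2r.
have k_up : k%:R <= q ^+ 7 * m by apply: nat_le_q; rewrite mulnC leq_divM.
have k_low : q ^+ 8 * m <= k%:R.
  apply: q_le_nat; apply: leq_trans (leq_double_div (p2 _) (le_large 7 isT)) _.
  by rewrite leq_mul2r two_pow orbT.
have A0_low : q ^+ 6 * m <= A0%:R.
  apply: q_le_nat; apply: leq_trans (leq_double_div (p2 _) (le_large 5 isT)) _.
  by rewrite leq_mul2r two_pow orbT.
have n_nat : (#|I| <= 2 ^ (16 * D) * n)%N.
  have eq_n : n = (#|I| %/ (2 ^ (14 * D) * 2))%N.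
    by rewrite /n /k /Q (_ : 14 = 7 + 7)%N // mulnDl expnD !divnMA.
  have le15 : (2 ^ (14 * D) * 2 <= 2 ^ (15 * D))%N by rewrite mulnC two_pow.
  rewrite eq_n; apply: leq_trans (@leq_double_div (2 ^ (14 * D) * 2)%N _ _ _) _; first by rewrite muln_gt0 p2.
    by apply: leq_trans le15 (le_large _ _).
  by rewrite leq_mul2r; apply/orP; right; apply: leq_trans (two_pow 15); rewrite leq_mul2l.
have n_low : q ^+ 16 * m <= n%:R by apply: q_le_nat.
have n_k : (2 * n <= k %/ Q)%N by rewrite mulnC leq_divM.
have n_large : (2 ^ (48 * D) <= n)%N.
  have := leq_trans I_large n_nat.
  by rewrite (_ : 64 = 16 + 48)%N // mulnDl expnD leq_pmul2l.
have mm_n : (8 * (#|I| * #|I|) <= 2 ^ n)%N.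
  apply: leq_trans (expn2_cube _).
    rewrite leq_mul2l /=; apply: leq_trans (leq_mul n_nat n_nat) _.
    rewrite mulnACA -expnD -mulnDl.
    have h32 : (2 ^ ((16 + 16) * D) <= n)%N.
      by apply: leq_trans n_large; rewrite leq_exp2l // leq_mul2r orbT.
    apply: leq_trans (leq_mul h32 (leqnn (n * n)%N)) _.
    by rewrite !expnS expn0 muln1.
  apply: leq_trans n_large; rewrite (_ : 16 = 2 ^ 4)%N // leq_exp2l //.
  by apply: leq_trans (_ : 48 * 1 <= _)%N => //; rewrite leq_mul2l D_gt0.
have K_up : K%:R <= q ^+ 5 * m.
  rewrite /K natrM.
  have h1 : (D * D).+1%:R * q ^+ 7 <= q ^+ 5.
    rewrite -natr1 natrM; have e1 := DqS 6; have e2 := DqS 5; have e3 := qS 5; have e4 := qS 6.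
    have := ler_wpM2l D0 e1; have := qX_ge0 5; lra.
  apply: le_trans (ler_wpM2r (ler0n R _) k_up) _.
  by rewrite mulrAC ler_wpM2r ?(ltW m_gt0) // mulrC.
have [pc pcP] : exists pc : nat -> I, forall i j, (i < j < k)%N -> [disjoint ball h (pc i) & ball h (pc j)].
  apply: (exists_disjoint_balls I_gt0 degL degR).
  rewrite -(ler_nat R) mulnA natrM -/K -/m.
  have h1 : (D * D).+1%:R * q ^+ 5 <= q ^+ 3.
    rewrite -natr1 natrM; have e1 := DqS 4; have e2 := DqS 3; have e3 := qS 3; have e4 := qS 4.
    have := ler_wpM2l D0 e1; have := qX_ge0 3; lra.
  apply: le_trans (ler_wpM2r (ler0n R _) K_up) _.
  rewrite mulrAC; apply: le_trans (_ : q ^+ 3 * m <= _).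
    by rewrite ler_wpM2r ?(ltW m_gt0) // mulrC.
  by have := qSm 0; have := qSm 1; have := qSm 2; have := qm_gt0 3; rewrite q0m; lra.
have K2 : (2 * K <= #|I|)%N.
  rewrite -(ler_nat R) natrM -/m.
  have := qSm 0; have := qSm 1; have := qSm 2; have := qSm 3; have := qSm 4.
  by have := qm_gt0 5; move: K_up; rewrite q0m; lra.
have [qc qcP] : exists qc : nat -> I, forall i j, (i < j < k)%N ->
    [disjoint preds h (qc i) & preds h (qc j)] /\ qc i != qc j.
  by apply: (exists_disjoint_preds I_gt0 degL degR); apply: leq_trans K2; rewrite leq_pmull.
have LB_q : #|~: B0|%:R <= q ^+ 50 * m by apply: nat_le_q.
have qle i j : (i <= j)%N -> q ^+ j <= q ^+ i.
  move=> leij; apply: ler_wiXn2l => //; first exact: ltW q_gt0.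
  by have := qS 0; have := qX_gt0 1; rewrite expr0 expr1; lra.
have chain i : 8 * (q ^+ (3 + i) * m) <= q ^+ i * m.
  by have := qSm i; have := qSm i.+1; have := qSm i.+2; rewrite !add3n; lra.
have small i : q ^+ i.+1 <= 1 / 2.
  by have := qS i; have := qle 0 i isT; rewrite expr0; lra.
have Dq1 i : D%:R * q ^+ i.+1 <= 1 / 2.
  by have := DqS i; have := qle 0 i isT; rewrite expr0; lra.
have x_gt0 : 0 < q ^+ 50 by apply: qX_gt0.
have DDx : 2 * (D * D)%:R * (2 * D%:R * q ^+ 50) <= 1.
  rewrite natrM; have e1 := DqS 49; have e2 := DqS 48; have e3 := DqS 47.
  have f1 := ler_wpM2l D0 e1; have f2 := ler_wpM2l D0 f1; have f3 := ler_wpM2l D0 e2.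
  by have := qS 46; have := small 45; lra.
have [u1 u2] : (1 + q ^+ 50) ^+ (2 * D) <= 1 + q ^+ 48 /\ 1 - q ^+ 48 <= (1 - q ^+ 50) ^+ D.
  have e1 := DqS 49; have e2 := qS 48; have e3 := small 48; have e4 := qX_gt0 48.
  have [||h1 _] := @exp_upper R (q ^+ 50) (2 * D)%N; rewrite ?natrM; [exact: ltW|lra|].
  have [||_ h2] := @exp_upper R (q ^+ 50) D; [exact: ltW|by have := small 48; lra|].
  by rewrite natrM in h1; split; [apply: le_trans h1 _|apply: le_trans h2]; lra.
have th_low : 1 / 2 <= (1 - 2 * D%:R * q ^+ 50) ^+ (D * D).
  have [||_ h2] := @exp_upper R (2 * D%:R * q ^+ 50) (D * D)%N.
  - by apply: mulr_ge0 (qX_ge0 _); apply: mulr_ge0.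
  - exact: DDx.
  - by apply: le_trans h2; move: DDx; lra.
have th_up : (1 - 2 * D%:R * q ^+ 50) ^+ (D * D) <= 1.
  have := Dq1 49; have : 0 <= D%:R * q ^+ 50 by apply: mulr_ge0 (qX_ge0 _).
  by move=> *; apply: exprn_ile1; lra.
have Q0 : (0 < Q)%N by apply: p2.
have iQ : (Q%:R)^-1 = q ^+ 7.
  have Qn : (Q%:R : R) != 0 by rewrite pnatr_eq0 -lt0n.
  by apply: (mulfI Qn); rewrite mulfV // /Q expn_q.
have q16 : (1 / 16) ^+ D = q ^+ 4.
  rewrite /q -exprM mulnC exprM (_ : 1 / 16 = 2^-1 ^+ 4 :> R) //; by field.
have m64 : (2 ^ (64 * D))%:R <= m by rewrite ler_nat.
have Dm : 4 * D%:R <= m.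
  apply: le_trans m64; rewrite -natrM ler_nat.
  apply: leq_trans (_ : 2 * 2 ^ (1 * D) <= _)%N.
    have e4 : (4 * D = 2 * (2 * D))%N by rewrite mulnA.
    by rewrite mul1n e4 leq_mul2l mul2_leq_expn2.
  by apply: leq_trans (two_pow 1) _; rewrite leq_exp2l // leq_mul2r orbT.
have DDm : D%:R * D%:R <= q ^+ 60 * m.
  have h1 : D%:R * D%:R * q ^+ 4 <= 1.
    have e1 := DqS 3; have e2 := DqS 2; have f1 := ler_wpM2l D0 e1.
    by have := small 1; lra.
  have h2 : 1 <= q ^+ 64 * m.
    by rewrite -[X in X <= _](expn_q 64) mulrC; apply: ler_wpM2l; rewrite ?qX_ge0.
  have q4 := qX_gt0 4; rewrite -(ler_pM2r q4); apply: le_trans h1 _; apply: le_trans h2 _.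
  by rewrite [X in _ <= X]mulrAC -exprD lexx.
have dD : q <= d ^+ D.
  by rewrite /q; apply: lerXn2r; rewrite ?nnegrE //; move: d_ge; lra.
have d0 : 0 <= d by move: d_ge; lra.
pose pb := q ^+ 44 * m.
have pb_ge : D%:R * (4 * m * q ^+ 48 + #|~: B0|%:R) <= pb.
  have e1 := DqSm 47; have e2 := DqSm 49; have f1 := ler_wpM2l D0 LB_q.
  have e3 := chain 44; have e4 := qSm 47; have e5 := qSm 48; have e6 := qm_gt0 49.
  by rewrite /pb; lra.
have pb_q : D%:R * pb <= q ^+ 43 * m by have := DqSm 43; have := qm_gt0 43; rewrite /pb; lra.
have Dxm : D%:R * (q ^+ 50 * m) <= q ^+ 49 * m.
  by have := DqSm 49; have := qm_gt0 49; lra.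
have wq : q ^+ 17 * m <= n%:R - 2 * pb - #|~: B0|%:R.
  have e1 := qSm 16; have e2 : q ^+ 44 * m <= q ^+ 20 * m by rewrite ler_wpM2r ?qle // ltW.
  have e3 : q ^+ 50 * m <= q ^+ 20 * m by rewrite ler_wpM2r ?qle // ltW.
  have e4 := chain 17; have e5 := qm_gt0 20.
  by move: n_low LB_q; rewrite /pb; lra.
have gq : q ^+ 9 * m <= q ^+ 8 * m - 2 * D%:R * pb.
  have e1 := qSm 8; have e2 : q ^+ 43 * m <= q ^+ 12 * m by rewrite ler_wpM2r ?qle // ltW.
  have e3 := chain 9; have e4 := qm_gt0 12.
  by move: pb_q; lra.
have half_m i : 2 * (q ^+ i.+1 * m) <= m.
  by apply: le_trans (qSm i) _; rewrite -[X in _ <= X]mul1r ler_wpM2r ?(ltW m_gt0) // (qle 0 i).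
have B0_half : m / 2 <= #|B0|%:R.
  have : m = #|B0|%:R + #|~: B0|%:R by rewrite -natrD cardsC.
  by have := half_m 49; move: LB_q; lra.
(* For x = q^50, the value q^48 of u and y covers products and union bounds of length 2 D. The
   values 1/16 and q^5 for rho1 and rho2 are what remains of the degrees m / 8 and q^4 m after
   subtracting K <= q^5 m. *)
have H := @spanning_embedding R I E B0 (q ^+ 50) d h D K k n A0 pc qc (q ^+ 48)
   (2^-1 ^+ n) (q ^+ 48) (1 / 16) (q ^+ 5) (q ^+ 8 * m) pb.
apply: H => //; rewrite -?/m.
- by move=> a; apply: leq_trans (leq_div2r _ (deg_a a)) _; rewrite mulKn.
- apply: le_trans A0_low; rewrite (fourX_q _ 48); apply: ler_wpM2r; [exact: ltW|exact: qle].
- by lra.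
- by lra.
- exact: qX_ge0.
- by have := small 4; lra.
- move=> b bB; have : m <= 8 * #|coll E b|%:R by rewrite -natrM ler_nat deg_B0.
  by have := half_m 0; have := chain 2; have := qSm 1; have := qSm 0; move: K_up; rewrite q0m; lra.
- move=> b; have : q ^+ 4 * m <= #|coll E b|%:R by apply: q_le_nat.
  by have := qSm 4; move: K_up; lra.
- by have := Dq1 49; lra.
- apply: exp_decay n_k => //; rewrite ?iQ ?q16.
    by have := qle 5 7 isT; have := qS 4; lra.
  by have := small 3; lra.
- apply: exp_decay n_k => //; rewrite ?iQ.
    have := ler_wpM2l (qX_ge0 5) th_low; have := qS 5; have := qS 6; lra.
  by have := ler_wpM2l (qX_ge0 5) th_up; have := small 4; lra.
- by rewrite exprn_ge0 // invr_ge0.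
- rewrite -mulrA mulrCA.
  apply: le_trans (_ : 2^-1 ^+ n * (2 ^ n)%:R <= _).
    by rewrite ler_wpM2l ?exprn_ge0 ?invr_ge0 // -!natrM ler_nat.
  by rewrite natrX -exprMn mulVf ?pnatr_eq0 // expr1n.
- exact: qX_gt0.
- by have : 0 < D%:R :> R; [rewrite ltr0n|move: Dm; lra].
- have e1 := DqS 49; have e2 := DqS 48; have Dm' : 2 * D%:R <= m / 2 by move: Dm; lra.
  have h1 : q ^+ 48 * (m / 2) <= q ^+ 48 * (m - 2 * D%:R).
    by rewrite ler_wpM2l ?qX_ge0 //; lra.
  apply: le_trans h1; have := DqSm 49; have := qSm 48; lra.
- by rewrite (fourX2_q _ 46); apply: le_trans B0_half; have := half_m 45; lra.
- have e1 : q ^+ 49 * m <= q ^+ 18 * m by rewrite ler_wpM2r ?qle // ltW.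
  have e2 := qSm 17; have e3 := qm_gt0 17; have e4 := ler0n R #|~: B0|.
  by move: wq Dxm e1 e2 e3 e4; lra.
- rewrite -(ler_nat R); apply: le_trans LB_q _; apply: le_trans k_low.
  by rewrite ler_wpM2r ?qle // ltW.
- by rewrite (fourX2_q _ 4); apply: le_trans B0_half; have := half_m 3; lra.
- by rewrite (fourX_q _ 6).
- by apply: lt_le_trans wq; apply: qm_gt0.
- by have := qm_gt0 9; move: gq; lra.
(* The right side has order q^17 (q q^9)^2 = q^37 times m^3. On the left stand terms of order q^48
   m^3 and D^2 m^2, and D^2 <= q^60 m. *)
- rewrite natrM.
  have gpos : 0 <= q ^+ 9 * m by rewrite ltW.
  have h1 : q * (q ^+ 9 * m) <= d ^+ D * (q ^+ 8 * m - 2 * D%:R * pb).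
    by apply: ler_pM => //; apply: ltW q_gt0.
  have h2 : (q * (q ^+ 9 * m)) ^+ 2 <= (d ^+ D * (q ^+ 8 * m - 2 * D%:R * pb)) ^+ 2.
    apply: lerXn2r => //; rewrite nnegrE; apply: mulr_ge0 => //.
    - exact: ltW q_gt0.
    - exact: exprn_ge0.
    - exact: le_trans gq.
  have h3 : (q ^+ 17 * m) * (q * (q ^+ 9 * m)) ^+ 2
      <= (n%:R - 2 * pb - #|~: B0|%:R) * (d ^+ D * (q ^+ 8 * m - 2 * D%:R * pb)) ^+ 2.
    by apply: ler_pM => //; rewrite ?sqr_ge0 // ltW.
  apply: lt_le_trans h3.
  have -> : (q ^+ 17 * m) * (q * (q ^+ 9 * m)) ^+ 2 = q ^+ 37 * m * (m * m) by ring.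
  have mm0 : 0 < m * m by rewrite mulr_gt0.
  have -> : 3 * q ^+ 48 * m * (m * m) + 2 * m * (4 * (m * (D%:R * D%:R) + 3 * (m * m) * q ^+ 48))
     = (27 * (q ^+ 48 * m) + 8 * (D%:R * D%:R)) * (m * m) by ring.
  rewrite ltr_pM2r //.
  have e1 := chain 37; have e2 := chain 40; have e3 := qm_gt0 43.
  have e4 : q ^+ 48 * m <= q ^+ 43 * m by rewrite ler_wpM2r ?qle // ltW.
  have e5 : q ^+ 60 * m <= q ^+ 43 * m by rewrite ler_wpM2r ?qle // ltW.
  by move: DDm; lra.
Qed.

End SpanningRegular.

(** * A regular pair by density increment *)

Section DensityIncrement.

Import Order.TTheory GRing.Theory Num.Theory.
Local Open Scope ring_scope.

Variables (R : realFieldType) (T : finType).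

(** Discarding an element of weight at most lam keeps the average at least lam; once there is none,
    any s elements will do. *)
Lemma heavy_subset (w : T -> R) (X : {set T}) (lam : R) s : (s <= #|X|)%N ->
  lam * #|X|%:R <= \sum_(a in X) w a ->
  exists X' : {set T}, [/\ X' \subset X, #|X'| = s & lam * s%:R <= \sum_(a in X') w a].
Proof.
have [n] := ubnP (#|X| - s)%N; elim: n X => // n IHn X ltn leX heavy.
have [eqs|nes] := eqVneq s #|X|; first by exists X; rewrite eqs.
have [/existsP[a /andP[aX wa]]|none] := boolP [exists a in X, w a <= lam].
  have cX : #|X| = #|X :\ a|.+1 by rewrite (cardsD1 a) aX.
  have [|||X' [sX' cX' hX']] := IHn (X :\ a).
  - by move: ltn leX nes; rewrite cX; lia.
  - by move: leX nes; rewrite cX; lia.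
  - move: heavy; rewrite (big_setD1 a) //= cX -natr1; move: wa; lra.
  by exists X'; split=> //; apply: subset_trans sX' (subsetDl _ _).
have [X' sX' cX'] := subset_of_card leX.
exists X'; split=> //; rewrite -cX' mulrC mulr_natl -sumr_const; apply: ler_sum => a aX'.
have := none; rewrite negb_exists => /forallP/(_ a).
by rewrite negb_and (subsetP sX' _ aX') /= -ltNge => /ltW.
Qed.

Variable E : rel T.

Definition edges (X Y : {set T}) : R := \sum_(a in X) #|nb E a :&: Y|%:R.

Lemma edges_sym X Y : edges X Y = \sum_(b in Y) #|coll E b :&: X|%:R.
Proof.
have cE (S S' : {set T}) : #|S :&: S'|%:R = \sum_(b in S') (b \in S)%:R :> R.
  rewrite -natr_sum -sum1_card; congr _%:R; rewrite big_mkcond [RHS]big_mkcond /=.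
  by apply: eq_bigr => b _; rewrite inE; case: (b \in S); case: (b \in S').
rewrite /edges; under eq_bigr do rewrite cE; rewrite exchange_big /=.
by apply: eq_bigr => b _; rewrite cE; apply: eq_bigr => a _; rewrite !inE.
Qed.

Lemma edges_le X Y : edges X Y <= #|X|%:R * #|Y|%:R.
Proof.
rewrite mulr_natl -sumr_const; apply: ler_sum => a _.
by rewrite ler_nat subset_leq_card ?subsetIr.
Qed.

Lemma edgesD1 (X X1 Y : {set T}) : X1 \subset X -> edges X Y = edges X1 Y + edges (X :\: X1) Y.
Proof.
move=> sX; rewrite /edges (big_setID X1) /=; congr (_ + _).
by apply: eq_bigl => a; rewrite (setIidPr sX).
Qed.

Lemma dense_subpair (X Y : {set T}) lam s : (s <= #|X|)%N -> (s <= #|Y|)%N -> 0 <= lam ->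
  lam * #|X|%:R * #|Y|%:R <= edges X Y ->
  exists X' Y' : {set T}, [/\ X' \subset X, Y' \subset Y, #|X'| = s, #|Y'| = s
    & lam * s%:R * s%:R <= edges X' Y'].
Proof.
move=> sX sY lam0 dense.
have [|X' [sX' cX' hX']] := @heavy_subset (fun a => #|nb E a :&: Y|%:R) X (lam * #|Y|%:R) s sX.
  by move: dense; rewrite /edges mulrAC.
have [|Y' [sY' cY' hY']] := @heavy_subset (fun b => #|coll E b :&: X'|%:R) Y (lam * s%:R) s sY.
  by rewrite -edges_sym /edges mulrAC.
by exists X', Y'; split=> //; rewrite edges_sym.
Qed.

Variables (S : nat) (tau : R) (A B : {set T}) (m0 : nat).
Hypothesis S_gt0 : (0 < S)%N.
Hypothesis tau_ge0 : 0 <= tau.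
Hypothesis cardA : #|A| = m0.
Hypothesis cardB : #|B| = m0.
Hypothesis denseAB : 1 / 2 * m0%:R * m0%:R <= edges A B.

Let dens j : R := 1 / 2 * (1 + tau) ^+ j.

Definition upper_regular d (A' B' : {set T}) s : Prop :=
  forall X Y : {set T}, X \subset A' -> Y \subset B' -> (s <= #|X|)%N -> (s <= #|Y|)%N ->
    edges X Y <= (1 + tau) * d * #|X|%:R * #|Y|%:R.

(** The j-th pair has size m0 / S^j and density at least [dens j]. Densities cannot exceed 1, so
    fewer than J increments can succeed. *)
Lemma density_increment J : (S ^ J <= m0)%N -> 1 < dens J ->
  exists (A' B' : {set T}) m' d, [/\ [/\ A' \subset A, B' \subset B, #|A'| = m' & #|B'| = m'],
    (m0 %/ S ^ J <= m')%N, (1 / 2 <= d) && (d <= 1), d * m'%:R * m'%:R <= edges A' B'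
    & upper_regular d A' B' (m' %/ S)].
Proof.
move=> leJ densJ.
have S1 : 0 < 1 + tau by move: tau_ge0; lra.
have dens_ge j : 1 / 2 <= dens j.
  by rewrite /dens -[X in X <= _]mulr1 ler_wpM2l ?exprn_ege1 //; move: tau_ge0; lra.
have mj_gt0 j : (j <= J)%N -> (0 < m0 %/ S ^ j)%N.
  move=> lej; rewrite divn_gt0 ?expn_gt0 ?S_gt0 //; apply: leq_trans leJ.
  exact: leq_pexp2l.
pose P j := exists A' B' : {set T}, [/\ A' \subset A, B' \subset B, #|A'| = (m0 %/ S ^ j)%N,
  #|B'| = (m0 %/ S ^ j)%N & dens j * #|A'|%:R * #|B'|%:R <= edges A' B'].
have P_le1 j : (j <= J)%N -> P j -> dens j <= 1.
  move=> lej [A' [B' [_ _ cA' cB' dn]]].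
  have m_gt0 : 0 < #|A'|%:R * #|B'|%:R :> R by rewrite cA' cB' mulr_gt0 // ltr0n mj_gt0.
  have := le_trans dn (edges_le A' B'); rewrite -mulrA -[X in _ <= X]mul1r ler_pM2r //.
(* The induction is on the number i of increments still possible. *)
suff : forall i, (i <= J)%N -> P (J - i)%N -> exists (A' B' : {set T}) m' d,
   [/\ [/\ A' \subset A, B' \subset B, #|A'| = m' & #|B'| = m'],
    (m0 %/ S ^ J <= m')%N, (1 / 2 <= d) && (d <= 1), d * m'%:R * m'%:R <= edges A' B'
    & upper_regular d A' B' (m' %/ S)].
  move/(_ J (leqnn _)); apply; rewrite subnn; exists A, B.
  by rewrite expn0 divn1 cardA cardB /dens expr0 mulr1; split.
elim=> [_|i IHi ltiJ].
  by rewrite subn0 => /(P_le1 _ (leqnn _)); rewrite leNgt densJ.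
set j := (J - i.+1)%N => Pj; have [A' [B' [sA' sB' cA' cB' dn]]] := Pj.
have jJ : (j <= J)%N by apply: leq_subr.
have ej : (J - i)%N = j.+1 by rewrite /j subnS prednK // subn_gt0.
set m' := (m0 %/ S ^ j)%N in cA' cB'.
pose bad (XY : {set T} * {set T}) := [&& XY.1 \subset A', XY.2 \subset B',
   #|XY.1| == (m' %/ S)%N, #|XY.2| == (m' %/ S)%N
   & (1 + tau) * dens j * #|XY.1|%:R * #|XY.2|%:R <= edges XY.1 XY.2].
case: (pickP bad) => [[X Y] /and5P[/= sX sY /eqP cX /eqP cY dnXY]|none].
  apply: IHi; first exact: ltnW.
  rewrite ej; exists X, Y; split.
  - exact: subset_trans sA'.
  - exact: subset_trans sB'.
  - by rewrite cX /m' -divnMA expnSr.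
  - by rewrite cY /m' -divnMA expnSr.
  - by have -> : dens j.+1 = (1 + tau) * dens j by rewrite /dens exprS; ring.
exists A', B', m', (dens j); split=> //.
- by apply: leq_div2l; rewrite ?expn_gt0 ?S_gt0 // leq_pexp2l.
- by rewrite dens_ge P_le1.
- by rewrite -{1}cA' -cB'.
- move=> X Y sX sY leX leY; rewrite leNgt; apply/negP=> /ltW dnXY.
  (* A subpair that is too dense can be trimmed to the exact size tested by [bad]. *)
  have [|X' [Y' [sX' sY' cX' cY' dn']]] := dense_subpair leX leY _ dnXY.
    by rewrite mulr_ge0 ?(ltW S1) //; have := dens_ge j; lra.
  have := none (X', Y'); rewrite /bad /= cX' cY' !eqxx dn'.
  by rewrite (subset_trans sX' sX) (subset_trans sY' sY).
Qed.

End DensityIncrement.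

(** * From upper regularity to typical degrees *)

Section RegularFromIncrement.

Import Order.TTheory GRing.Theory Num.Theory.
Local Open Scope ring_scope.

Variables (R : realFieldType) (T : finType) (E : rel T) (A B : {set T}) (m S : nat).
Variables (p d : R).

Hypothesis p_gt0 : 0 < p.
Hypothesis p_le : p <= 1 / 8.
Hypothesis cardA : #|A| = m.
Hypothesis cardB : #|B| = m.
Hypothesis m_gt0 : (0 < m)%N.
Hypothesis S_gt0 : (0 < S)%N.
Hypothesis S_large : 16 <= p * p * S%:R.
Hypothesis d_ge : 1 / 2 <= d.
Hypothesis d_le : d <= 1.
Hypothesis dense : d * m%:R * m%:R <= edges R E A B.
Hypothesis upper : upper_regular E (p * p * p / 2) d A B (m %/ S).

Local Notation M := (m%:R : R).
Local Notation tau := (p * p * p / 2).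
Let s := (m %/ S)%N.

(** The tolerated deficit p^2 / 2 must stay below p * p: a relative deficit p on a set [U] filling
    only a share p of [B] has to outweigh it. *)
Definition A_hi : {set T} := [set a in A | (1 - p * p / 2) * d * M <= #|nb E a :&: B|%:R].
Definition B_hi : {set T} := [set b in B | d / 2 * M <= #|coll E b :&: A|%:R].

Lemma s_le : 16 * s%:R <= p * p * M.
Proof.
have S0 : 0 < S%:R :> R by rewrite ltr0n.
have h1 : s%:R * S%:R <= M by rewrite -natrM ler_nat leq_divM.
have pp : 0 <= p * p by rewrite mulr_ge0 ?(ltW p_gt0).
have h2 := ler_wpM2l pp h1.
have h3 : 16 * s%:R <= s%:R * (p * p * S%:R) by rewrite mulrC ler_wpM2l ?ler0n.
by move: h2 h3; lra.
Qed.

Lemma M_gt0 : 0 < M. Proof. by rewrite ltr0n. Qed.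

Lemma pp_bounds : [/\ 0 < p * p, p * p <= p / 8, 0 < p * p * p & p * p * p <= p * p / 8].
Proof.
have h1 : 0 < p * p by rewrite mulr_gt0.
have h2 : 0 < p * p * p by rewrite mulr_gt0.
have h3 := ler_wpM2l (ltW p_gt0) p_le; have h4 := ler_wpM2l (ltW h1) p_le.
by split; lra.
Qed.

(** Edges missing at low vertices must be made up inside [A_hi]. Upper regularity then gives p^2 / 2
    times the number of low vertices at most tau M, and tau = p^3 / 2 turns this into p M. *)
Lemma card_A_lo : #|A :\: A_hi|%:R <= p * M.
Proof.
have [p1 p2 p3 p4] := pp_bounds.
have sAhi : A_hi \subset A by apply/subsetP=> a; rewrite inE => /andP[].
have low : edges R E (A :\: A_hi) B <= #|A :\: A_hi|%:R * ((1 - p * p / 2) * d * M).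
  rewrite mulr_natl -sumr_const; apply: ler_sum => a; rewrite !inE negb_and -ltNge.
  by case/andP=> /orP[/negP//|/ltW].
have eq_e := edgesD1 R E B sAhi.
have eqM : M = #|A_hi|%:R + #|A :\: A_hi|%:R.
  by rewrite -cardA -(cardsID A_hi A) natrD (setIidPr sAhi).
move: low dense eq_e eqM.
set al := #|A :\: A_hi|%:R; set hi := #|A_hi|%:R; set e1 := edges _ _ A_hi B.
move=> low dn eq_e eqM; rewrite eq_e in dn.
have al0 : 0 <= al by rewrite ler0n.
have hi0 : 0 <= hi by rewrite ler0n.
have M0 := M_gt0.
have key : d * M * (hi + al * (p * p / 2)) <= e1 by rewrite eqM in dn low *; lra.
have dM : 0 < d * M by rewrite mulr_gt0 //; move: d_ge; lra.
have [les|lts] := leqP s #|A_hi|.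
  have leB : (s <= #|B|)%N by rewrite cardB leq_div.
  have := upper sAhi (subxx B) les leB; rewrite cardB -/hi -/e1 => up.
  have h1 : d * M * (hi + al * (p * p / 2)) <= d * M * ((1 + tau) * hi).
    by apply: le_trans key _; move: up; lra.
  rewrite ler_pM2l // in h1.
  have h2 : al * (p * p / 2) <= tau * M.
    have : tau * hi <= tau * M by rewrite ler_wpM2l ?eqM //; lra.
    by move: h1; lra.
  have h3 : (p * p / 2) * al <= (p * p / 2) * (p * M) by move: h2; lra.
  by rewrite ler_pM2l in h3; lra.
have hs : hi <= s%:R by rewrite ler_nat ltnW.
have e1_le : e1 <= hi * M by have := edges_le R E A_hi B; rewrite cardB.
have h1 : M * (d * (hi + al * (p * p / 2))) <= M * hi by move: key e1_le; lra.
rewrite ler_pM2l // in h1.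
have sl := s_le.
have h2 : (1 / 2) * (al * (p * p / 2)) <= d * (al * (p * p / 2)).
  by rewrite ler_wpM2r // mulr_ge0 //; lra.
have h3 : (p * p) * al <= (p * p) * (M / 4).
  have : 0 <= d * hi by rewrite mulr_ge0 //; move: d_ge; lra.
  by move: h1 h2 hs sl; lra.
rewrite ler_pM2l // in h3.
have h4 : p * p * M <= M / 64.
  by have := ler_wpM2r (ltW M0) p2; have := ler_wpM2r (ltW M0) p_le; lra.
by move: h3 hs sl h4 eqM; lra.
Qed.

Lemma edgesD2 (X Y Y1 : {set T}) : Y1 \subset Y ->
  edges R E X Y = edges R E X Y1 + edges R E X (Y :\: Y1).
Proof.
move=> sY; rewrite !edges_sym (big_setID Y1) /=; congr (_ + _).
by apply: eq_bigl => a; rewrite (setIidPr sY).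
Qed.

Lemma s_small : 64 * s%:R <= M / 16.
Proof.
have [p1 p2 p3 p4] := pp_bounds; have sl := s_le; have M0 := M_gt0.
by have := ler_wpM2r (ltW M0) p2; have := ler_wpM2r (ltW M0) p_le; lra.
Qed.

Lemma card_B_lo : #|B :\: B_hi|%:R <= p * M.
Proof.
have [p1 p2 p3 p4] := pp_bounds.
have sBhi : B_hi \subset B by apply/subsetP=> a; rewrite inE => /andP[].
have low : edges R E A (B :\: B_hi) <= #|B :\: B_hi|%:R * (d / 2 * M).
  rewrite edges_sym mulr_natl -sumr_const; apply: ler_sum => a.
  rewrite !inE negb_and -ltNge.
  by case/andP=> /orP[/negP//|/ltW].
have eq_e := edgesD2 A sBhi.
have eqM : M = #|B_hi|%:R + #|B :\: B_hi|%:R.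
  by rewrite -cardB -(cardsID B_hi B) natrD (setIidPr sBhi).
move: low dense eq_e eqM.
set al := #|B :\: B_hi|%:R; set hi := #|B_hi|%:R; set e1 := edges _ _ A B_hi.
move=> low dn eq_e eqM; rewrite eq_e in dn.
have al0 : 0 <= al by rewrite ler0n.
have hi0 : 0 <= hi by rewrite ler0n.
have M0 := M_gt0.
have key : d * M * (hi + al / 2) <= e1 by rewrite eqM in dn low *; lra.
have dM : 0 < d * M by rewrite mulr_gt0 //; move: d_ge; lra.
have [les|lts] := leqP s #|B_hi|.
  have leA : (s <= #|A|)%N by rewrite cardA leq_div.
  have := upper (subxx A) sBhi leA les; rewrite cardA -/hi -/e1 => up.
  have h1 : d * M * (hi + al / 2) <= d * M * ((1 + tau) * hi).
    by apply: le_trans key _; move: up; lra.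
  rewrite ler_pM2l // in h1.
  have h2 : tau * hi <= tau * M by rewrite ler_wpM2l ?eqM //; lra.
  have h3 : p * p * p * M <= p * M.
    by rewrite ler_wpM2r ?(ltW M0) //; move: p2 p4 p_gt0; lra.
  by move: h1 h2 h3; lra.
have hs : hi <= s%:R by rewrite ler_nat ltnW.
have e1_le : e1 <= hi * M by have := edges_le R E A B_hi; rewrite cardA mulrC.
have h1 : M * (d * (hi + al / 2)) <= M * hi by move: key e1_le; lra.
rewrite ler_pM2l // in h1.
have sl := s_small.
have h2 : (1 / 2) * (al / 2) <= d * (al / 2) by rewrite ler_wpM2r // divr_ge0.
have h3 : 0 <= d * hi by rewrite mulr_ge0 //; move: d_ge; lra.
by move: h1 h2 h3 hs sl eqM; lra.
Qed.

(* Upper regularity also excludes low degrees: vertices of A_hi have almost full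
   degree into B, so a deficit on U is an excess on B :\: U. *)
Lemma upper_regular_typical (U : {set T}) : U \subset B -> p * M <= #|U|%:R ->
  #|[set a in A_hi | ~~ typical E p d U a]|%:R <= p * M.
Proof.
move=> sUB leU.
have [p1 p2 p3 p4] := pp_bounds; have sl := s_small; have sl' := s_le; have M0 := M_gt0.
have sAhi : A_hi \subset A by apply/subsetP=> a; rewrite inE => /andP[].
have pM : p * p * M <= p * M by rewrite ler_wpM2r ?(ltW M0) //; move: p2 p_gt0; lra.
have su : (s <= #|U|)%N.
  by rewrite -(ler_nat R); have := ler0n R s; move: sl' leU pM; lra.
have U0 : 0 < #|U|%:R :> R by apply: lt_le_trans leU; rewrite mulr_gt0.
have dU : 0 < d * #|U|%:R by rewrite mulr_gt0 //; move: d_ge; lra.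
have U_le : #|U|%:R <= M by rewrite ler_nat -cardB subset_leq_card.
pose Xu := [set a in A_hi | (1 + p) * d * #|U|%:R < #|nb E a :&: U|%:R].
pose Xd := [set a in A_hi | #|nb E a :&: U|%:R < (1 - p) * d * #|U|%:R].
have sXu : Xu \subset A by apply: subset_trans sAhi; apply/subsetP=> a; rewrite inE => /andP[].
have sXd : Xd \subset A by apply: subset_trans sAhi; apply/subsetP=> a; rewrite inE => /andP[].
have cXu : (#|Xu| < s.+1)%N.
  rewrite ltnS leqNgt; apply/negP=> ltX.
  have := upper sXu sUB (ltnW ltX) su; apply/negP; rewrite -ltNge.
  have X0 : 0 < #|Xu|%:R :> R by rewrite ltr0n; apply: leq_ltn_trans ltX.
  apply: lt_le_trans (_ : #|Xu|%:R * ((1 + p) * d * #|U|%:R) <= _).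
    have := mulr_gt0 X0 dU; have : tau < p by move: p4 p2 p_gt0; lra.
    move=> tp XdU; have := mulr_gt0 XdU (_ : 0 < p - tau); lra.
  rewrite mulr_natl -sumr_const; apply: ler_sum => a; rewrite inE => /andP[_].
  exact: ltW.
have cXd : (#|Xd| < s.+1)%N.
  rewrite ltnS leqNgt; apply/negP=> ltX.
  have X0 : 0 < #|Xd|%:R :> R by rewrite ltr0n; apply: leq_ltn_trans ltX.
  have low : #|Xd|%:R * ((1 - p * p / 2) * d * M - (1 - p) * d * #|U|%:R)
      <= edges R E Xd (B :\: U).
    rewrite mulr_natl -sumr_const; apply: ler_sum => a; rewrite !inE.
    case/andP=> /andP[_ hi] /ltW lo.
    have : (#|nb E a :&: B|%:R : R) = #|nb E a :&: U|%:R + #|nb E a :&: (B :\: U)|%:R.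
      rewrite -natrD -(cardsID U (nb E a :&: B)) -setIA (setIidPr sUB).
      by rewrite setIDA.
    by move: hi lo; lra.
  have cY : #|B :\: U|%:R = M - #|U|%:R :> R.
    by rewrite cardsDS // natrB ?subset_leq_card // cardB.
  (* If [B :\: U] is too small for [upper] to apply, its fewer than s vertices cannot supply the
     required degrees anyway. *)
  have [leY|ltY] := leqP s #|B :\: U|.
    have up := upper sXd (subsetDl B U) (ltnW ltX) leY.
    have := le_trans low up; rewrite cY.
    have -> : (1 + tau) * d * #|Xd|%:R * (M - #|U|%:R) = #|Xd|%:R * ((1 + tau) * d * (M - #|U|%:R)) by ring.
    rewrite ler_pM2l // => h1.
    have h2 : d * ((p + tau) * #|U|%:R) <= d * ((p * p / 2 + tau) * M) by move: h1; lra.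
    rewrite ler_pM2l in h2; last by move: d_ge; lra.
    have h3 : (p + tau) * (p * M) <= (p + tau) * #|U|%:R by rewrite ler_wpM2l //; move: p_gt0 p3; lra.
    have h4 : p * p * p * M <= p * p / 8 * M by rewrite ler_wpM2r ?(ltW M0).
    have h5 : 0 <= p * p * p * p * M by rewrite !mulr_ge0 // ltW.
    have h6 : 0 < p * p * M by rewrite mulr_gt0.
    by move: h2 h3 h4 h5 h6; lra.
  have up : edges R E Xd (B :\: U) <= #|Xd|%:R * s%:R.
    apply: le_trans (edges_le _ _ _ _) _; rewrite ler_wpM2l ?ler0n //.
    by rewrite ler_nat ltnW.
  have := le_trans low up; rewrite ler_pM2l // => h1.
  have h2 : (1 - p) * d * #|U|%:R <= (1 - p) * d * M.
    by rewrite ler_wpM2l // mulr_ge0 //; move: d_ge p_le; lra.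
  have h3 : 1 / 2 * ((p - p * p / 2) * M) <= d * ((p - p * p / 2) * M).
    by rewrite ler_wpM2r // mulr_ge0 ?(ltW M0) //; move: p2 p_gt0; lra.
  have h4 : p * p * M <= p / 8 * M by rewrite ler_wpM2r ?(ltW M0).
  have h5 : 0 < p * M by rewrite mulr_gt0.
  by move: h1 h2 h3 h4 h5 sl'; lra.
have cov : [set a in A_hi | ~~ typical E p d U a] \subset Xu :|: Xd.
  apply/subsetP=> a; rewrite 2!inE => /andP[ahi].
  rewrite /typical negb_and -!ltNge => /orP[lt1|lt2].
    by rewrite !in_set ahi lt1 orbT.
  by rewrite !in_set ahi lt2.
apply: le_trans (_ : #|Xu|%:R + #|Xd|%:R <= _).
  rewrite -natrD ler_nat; apply: leq_trans (subset_leq_card cov) _.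
  exact: leq_card_setU.
have h1 : (#|Xu|%:R : R) <= s%:R by rewrite ler_nat -ltnS.
have h2 : (#|Xd|%:R : R) <= s%:R by rewrite ler_nat -ltnS.
by have := ler0n R s; move: sl' pM; lra.
Qed.

End RegularFromIncrement.

(** * Covering a regular pair by two copies *)

Section EnumerateSet.

Variables (T : finType) (A : {set T}) (m : nat).
Hypothesis cardA : #|A| = m.

Definition enum_pt (i : 'I_m) : T := enum_val (cast_ord (esym cardA) i).

Lemma enum_pt_in i : enum_pt i \in A.
Proof. exact: enum_valP. Qed.

Lemma enum_pt_inj : injective enum_pt.
Proof. by move=> i j /enum_val_inj/cast_ord_inj. Qed.

Lemma enum_pt_image (f : {perm 'I_m}) : (fun i => enum_pt (f i)) @: setT = A.
Proof.
apply/eqP; rewrite eqEcard card_imset; last by move=> i j /enum_pt_inj/perm_inj.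
rewrite cardsT card_ord cardA leqnn andbT.
by apply/subsetP=> _ /imsetP[i _ ->]; apply: enum_pt_in.
Qed.

Lemma card_enum_pt_preim (X : {set T}) : X \subset A -> #|enum_pt @^-1: X| = #|X|.
Proof.
move=> sXA; rewrite -(card_imset _ enum_pt_inj); congr #|pred_of_set _|.
apply/setP=> x; apply/imsetP/idP => [[i]|xX]; first by rewrite inE => ? ->.
have : x \in (fun i => enum_pt ((1%g : {perm 'I_m}) i)) @: setT.
  by rewrite enum_pt_image (subsetP sXA).
by case/imsetP=> i _ eqx; exists i; rewrite ?inE eqx perm1 in xX *.
Qed.

End EnumerateSet.

Section FinalPair.

Import Order.TTheory GRing.Theory Num.Theory.
Local Open Scope ring_scope.

Variables (R : realFieldType) (T : finType) (c : edge_coloring T) (F : graph_sequence) (D : nat).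
Hypothesis D_gt0 : (0 < D)%N.
Hypothesis boundF : bounded_sequence D F.
Hypothesis bipF : bipartite_sequence F.

Variable col : bool.
Let E : rel T := fun x y => c x y == col.
Let q : R := 2^-1 ^+ D.

(** Both sides are enumerated by ['I_m]; the two permutations composed with the enumerations are the
    two halves of an embedded double cover. *)
Lemma tiled_regular_pair (A B B0 : {set T}) m (d : R) :
  [disjoint A & B] -> #|A| = m -> #|B| = m -> B0 \subset B ->
  1 / 2 <= d -> d <= 1 ->
  (forall U : {set T}, U \subset B0 -> q ^+ 50 * m%:R <= #|U|%:R ->
     #|[set a in A | ~~ typical E (q ^+ 50) d U a]|%:R <= q ^+ 50 * m%:R) ->
  (2 ^ (64 * D) <= m)%N ->
  (2 ^ (50 * D) * #|B :\: B0| <= m)%N ->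
  (forall a, a \in A -> (m <= 2 ^ (5 * D) * #|nb E a :&: B0|)%N) ->
  (forall b, b \in B -> (m <= 2 ^ (4 * D) * #|coll E b :&: A|)%N) ->
  (forall b, b \in B0 -> (m <= 8 * #|coll E b :&: A|)%N) ->
  tiled c F 2 (A :|: B).
Proof.
move=> dAB cardA cardB sB0 d_ge d_le reg m_large LB degA degB degB0.
have m_gt0 : (0 < m)%N by apply: leq_trans m_large; rewrite expn_gt0.
pose fA := enum_pt cardA; pose fB := enum_pt cardB.
pose E' : rel 'I_m := fun i j => E (fA i) (fB j).
pose B0' := fB @^-1: B0.
have nbE i U' : nb E' i :&: U' = fB @^-1: (nb E (fA i) :&: fB @: U').
  apply/setP=> j; rewrite !inE (mem_imset _ _ (@enum_pt_inj _ _ _ _)) //.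
have nbE0 i : nb E' i :&: B0' = fB @^-1: (nb E (fA i) :&: B0).
  by apply/setP=> j; rewrite !inE.
have collE j : coll E' j = fA @^-1: (coll E (fB j) :&: A).
  by apply/setP=> i; rewrite !inE enum_pt_in andbT.
have fB_sub (U' : {set 'I_m}) : fB @: U' \subset B.
  by apply/subsetP=> _ /imsetP[j _ ->]; apply: enum_pt_in.
have [side sideP] := bipF m.
have degF1 p : (#|[set x | F m p x]| <= D)%N by exact: degree_bounded.
have degF2 x : (#|preds (F m) x| <= D)%N.
  apply: leq_trans (degree_bounded (n := m) x boundF).
  by apply: subset_leq_card; apply/subsetP=> p; rewrite !inE adj_sym.
have [||||||f [g fgE]] := @spanning_regular R D D_gt0 'I_m E' B0' d (fun p x => F m p x)
   degF1 degF2 d_ge d_le; rewrite ?card_ord //.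
- move=> U' sU'; rewrite card_ord => leU'.
  have cU : #|fB @: U'| = #|U'| by rewrite card_imset //; apply: enum_pt_inj.
  have sU : fB @: U' \subset B0.
    by apply/subsetP=> _ /imsetP[j jU ->]; have := subsetP sU' j jU; rewrite inE.
  have := reg (fB @: U') sU; rewrite cU => /(_ leU'); apply: le_trans.
  rewrite ler_nat -(card_imset _ (@enum_pt_inj _ A m cardA)).
  apply/subset_leq_card/subsetP=> _ /imsetP[i iX ->].
  rewrite inE enum_pt_in /=; move: iX; rewrite inE; apply: contra.
  rewrite /typical cU nbE card_enum_pt_preim //.
  exact: subset_trans (subsetIr _ _) (fB_sub _).
- have -> : ~: B0' = fB @^-1: (B :\: B0).
    by apply/setP=> j; rewrite !inE enum_pt_in andbT.
  by rewrite card_enum_pt_preim ?subsetDl.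
- move=> i; rewrite nbE0 card_enum_pt_preim; first by apply/degA/enum_pt_in.
  exact: subset_trans (subsetIr _ _) sB0.
- by move=> j; rewrite collE card_enum_pt_preim ?subsetIr //; apply/degB/enum_pt_in.
- by move=> j; rewrite inE => jB; rewrite collE card_enum_pt_preim ?subsetIr //; apply: degB0.
rewrite -(enum_pt_image cardA f) -(enum_pt_image cardB g).
apply: (@tiled_double_cover T c F m side (fun i => fA (f i)) (fun i => fB (g i)) col) => //.
- by move=> i j /enum_pt_inj/perm_inj.
- by move=> i j /enum_pt_inj/perm_inj.
- move=> i j; apply/eqP=> eq_ij; have := disjointFr dAB (enum_pt_in cardA (f i)).
  by rewrite -/(fA _) eq_ij enum_pt_in.
- by move=> i j Fij; apply/eqP/fgE.
Qed.

End FinalPair.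

(** * Absorbing the leftover vertices *)

Section Absorption.

Variables (T : finType) (c : edge_coloring T) (F : graph_sequence) (D : nat).
Hypothesis D_gt0 : 0 < D.
Hypothesis boundF : bounded_sequence D F.
Hypothesis bipF : bipartite_sequence F.

Lemma tiled_split k k' (X Y : {set T}) : Y \subset X ->
  tiled c F k (X :\: Y) -> tiled c F k' Y -> tiled c F (k + k') X.
Proof.
move=> sYX tX tY; have := @tiledU_sub T c F k k' X Y set0 (sub0set _) sYX tX.
by rewrite !setD0; apply.
Qed.

(** Any D vertices of [L] miss at most half of [Y] in colour [col], so every candidate set has at
    least #|L| elements. Hence [L] can be enumerated arbitrarily and Hall's condition is
    immediate. *)
Lemma tiled_sparse (L Y : {set T}) (col : bool) :
  [disjoint L & Y] -> 2 * #|L| <= #|Y| ->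
  (forall l, l \in L -> 2 * D * #|[set y in Y | c l y != col]| <= #|Y|) ->
  exists G : {set T}, [/\ G \subset Y, #|G| = #|L| & tiled c F 2 (L :|: G)].
Proof.
move=> dLY leL sparse; have [L0|[l0 l0L]] := set_0Vmem L.
  by exists set0; rewrite L0 setU0 !cards0 sub0set; split=> //; apply: tiled0.
pose n := #|L|; have n_gt0 : 0 < n by apply/card_gt0P; exists l0.
pose f := @enum_pt T L n (erefl _).
pose C q := [set y in Y | [forall p, F n p q ==> (c (f p) y == col)]].
have degF q : #|[set p | F n p q]| <= D.
  apply: leq_trans (degree_bounded (n := n) q boundF).
  by apply: subset_leq_card; apply/subsetP=> p; rewrite !inE adj_sym.
have cardC q : n <= #|C q|.
  pose bad p := [set y in Y | c (f p) y != col].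
  have cov : Y :\: C q \subset \bigcup_(p in [set p | F n p q]) bad p.
    apply/subsetP=> y; rewrite !inE => /andP[+ yY]; rewrite yY /= => /forallPn[p].
    rewrite negb_imply => /andP[Fpq nc]; apply/bigcupP; exists p; rewrite inE //.
    by rewrite yY.
  have le1 : #|Y :\: C q| <= D * (#|Y| %/ (2 * D)).
    apply: leq_trans (subset_leq_card cov) _.
    apply: leq_trans (bigcup_card_le (k := #|Y| %/ (2 * D)) _) _ => [p _|]; last by rewrite leq_mul2r degF orbT.
    by rewrite leq_divRL ?muln_gt0 // mulnC; apply/sparse/enum_pt_in.
  have le2 : 2 * (D * (#|Y| %/ (2 * D))) <= #|Y| by rewrite mulnA mulnC leq_divM.
  have := cardsID (C q) Y; have : #|Y :&: C q| <= #|C q| by rewrite subset_leq_card ?subsetIr.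
  by move: le1 le2 leL; rewrite -/n; lia.
have [S sS|g g_inj gC] := @hall_marriage 'I_n T l0 C setT.
  have [->|[q qS]] := set_0Vmem S; first by rewrite cards0.
  apply: leq_trans (max_card _) _; rewrite card_ord.
  by apply: leq_trans (cardC q) _; apply/subset_leq_card/(bigcup_sup _ qS).
have {}g_inj : injective g by move=> i j; apply: g_inj; rewrite inE.
have gY i : g i \in Y by have := gC i; rewrite !inE => /(_ isT)/andP[].
have [side sideP] := bipF n.
exists (g @: [set: 'I_n]); split.
- by apply/subsetP=> _ /imsetP[i _ ->].
- by rewrite card_imset // cardsT card_ord.
- have -> : L = f @: setT.
    rewrite -[LHS](enum_pt_image (erefl n) (1%g : {perm 'I_n})).
    by apply: eq_imset => i; rewrite /= perm1.
  apply: (@tiled_double_cover T c F n side f g col) => //.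
  + exact: enum_pt_inj.
  + move=> i j; apply: contraTneq (gY j) => <-.
    by rewrite (disjointFr dLY) // enum_pt_in.
  + move=> i j Fij; have := gC j; rewrite !inE => /(_ isT)/andP[_ /forallP/(_ i)].
    by rewrite Fij => /eqP.
Qed.

(** Subtraction is truncated, so at most one of the two differences is nonzero; a single copy of
    that order inside the larger side evens them out. *)
Lemma tiled_balance (A B Ac Bc : {set T}) : Ac \subset A -> Bc \subset B ->
  2 ^ (10 * D) * (#|A| - #|B|) <= #|Ac| -> 2 ^ (10 * D) * (#|B| - #|A|) <= #|Bc| ->
  exists SA SB : {set T}, [/\ SA \subset Ac, SB \subset Bc,
    #|A :\: SA| = #|B :\: SB|, #|SA| + #|SB| = (#|A| - #|B|) + (#|B| - #|A|)
    & tiled c F 1 (SA :|: SB)].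
Proof.
move=> sA sB leA leB; case: (ltngtP #|A| #|B|) => [ltAB|ltBA|eqAB].
- have [|S [sS cS pS]] := greedy_piece c D_gt0 boundF bipF (X := Bc) (j := #|B| - #|A|) _ leB.
    by rewrite subn_gt0.
  exists set0, S; rewrite sub0set sS setD0 set0U cards0 cS.
  rewrite cardsDS ?(subset_trans sS) // cS; split=> //; try lia.
  exact: tiled_piece.
- have [|S [sS cS pS]] := greedy_piece c D_gt0 boundF bipF (X := Ac) (j := #|A| - #|B|) _ leA.
    by rewrite subn_gt0.
  exists S, set0; rewrite sub0set sS setD0 setU0 cards0 cS.
  rewrite cardsDS ?(subset_trans sS) // cS; split=> //; try lia.
  exact: tiled_piece.
- exists set0, set0; rewrite !sub0set !setD0 setU0 cards0; split=> //; first by lia.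
  exact: tiled0.
Qed.

End Absorption.

Section Core.

Import Order.TTheory GRing.Theory Num.Theory.
Local Open Scope ring_scope.

Variables (R : realFieldType) (D : nat).
Let q : R := 2^-1 ^+ D.

Lemma le_q_nat a (s t : nat) : s%:R <= q ^+ a * t%:R -> (2 ^ (a * D) * s <= t)%N.
Proof.
move=> le_st; rewrite -(ler_nat R) natrM.
apply: le_trans (ler_wpM2l (ler0n R _) le_st) _.
by rewrite mulrA expn_q mul1r.
Qed.

Lemma q_le_nat_inv a (s t : nat) : q ^+ a * t%:R <= s%:R -> (t <= 2 ^ (a * D) * s)%N.
Proof.
move=> le_st; rewrite -(ler_nat R) natrM.
apply: le_trans (ler_wpM2l (ler0n R _) le_st).
by rewrite mulrA expn_q mul1r.
Qed.

Lemma q_half : (0 < D)%N -> q <= 1 / 2.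
Proof. by move=> D_gt0; have := qS R D_gt0 0; rewrite expr0 expr1 -/q; lra. Qed.

Lemma q_mono i j : (0 < D)%N -> (i <= j)%N -> q ^+ j <= q ^+ i.
Proof.
move=> D_gt0 leij; apply: ler_wiXn2l => //; first exact: ltW (q_gt0 R D).
by have := q_half D_gt0; lra.
Qed.

(* Leftover vertices with many neighbours of colour col in A join B, those with many
   in B join A, and those with neither are covered together with a subset of A in
   the other colour; one more greedy copy then makes the two sides equal. *)
Lemma tiled_core (T : finType) (c : edge_coloring T) (F : graph_sequence) (col : bool)
    (A B L : {set T}) (m : nat) (d : R) (E := fun x y => c x y == col) (M := m%:R : R) :
  (0 < D)%N -> bounded_sequence D F -> bipartite_sequence F ->
  [disjoint A & B] -> [disjoint L & A] -> [disjoint L & B] ->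
  1 / 2 <= d -> d <= 1 -> (2 ^ (72 * D) <= m)%N ->
  (1 - q ^+ 52) * M <= #|A|%:R -> (#|A| <= m)%N ->
  (1 - q ^+ 52) * M <= #|B|%:R -> (#|B| <= m)%N ->
  (forall U : {set T}, U \subset B -> q ^+ 52 * M <= #|U|%:R ->
     #|[set a in A | ~~ typical E (q ^+ 52) d U a]|%:R <= q ^+ 52 * M) ->
  (forall a, a \in A -> M / 4 <= #|nb E a :&: B|%:R) ->
  (forall b, b \in B -> M / 5 <= #|coll E b :&: A|%:R) ->
  (2 ^ (60 * D) * #|L| <= m)%N ->
  tiled c F 5 (A :|: B :|: L).
Proof.
move=> D_gt0 boundF bipF dAB dLA dLB d_ge d_le m_large cardA cardA_le cardB cardB_le.
move=> reg degA degB cardL.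
have m_gt0 : (0 < m)%N by apply: leq_trans m_large; rewrite expn_gt0.
have M0 : 0 < M by rewrite ltr0n.
have qM_gt0 i : 0 < q ^+ i * M by rewrite mulr_gt0 // qX_gt0.
have qSM i : 2 * (q ^+ i.+1 * M) <= q ^+ i * M.
  by rewrite mulrA ler_wpM2r ?qS // ltW.
have qmM i j : (i <= j)%N -> q ^+ j * M <= q ^+ i * M.
  by move=> leij; rewrite ler_wpM2r ?q_mono // ltW.
have q5 : 32 * (q ^+ 5 * M) <= M.
  have := qSM 0; have := qSM 1; have := qSM 2; have := qSM 3; have := qSM 4.
  by rewrite expr0 mul1r; lra.
have q10 : 1024 * (q ^+ 10 * M) <= M.
  have := qSM 5; have := qSM 6; have := qSM 7; have := qSM 8; have := qSM 9.
  by move: q5; clear -q; lra.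
have L60 : #|L|%:R <= q ^+ 60 * M by apply: nat_le_q.
have L_ge0 : 0 <= #|L|%:R :> R by rewrite ler0n.
have q60 : 2 * (q ^+ 60 * M) <= q ^+ 52 * M.
  by have := qSM 59; have := qmM 52 59 isT; lra.
have e52 := qSM 51; have e51 := qSM 50; have p52 := qM_gt0 52.
have e50 : q ^+ 50 * M <= q ^+ 10 * M by apply: qmM.
(* The threshold q^3 m lies between two demands: below it a vertex is sparse enough for
   [tiled_sparse], above it the degree survives later removals with the q^4 and q^5 shares asked of
   the final pair. *)
pose LB := [set l in L | (m <= 2 ^ (3 * D) * #|coll E l :&: A|)%N].
pose LA := [set l in L :\: LB | (m <= 2 ^ (3 * D) * #|nb E l :&: B|)%N].
pose L0 := L :\: LB :\: LA.
have sLB : LB \subset L by apply/subsetP=> l; rewrite inE => /andP[].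
have sLA : LA \subset L by apply/subsetP=> l; rewrite !inE => /andP[/andP[]].
have sL0 : L0 \subset L by apply: subset_trans (subsetDl _ _) (subsetDl _ _).
have leL (X : {set T}) : X \subset L -> #|X|%:R <= q ^+ 60 * M.
  by move=> sX; apply: le_trans L60; rewrite ler_nat subset_leq_card.
have LB60 := leL _ sLB; have LA60 := leL _ sLA; have L060 := leL _ sL0.
have pM : q ^+ 52 * M <= M / 1024 by move: e52 e51 e50 q10 p52; clear -q; lra.
have [|||G [sG cG tG]] := @tiled_sparse T c F D D_gt0 boundF bipF L0 A (~~ col).
- exact: disjointWl sL0 dLA.
- by rewrite -(ler_nat R) natrM -/M; move: L060 q60 cardA pM M0; clear -q; lra.
- move=> l; rewrite 3!inE => /and3P[_ + lL]; rewrite inE lL /= -ltnNge => lt_m.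
  have -> : [set y in A | c l y != ~~ col] = coll E l :&: A.
    apply/setP=> y; rewrite !inE andbC /E color_sym.
    by case: (c y l); case: (col).
  rewrite -(leq_pmul2l (isT : 0 < 2)%N); apply: leq_trans (_ : m <= _)%N; last first.
    by rewrite -(ler_nat R) natrM -/M; move: cardA pM M0; clear -q; lra.
  apply: leq_trans (ltnW lt_m); rewrite !mulnA leq_mul2r; apply/orP; right.
  rewrite -mulnA; apply: leq_trans (leq_mul (leqnn 2) (mul2_leq_expn2 D)) _.
  by rewrite -expnS leq_exp2l // mulSn -addn1 leq_add2l muln_gt0.
have G60 : #|G|%:R <= q ^+ 60 * M by rewrite cG.
pose A2 := (A :\: G) :|: LA; pose B2 := B :|: LB.
have cA2 : #|A2| = (#|A| - #|G| + #|LA|)%N.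
  rewrite cardsU cardsDS // (_ : _ :&: _ = set0) ?cards0 ?subn0 //.
  apply/setP=> x; rewrite !inE; apply/negbTE/negP=> /andP[/andP[_ xA] /andP[/andP[_ xL] _]].
  by have := disjointFr dLA xL; rewrite xA.
have cB2 : #|B2| = (#|B| + #|LB|)%N.
  rewrite cardsU (_ : _ :&: _ = set0) ?cards0 ?subn0 //.
  apply/setP=> x; rewrite !inE; apply/negbTE/negP=> /andP[xB /andP[xL _]].
  by have := disjointFr dLB xL; rewrite xB.
have A2R : #|A2|%:R = #|A|%:R - #|G|%:R + #|LA|%:R :> R.
  by rewrite cA2 natrD natrB ?subset_leq_card.
have B2R : #|B2|%:R = #|B|%:R + #|LB|%:R :> R by rewrite cB2 natrD.
have A_M : #|A|%:R <= M by rewrite ler_nat.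
have B_M : #|B|%:R <= M by rewrite ler_nat.
have G_ge0 : 0 <= #|G|%:R :> R by rewrite ler0n.
have LA_ge0 : 0 <= #|LA|%:R :> R by rewrite ler0n.
have LB_ge0 : 0 <= #|LB|%:R :> R by rewrite ler0n.
pose gap := (#|A2| - #|B2| + (#|B2| - #|A2|))%N.
have gap51 : gap%:R <= q ^+ 51 * M.
  rewrite /gap; case: (leqP #|A2| #|B2|) => [le|/ltnW le].
    rewrite (eqP le) add0n natrB //; move: cardA cardB A2R B2R G60 LA60 LB60 A_M B_M q60 e52 LA_ge0 LB_ge0 G_ge0.
    by clear -q; lra.
  rewrite [X in (_ + X)%N](eqP le) addn0 natrB //.
  by move: cardA cardB A2R B2R G60 LA60 LB60 A_M B_M q60 e52 LA_ge0 LB_ge0 G_ge0 M0; clear -q; lra.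
have gap_le : (2 ^ (10 * D) * gap <= #|A :\: G|)%N /\ (2 ^ (10 * D) * gap <= #|B|)%N.
  have h : (2 ^ (10 * D))%:R * gap%:R <= q ^+ 41 * M.
    apply: le_trans (ler_wpM2l (ler0n R _) gap51) _.
    have -> : (2 ^ (10 * D))%:R * (q ^+ 51 * M) = ((2 ^ (10 * D))%:R * q ^+ 10) * (q ^+ 41 * M).
      by rewrite (_ : q ^+ 51 = q ^+ 10 * q ^+ 41) -?exprD // !mulrA.
    by rewrite expn_q mul1r.
  have h41 : q ^+ 41 * M <= q ^+ 10 * M by apply: qmM.
  rewrite -!(ler_nat R) !natrM cardsDS // natrB ?subset_leq_card //.
  by move: h h41 q10 cardA cardB G60 q60 pM M0; clear -q => *; split; lra.
have [||||SA [SB [sSA sSB eqAB cS tS]]] := @tiled_balance T c F D D_gt0 boundF bipF A2 B2 (A :\: G) B.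
- exact: subsetUl.
- exact: subsetUl.
- by apply: leq_trans gap_le.1; rewrite leq_mul2l leq_addr orbT.
- by apply: leq_trans gap_le.2; rewrite leq_mul2l leq_addl orbT.
have SA51 : #|SA|%:R <= q ^+ 51 * M.
  by apply: le_trans gap51; rewrite ler_nat /gap -cS leq_addr.
have SB51 : #|SB|%:R <= q ^+ 51 * M.
  by apply: le_trans gap51; rewrite ler_nat /gap -cS leq_addl.
pose A3 := A2 :\: SA; pose B3 := B2 :\: SB; pose ms := #|A3|.
have sSA2 : SA \subset A2 by apply: subset_trans sSA (subsetUl _ _).
have msR : ms%:R = #|A2|%:R - #|SA|%:R :> R.
  by rewrite /ms cardsDS // natrB ?subset_leq_card.
have SA_ge0 : 0 <= #|SA|%:R :> R by rewrite ler0n.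
have ms_up : ms%:R <= M + q ^+ 60 * M by rewrite msR A2R; move: SA_ge0 G_ge0 A_M LA60 M0; clear -q; lra.
have ms_low : M / 2 <= ms%:R.
  by rewrite msR A2R; move: cardA G60 SA51 q60 p52 LA_ge0 pM e51 e50 q10 M0; clear -q; lra.
have BhE : B :\: SB \subset B3.
  by apply/subsetP=> x; rewrite !inE => /andP[-> ->].
have tAB : tiled c F 2 (A3 :|: B3).
  apply: (@tiled_regular_pair R T c F D D_gt0 boundF bipF col A3 B3 (B :\: SB) ms d) => //.
  - rewrite -setI_eq0; apply/eqP/setP=> x; rewrite in_set0; apply/negbTE/negP.
    case/setIP=> /setDP[/setUP[/setDP[xA _]|xLA] _] /setDP[/setUP[xB|xLB] _].
    + by have := disjointFr dAB xA; rewrite xB.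
    + by have := disjointFr dLA (subsetP sLB _ xLB); rewrite xA.
    + by have := disjointFr dLB (subsetP sLA _ xLA); rewrite xB.
    + by move: xLA; rewrite inE in_setD xLB.
  (* The exponent drops from 52 to 50 to cover the vertices of [LA], which may all be atypical, and
     the change of size from m to ms >= m / 2. *)
  - rewrite -/q => U sU leU; have sUB : U \subset B by apply: subset_trans sU (subsetDl _ _).
    have q50ms : q ^+ 50 * (M / 2) <= q ^+ 50 * ms%:R by rewrite ler_wpM2l // qX_ge0.
    have leU' : q ^+ 52 * M <= #|U|%:R by
      apply: le_trans (le_trans _ q50ms) leU; move: e52 e51 p52 M0; clear -q; lra.
    apply: le_trans (_ : (#|[set a in A | ~~ typical E (q ^+ 52) d U a]| + #|LA|)%:R <= _).
      rewrite ler_nat; apply: leq_trans (leq_card_setU _ _).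
      apply/subset_leq_card/subsetP=> a; rewrite in_set in_setU.
      case/andP=> /setDP[/setUP[/setDP[aA _]|aL] _] ntyp; last by rewrite aL orbT.
      rewrite inE aA /=; apply/orP; left; apply: contra ntyp => /andP[lo hi].
      have U0 : 0 <= d * #|U|%:R by rewrite mulr_ge0 ?ler0n //; move: d_ge M0; clear -q; lra.
      have qq : q ^+ 52 <= q ^+ 50 by apply: q_mono.
      have := ler_wpM2r U0 qq; rewrite /typical => h.
      by apply/andP; split; [apply: le_trans lo|apply: (le_trans hi)]; move: h M0; clear -q; lra.
    rewrite natrD; have h_reg := reg U sUB leU'; apply: le_trans q50ms.
    by move: h_reg LA60 q60 e52 e51 p52 M0; clear -q; lra.
  - rewrite -(leq_pmul2l (isT : 0 < 2)%N); apply: leq_trans (_ : m <= _)%N; last first.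
      by rewrite -(ler_nat R) natrM -/M; move: ms_low M0; clear -q; lra.
    apply: leq_trans m_large; rewrite -expnS leq_exp2l //.
    by rewrite -add1n (_ : 72 = 8 + 64)%N // mulnDl leq_add2r muln_gt0.
  - apply: le_q_nat; apply: le_trans (_ : #|LB|%:R <= _).
      rewrite ler_nat; apply/subset_leq_card/subsetP=> x.
      case/setDP=> /setDP[/setUP[xB|//] xSB]; by rewrite in_setD xSB xB.
    have q50ms : q ^+ 50 * (M / 2) <= q ^+ 50 * ms%:R by rewrite ler_wpM2l // qX_ge0.
    by apply: le_trans q50ms; move: LB60 q60 e52 e51 p52 M0; clear -q; lra.
  - move=> a aA3; apply: q_le_nat_inv.
    have sub_nb : #|nb E a :&: B|%:R <= #|nb E a :&: (B :\: SB)|%:R + #|SB|%:R :> R.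
      rewrite -natrD ler_nat; apply: leq_trans (leq_card_setU _ _).
      by apply/subset_leq_card/subsetP=> x; rewrite !inE => /andP[-> ->]; case: (x \in SB).
    have q5ms : q ^+ 5 * ms%:R <= q ^+ 5 * (M + q ^+ 60 * M) by rewrite ler_wpM2l // qX_ge0.
    have q5M : q ^+ 5 * (q ^+ 60 * M) <= q ^+ 5 * M.
      rewrite ler_wpM2l ?qX_ge0 // -[X in _ <= X]mul1r ler_wpM2r ?(ltW M0) //.
      by rewrite -(expr0 q) q_mono.
    case/setDP: aA3 => /setUP[/setDP[aA _]|aL] _.
      by have := degA a aA; move: sub_nb SB51 e51 e50 q10 q5 q5ms q5M M0; clear -q; lra.
    have : q ^+ 3 * M <= #|nb E a :&: B|%:R.
      by apply: q_le_nat; move: aL; rewrite inE => /andP[].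
    have := qSM 3; have := qSM 4; have := qmM 5 50 isT.
    by move: sub_nb SB51 e51 q5ms q5M M0; have := qM_gt0 5; clear -q; lra.
  - have sub_coll b : #|coll E b :&: A|%:R <= #|coll E b :&: A3|%:R + #|SA|%:R + #|G|%:R :> R.
      rewrite -!natrD ler_nat; apply: leq_trans (leq_add (leq_card_setU _ _) (leqnn _)).
      apply: leq_trans (leq_card_setU _ _).
      apply/subset_leq_card/subsetP=> x; rewrite in_setI => /andP[xb xA].
      rewrite !in_setU in_setI xb in_setD in_setU in_setD xA /=.
      by case: (x \in SA); case: (x \in G); rewrite ?orbT.
    move=> b bB3; apply: q_le_nat_inv.
    have q4ms : q ^+ 4 * ms%:R <= q ^+ 4 * (M + q ^+ 60 * M) by rewrite ler_wpM2l // qX_ge0.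
    have e64 : q ^+ 4 * (q ^+ 60 * M) <= q ^+ 5 * M.
      by rewrite mulrA -exprD; apply: qmM.
    have s3 := qSM 3; have s4 := qSM 4; have s2 := qSM 2.
    have s50 := qmM 6 50 isT; have s5 := qSM 5; have p5 := qM_gt0 5.
    have sb := sub_coll b.
    case/setDP: bB3 => /setUP[bB|bL] _.
      have := degB b bB; have s1 := qSM 1; have s0 := qSM 0; rewrite expr0 mul1r in s0.
      by move: sb SA51 e51 e50 q10 G60 q60 pM q4ms e64 s0 s1 s2 s3 s4 M0; clear -q; lra.
    have : q ^+ 3 * M <= #|coll E b :&: A|%:R.
      by apply: q_le_nat; move: bL; rewrite inE => /andP[].
    by move: sb SA51 e51 e52 G60 q60 q4ms e64 s3 s4 s50 s5 p5 M0; clear -q; lra.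
  - move=> b /setDP[bB _].
    have sub_coll : #|coll E b :&: A|%:R <= #|coll E b :&: A3|%:R + #|SA|%:R + #|G|%:R :> R.
      rewrite -!natrD ler_nat; apply: leq_trans (leq_add (leq_card_setU _ _) (leqnn _)).
      apply: leq_trans (leq_card_setU _ _).
      apply/subset_leq_card/subsetP=> x; rewrite in_setI => /andP[xb xA].
      rewrite !in_setU in_setI xb in_setD in_setU in_setD xA /=.
      by case: (x \in SA); case: (x \in G); rewrite ?orbT.
    rewrite -(ler_nat R) natrM; have := degB b bB.
    by move: sub_coll SA51 e51 e50 q10 G60 q60 pM ms_up M0; clear -q; lra.
pose X := A :|: B :|: L.
have sub1 : L0 :|: G \subset X.
  apply/subsetP=> x /setUP[/(subsetP sL0) xL|/(subsetP sG) xA]; first by rewrite in_setU xL orbT.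
  by rewrite !in_setU xA.
(* Two copies for the sparse leftover, one for balancing and two for the final pair. *)
rewrite (_ : 5 = 3 + 2)%N //; apply: (@tiled_split T c F 3 2 X (L0 :|: G)) => //.
have sS1 : SA :|: SB \subset X :\: (L0 :|: G).
  apply/subsetP=> x /setUP[/(subsetP sSA)/setDP[xA xG]|/(subsetP sSB) xB].
    rewrite in_setD in_setU negb_or xG !in_setU xA andbT /= andbT.
    by apply/negP=> /(subsetP sL0)/(disjointFr dLA); rewrite xA.
  rewrite in_setD in_setU negb_or !in_setU xB orbT /= andbT.
  apply/andP; split; first by apply/negP=> /(subsetP sL0)/(disjointFr dLB); rewrite xB.
  by apply/negP=> /(subsetP sG)/(disjointFr dAB); rewrite xB.
rewrite (_ : 3 = 2 + 1)%N //; apply: (tiled_split sS1) => //.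
suff -> : X :\: (L0 :|: G) :\: (SA :|: SB) = A3 :|: B3 by [].
have dSB x : x \in A :|: L -> x \notin SB.
  case/setUP=> xx; apply/negP=> /(subsetP sSB); first by rewrite (disjointFr dAB).
  by rewrite (disjointFr dLB).
have dSA x : x \in B :|: L -> x \notin SA.
  case/setUP=> xx; apply/negP=> /(subsetP sSA)/setDP[xA _].
    by have := disjointFr dAB xA; rewrite xx.
  by have := disjointFr dLA xx; rewrite xA.
have dG x : x \in B :|: L -> x \notin G.
  case/setUP=> xx; apply/negP=> /(subsetP sG) xA.
    by have := disjointFr dAB xA; rewrite xx.
  by have := disjointFr dLA xx; rewrite xA.
have dL0 x : x \in A :|: B :|: LA :|: LB -> x \notin L0.
  case/setUP=> [/setUP[/setUP[xx|xx]|xx]|xx]; apply/negP.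
  - by move/(subsetP sL0)/(disjointFr dLA); rewrite xx.
  - by move/(subsetP sL0)/(disjointFr dLB); rewrite xx.
  - by case/setDP; rewrite xx.
  - by case/setDP=> /setDP[_]; rewrite xx.
apply/eqP; rewrite eqEsubset; apply/andP; split; apply/subsetP=> x.
  case/setDP=> /setDP[xX xLG] xS; move: xLG xS; rewrite !in_setU !negb_or.
  case/andP=> xL0 xG /andP[xSA xSB].
  rewrite in_setD in_setU in_setD xSA xG /= in_setD xSB in_setU /=.
  case/setUP: xX => [/setUP[->|->]|xL]; rewrite ?orbT //.
  move: xL0; rewrite !in_setD xL andbT negb_and !negbK.
  by case/orP=> ->; rewrite ?orbT.
rewrite in_setD in_setD !(in_setU x _ SB) !(in_setU x _ G) !negb_or.
case/setUP=> /setDP[/setUP[xx|xx] xS].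
- case/setDP: xx => xA xG; rewrite xS xG dSB ?in_setU ?xA // dL0 //.
  by rewrite !in_setU xA.
- have xL := subsetP sLA _ xx; rewrite xS dSB ?dG ?dL0 // !in_setU ?xL ?xx ?orbT //.
- by rewrite xS dSA ?dG ?dL0 // !in_setU xx ?orbT.
- have xL := subsetP sLB _ xx; rewrite xS dSA ?dG ?dL0 // !in_setU ?xL ?xx ?orbT //.
Qed.

End Core.

(** * Choice of constants and assembly *)

Section Assembly.

Import Order.TTheory GRing.Theory Num.Theory.
Local Open Scope ring_scope.

Variables (R : realFieldType) (D : nat).
Hypothesis D_gt0 : (0 < D)%N.
Let q : R := 2^-1 ^+ D.
Let p : R := q ^+ 52.

Lemma p_le : p <= 1 / 8.
Proof.
have := qS R D_gt0 0; have := qS R D_gt0 1; have := qS R D_gt0 2.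
have := q_mono R D_gt0 (isT : (3 <= 52)%N); rewrite -/q -/p expr0; clear -q; lra.
Qed.

(** The exponent is 108 = 2 * 52 + 4: it cancels p^2 and leaves 2^(4 D) >= 16. *)
Lemma pp_large : 16 <= p * p * (2 ^ (108 * D))%:R.
Proof.
have -> : p * p * (2 ^ (108 * D))%:R = (2 ^ (4 * D))%:R.
  rewrite /p -exprD [LHS]mulrC (_ : (108 = 4 + 104)%N) // mulnDl expnD natrM.
  by rewrite -mulrA expn_q mulr1.
rewrite -[X in X <= _]/(16%:R) ler_nat (_ : 16 = 2 ^ 4)%N // leq_exp2l //.
by rewrite -[X in (X <= _)%N]muln1 leq_mul2l.
Qed.

(** Here 160 = 3 * 52 + 4: the number of rounds times p^3 / 2 is 2^(4 D) / 2 >= 8, so Bernoulli's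
    inequality pushes the density above 1. *)
Lemma increment_wins : 1 < 1 / 2 * (1 + p * p * p / 2) ^+ (2 ^ (160 * D)).
Proof.
have p0 : 0 < p by apply: qX_gt0.
have t0 : 0 <= p * p * p / 2 by exact: ltW (divr_gt0 (mulr_gt0 (mulr_gt0 p0 p0) p0) (ltr0n _ 2)).
have := bernoulli (2 ^ (160 * D)) t0.
have -> : (2 ^ (160 * D))%:R * (p * p * p / 2) = (2 ^ (4 * D))%:R / 2.
  rewrite mulrA; congr (_ / 2); rewrite /p -!exprD.
  by rewrite (_ : (160 = 4 + 156)%N) // mulnDl expnD natrM -mulrA expn_q mulr1.
have : 16 <= (2 ^ (4 * D))%:R :> R.
  rewrite -[X in X <= _]/(16%:R) ler_nat (_ : 16 = 2 ^ 4)%N // leq_exp2l //.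
  by rewrite -[X in (X <= _)%N]muln1 leq_mul2l.
by clear -q; lra.
Qed.

Lemma tiled_large (T : finType) (c : edge_coloring T) (F : graph_sequence) J
    (k := (108 * D * J)%N) :
  bounded_sequence D F -> bipartite_sequence F -> 1 < 1 / 2 * (1 + p * p * p / 2) ^+ J ->
  (2 ^ (k + 72 * D).+1 <= #|T|)%N ->
  tiled c F (2 ^ (10 * D).+1 * (60 * D + (k + 3)) + 5) [set: T].
Proof.
move=> boundF bipF winJ largeT; pose n0 := (#|T| %/ 2)%N.
have n0_ge : (2 ^ (k + 72 * D) <= n0)%N by rewrite leq_divRL // -expnSr.
have [A _ cA] : exists2 A : {set T}, A \subset setT & #|A| = n0.
  by apply: subset_of_card; rewrite cardsT leq_div.
have [B sB cB] : exists2 B : {set T}, B \subset ~: A & #|B| = n0.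
  by apply: subset_of_card; rewrite cardsCs setCK cA /n0; clear; lia.
have [col le_col] := majority_color c A B; rewrite cA cB in le_col.
pose E : rel T := fun x y => c x y == col.
have dense : 1 / 2 * n0%:R * n0%:R <= edges R E A B.
  rewrite /edges -natr_sum; move: le_col; rewrite -(ler_nat R) !natrM.
  have -> : (\sum_(a in A) #|[set b in B | c a b == col]| = \sum_(a in A) #|nb E a :&: B|)%N.
    by apply: eq_bigr => a _; apply: eq_card => b; rewrite !inE andbC.
  by clear -p; lra.
have p0 : 0 < p by apply: qX_gt0.
have t0 : 0 <= p * p * p / 2 by exact: ltW (divr_gt0 (mulr_gt0 (mulr_gt0 p0 p0) p0) (ltr0n _ 2)).
have S0 : (0 < 2 ^ (108 * D))%N by rewrite expn_gt0.
have SJ : ((2 ^ (108 * D)) ^ J = 2 ^ k)%N by rewrite -expnM.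
have [|A' [B' [m [d [[sA' sB' cA' cB'] m_ge /andP[d_ge d_le] dense' upper]]]]] :=
  density_increment S0 t0 cA cB dense (J := J) _ winJ.
  by rewrite SJ; apply: leq_trans n0_ge; rewrite leq_exp2l // leq_addr.
have {}m_ge : (n0 %/ 2 ^ k <= m)%N by rewrite -SJ.
have m72 : (2 ^ (72 * D) <= m)%N.
  by apply: leq_trans m_ge; rewrite leq_divRL ?expn_gt0 // -expnD addnC.
have m_gt0 : (0 < m)%N by apply: leq_trans m72; rewrite expn_gt0.
have T_le : (#|T| <= 2 ^ (k + 3) * m)%N.
  have lt_n0 : (n0 < m.+1 * 2 ^ k)%N by rewrite -ltn_divLR ?expn_gt0.
  rewrite expnD; move: lt_n0 m_gt0; rewrite /n0; move: (2 ^ k)%N => K; clear.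
  by rewrite mulSn; nia.
pose Ah := A_hi E A' B' m p d; pose Bh := B_hi E A' B' m d.
have lo_A : #|A' :\: Ah|%:R <= p * m%:R.
  exact: (card_A_lo p0 p_le cA' cB' m_gt0 S0 pp_large d_ge dense' upper).
have lo_B : #|B' :\: Bh|%:R <= p * m%:R.
  exact: (card_B_lo p0 p_le cA' cB' m_gt0 S0 pp_large d_ge dense' upper).
have sAh : Ah \subset A' by apply/subsetP=> x; rewrite inE => /andP[].
have sBh : Bh \subset B' by apply/subsetP=> x; rewrite inE => /andP[].
have dAB : [disjoint Ah & Bh].
  apply: disjointWl (subset_trans sAh sA') _; apply: disjointWr (subset_trans sBh sB') _.
  by rewrite disjoint_sym disjoints_subset.
(* By [T_le], k + 3 halvings bring the leftover down to m, and 60 D more down to q^60 m. If the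
   process stops early, 60 D + 10 D + 1 <= 72 D suffices. *)
have [L [sL orL tL]] := greedy_tiling c D_gt0 boundF bipF (~: (Ah :|: Bh)) (60 * D + (k + 3)).
have cL : (2 ^ (60 * D) * #|L| <= m)%N.
  case/orP: orL => [ltL|leL].
    apply: leq_trans m72; apply: leq_trans (leq_mul (leqnn _) (ltnW ltL)) _.
    by rewrite -expnD leq_exp2l //; move: D_gt0; clear; lia.
  rewrite -(leq_pmul2l (expn_gt0 2 (k + 3))); apply: leq_trans T_le.
  rewrite mulnA -expnD addnC mulnC; apply: leq_trans leL (max_card _).
have [dLA dLB] : [disjoint L & Ah] /\ [disjoint L & Bh].
  move: sL; rewrite setCU subsetI => /andP[s1 s2].
  by rewrite !disjoints_subset.
have cAh : #|A' :\: Ah|%:R = m%:R - #|Ah|%:R :> R.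
  by rewrite cardsDS // cA' natrB // -cA' subset_leq_card.
have cBh : #|B' :\: Bh|%:R = m%:R - #|Bh|%:R :> R.
  by rewrite cardsDS // cB' natrB // -cB' subset_leq_card.
have M0 : 0 < m%:R :> R by rewrite ltr0n.
have pM : p * m%:R <= m%:R / 64.
  have := q_mono R D_gt0 (isT : (6 <= 52)%N); rewrite -/q -/p => p6.
  have : p <= 1 / 64; last by move=> h; have := ler_wpM2r (ltW M0) h; clear -p; lra.
  move: p6; have := qS R D_gt0 0; have := qS R D_gt0 1; have := qS R D_gt0 2.
  have := qS R D_gt0 3; have := qS R D_gt0 4; have := qS R D_gt0 5.
  by rewrite -/q expr0; clear -p; lra.
have dM : m%:R / 2 <= d * m%:R.
  by have := ler_wpM2r (ltW M0) d_ge; clear -p; lra.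
apply: (@tiled_split T c F _ _ setT (Ah :|: Bh :|: L)) => //.
  by rewrite setTD setCU -setDE.
apply: (@tiled_core R D T c F col Ah Bh L m d) => //.
- by move: lo_A; rewrite cAh -/p; clear -p; lra.
- by rewrite -cA' subset_leq_card.
- by move: lo_B; rewrite cBh -/p; clear -p; lra.
- by rewrite -cB' subset_leq_card.
- move=> U sU leU.
  apply: (upper_regular_typical p0 p_le cB' m_gt0 S0 pp_large d_ge upper) => //.
  exact: subset_trans sU sBh.
- move=> a; rewrite inE => /andP[_ deg_a].
  have : (#|nb E a :&: B'| <= #|nb E a :&: Bh| + #|B' :\: Bh|)%N.
    apply: leq_trans (leq_card_setU _ _); apply/subset_leq_card/subsetP=> x.
    by rewrite !(inE, in_setU, in_setD) => /andP[-> ->]; case: (_ <= _).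
  rewrite -(ler_nat R) natrD => h.
  have pp : p * p / 2 <= 1 / 8.
    by have := ler_wpM2l (ltW p0) p_le; have := p_le; move: p0; clear -p; lra.
  have dM0 : 0 <= d * m%:R by move: M0 dM; clear -p; lra.
  have := ler_wpM2r dM0 pp.
  by move: h deg_a lo_B pM dM M0; clear -p; lra.
- move=> b; rewrite inE => /andP[_ deg_b].
  have : (#|coll E b :&: A'| <= #|coll E b :&: Ah| + #|A' :\: Ah|)%N.
    apply: leq_trans (leq_card_setU _ _); apply/subset_leq_card/subsetP=> x.
    by rewrite !(inE, in_setU, in_setD) => /andP[-> ->]; case: (_ <= _).
  rewrite -(ler_nat R) natrD; move: deg_b lo_A pM dM M0; clear -p; lra.
Qed.

End Assembly.

(** For degree bound 0 the allowed number of pieces is 1, so a single copy has to cover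
    everything. *)
Lemma tiled_edgeless (T : finType) (c : edge_coloring T) (F : graph_sequence) :
  bounded_sequence 0 F -> tiled c F 1 [set: T].
Proof.
move=> boundF; have [->|[x _]] := set_0Vmem [set: T]; first exact: tiled0.
have cT : #|[set: T]| = #|T| by rewrite cardsT.
have edgeless i j : F #|T| i j = false.
  have := degree_bounded i boundF; rewrite leqn0 cards_eq0 => /eqP/setP/(_ j).
  by rewrite !inE.
rewrite -(enum_pt_image cT 1%g); apply/tiled_piece.
apply: (mono_piece_embed (col := true)) => [|i j|i j].
- by apply/card_gt0P; exists x.
- by move=> /enum_pt_inj; rewrite !permE.
- by rewrite edgeless.
Qed.

Lemma piece_count_bound D (k := 108 * D * 2 ^ (160 * D)) : 0 < D ->
  2 ^ (10 * D).+1 * (k + 72 * D + 8) <= 2 ^ (180 * D).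
Proof.
move=> D_gt0; rewrite (_ : 180 = 11 + 169) // mulnDl expnD; apply: leq_mul.
  by rewrite leq_exp2l // mulSn -add1n leq_add2r.
rewrite (_ : 169 = 8 + 1 + 160) // 2!mulnDl 2!expnD mul1n.
have J_gt0 : 0 < 2 ^ (160 * D) by rewrite expn_gt0.
(* 188 = 108 + 72 + 8 collects the coefficients once every term is bounded by a multiple of D 2^(160
   D). *)
have le8 : 188 <= 2 ^ (8 * D).
  by apply: leq_trans (_ : 2 ^ 8 <= _); rewrite // leq_exp2l // leq_pmulr.
have leD : D <= 2 ^ D by rewrite ltnW // ltn_expl.
apply: leq_trans (leq_mul (leq_mul le8 leD) (leqnn _)).
rewrite /k; move: J_gt0 D_gt0; move: (2 ^ (160 * D)) => J; clear; nia.
Qed.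

Lemma tiled_all D (T : finType) (c : edge_coloring T) (F : graph_sequence) :
  bounded_sequence D F -> bipartite_sequence F -> tiled c F (2 ^ (180 * D)) [set: T].
Proof.
case: (posnP D) => [->|D_gt0] boundF bipF; first exact: tiled_edgeless.
apply: tiled_leq (piece_count_bound D_gt0) _.
set k := 108 * D * _.
have [smallT|largeT] := ltnP #|T| (2 ^ (k + 72 * D).+1); last first.
  apply: tiled_leq _ (tiled_large D_gt0 c boundF bipF (increment_wins rat D_gt0) largeT).
  have -> : k + 72 * D + 8 = (k + 72 * D + 3) + 5 by rewrite -[RHS]addnA.
  rewrite -/k [X in _ <= X]mulnDr; apply: leq_add; last first.
    by rewrite leq_pmull // expn_gt0.
  by rewrite leq_mul2l addnCA -addnA leq_add2l leq_add2r leq_mul2r !orbT.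
(* A vertex set too small for a regular pair is halved until fewer than 2^(10 D + 1) vertices
   remain, which become single-vertex copies. *)
have [L [_ orL tL]] := greedy_tiling c D_gt0 boundF bipF setT (k + 72 * D).+1.
have ltL : #|L| < 2 ^ (10 * D).+1.
  case/orP: orL => // leL; have : #|L| * 2 ^ (k + 72 * D).+1 < 2 ^ (k + 72 * D).+1.
    by apply: leq_ltn_trans smallT; rewrite -cardsT.
  by rewrite -[X in _ < X]mul1n ltn_mul2r ltnS leqn0 => /andP[_ /eqP->]; rewrite expn_gt0.
apply: tiled_leq _ (tiled_split (subsetT L) tL (tiled_singletons c F L)).
move: (k + 72 * D) ltL; move: (2 ^ (10 * D).+1) => x y ltL.
rewrite mulnSr mulnDr -addnA leq_add2l; apply: leq_trans (_ : x * 2 <= _).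
  by rewrite muln2 -addnn leq_add2l ltnW.
by rewrite leq_mul2l orbT.
Qed.

Theorem theorem2 :
  exists C : nat,
  forall (Delta : nat) (F : graph_sequence),
    bounded_sequence Delta F -> bipartite_sequence F ->
  forall (T : finType) (c : edge_coloring T),
  exists (k : nat) (H : 'I_k -> subgraph T),
    [/\ k <= 2 ^ (C * Delta),
        forall i, mono_copy_from c F (H i)
      & vertex_partition H].
Proof.
exists 180 => Delta F boundF bipF T c.
exact: tiled_partition (tiled_all c boundF bipF).
Qed.
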